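(* For every $k\ge1$, $\mathcal{R}_{U_k}(W_{1.5})=\mathrm{NP}$.
   Context: The 1.5-way tape $W_{1.5}$ has cells $0,1,2,\dots$, initial cell $0$, and from each cell $n$ an edge $n\to n+1$ marked $+$ and an edge $n\to 0$ marked $-$. An $h$-head automaton with auxiliary memory of model $W_{1.5}$ has a finite state set, input alphabet $\Sigma$ with endmarkers $\triangleleft,\triangleright$, a finite memory alphabet $\Delta$, a transition function mapping (state, the $h$ symbols under its 2-way read-only input heads, the current memory symbol) to (new state, a move in $\{-1,0,+1\}$ per head, and $+$, $-$ or ''stay'' for the memory position), an initial state and accepting states; it starts with heads at the leftmost input symbol and memory at cell $0$ and runs deterministically for a fixed memory content $\mu\colon\{0,1,\dots\}\to\Delta$. For a set $\mathcal{T}$ of memory contents, the automaton accepts $w$ with a $\mathcal{T}$-restricted guess iff it reaches an accepting state on some $\mu\in\mathcal{T}$; $\mathcal{R}_{\mathcal{T}}(W_{1.5})$ is the class of languages recognized in this sense (any number of heads). For $\Delta=\{0\}\cup\Delta'$, $U_k$ (the $k$-sparse guesses) is the set of memory contents with at most $k$ cells containing symbols from $\Delta'$. *)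

(* Defs.v *)
From HB Require Import structures.
From mathcomp Require Import all_boot all_order all_algebra.

Set Implicit Arguments.
Unset Strict Implicit.
Unset Printing Implicit Defensive.

Import GRing.Theory.

Inductive move := MLeft | MStay | MRight.

Inductive insym (Sigma : Type) := LEnd | REnd | Letter of Sigma.
Arguments LEnd {Sigma}.
Arguments REnd {Sigma}.

Inductive memop := MemPlus | MemMinus | MemStay.

Definition w15_move (op : memop) (n : nat) : nat :=
  match op with MemPlus => n.+1 | MemMinus => 0 | MemStay => n end.

(* [aut_zero] is the symbol 0 of Delta = {0} u Delta', so that Delta' consists
   of the symbols other than [aut_zero]. *)
Record automaton (Sigma : finType) (h : nat) := Automaton {
  aut_state : finType;
  aut_mem : finType;
  aut_zero : aut_mem;
  aut_trans : aut_state -> {ffun 'I_h -> insym Sigma} -> aut_mem ->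
              aut_state * {ffun 'I_h -> move} * memop;
  aut_init : aut_state;
  aut_acc : {set aut_state}
}.

(* Input positions are 0 (left endmarker), 1 .. size w (letters) and
   (size w).+1 (right endmarker). *)
Definition insym_at (Sigma : Type) (w : seq Sigma) (i : nat) : insym Sigma :=
  nth REnd (LEnd :: map (@Letter Sigma) w) i.

(* A head told to leave the tape stays on the endmarker. *)
Definition head_move (len : nat) (d : move) (i : nat) : nat :=
  match d with
  | MLeft => i.-1
  | MStay => i
  | MRight => minn i.+1 len.+1
  end.

Record aconfig (Sigma : finType) (h : nat) (A : automaton Sigma h) := AConfig {
  ac_state : aut_state A;
  ac_head : 'I_h -> nat;
  ac_cell : nat
}.

Definition aut_start (Sigma : finType) (h : nat) (A : automaton Sigma h) :
  aconfig A := AConfig (aut_init A) (fun _ => 1) 0.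

Definition aut_step (Sigma : finType) (h : nat) (A : automaton Sigma h)
    (w : seq Sigma) (mu : nat -> aut_mem A) (c : aconfig A) : aconfig A :=
  let: (q, d, op) :=
    aut_trans (ac_state c) [ffun i => insym_at w (ac_head c i)]
              (mu (ac_cell c)) in
  AConfig q (fun i => head_move (size w) (d i) (ac_head c i))
          (w15_move op (ac_cell c)).

Definition aut_accepts (Sigma : finType) (h : nat) (A : automaton Sigma h)
    (w : seq Sigma) (mu : nat -> aut_mem A) : Prop :=
  exists t : nat, ac_state (iter t (aut_step w mu) (aut_start A)) \in aut_acc A.

Definition guess_set := forall D : finType, D -> (nat -> D) -> Prop.

Definition sparse (k : nat) : guess_set := fun D zero mu =>
  exists s : seq nat, size s <= k /\ forall n, mu n != zero -> n \in s.

Definition R_W15 (T : guess_set) (Sigma : finType) (L : seq Sigma -> Prop) :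
    Prop :=
  exists (h : nat) (A : automaton Sigma h), forall w : seq Sigma,
    L w <-> exists mu : nat -> aut_mem A,
              T (aut_mem A) (aut_zero A) mu /\ aut_accepts w mu.

(* There are m.+1 two-way infinite tapes; tape [ord0] carries the input. *)
Record ntm (Sigma : finType) (m : nat) := Ntm {
  tm_state : finType;
  tm_sym : finType;
  tm_blank : tm_sym;
  tm_letter : Sigma -> tm_sym;
  tm_letter_inj : injective tm_letter;
  tm_letter_blank : forall a, tm_letter a != tm_blank;
  tm_trans : tm_state -> {ffun 'I_m.+1 -> tm_sym} ->
             tm_state -> {ffun 'I_m.+1 -> tm_sym} -> {ffun 'I_m.+1 -> move} ->
             bool;
  tm_init : tm_state;
  tm_acc : {set tm_state}
}.

Record tconfig (Sigma : finType) (m : nat) (M : ntm Sigma m) := TConfig {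
  tc_state : tm_state M;
  tc_head : 'I_m.+1 -> int;
  tc_tape : 'I_m.+1 -> int -> tm_sym M
}.

Definition move_int (d : move) (x : int) : int :=
  match d with MLeft => (x - 1)%R | MStay => x | MRight => (x + 1)%R end.

Definition tm_start (Sigma : finType) (m : nat) (M : ntm Sigma m)
    (w : seq Sigma) : tconfig M :=
  TConfig (tm_init M) (fun _ => 0%R)
    (fun i x => if (i == ord0, x) is (true, Posz n)
                then nth (tm_blank M) (map (@tm_letter _ _ M) w) n
                else tm_blank M).

Definition tm_step (Sigma : finType) (m : nat) (M : ntm Sigma m)
    (c c' : tconfig M) : Prop :=
  exists (q : tm_state M) (s : {ffun 'I_m.+1 -> tm_sym M})
         (d : {ffun 'I_m.+1 -> move}),
    tm_trans (tc_state c) [ffun i => tc_tape c i (tc_head c i)] q s d /\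
    c' = TConfig q (fun i => move_int (d i) (tc_head c i))
           (fun i x => if x == tc_head c i then s i else tc_tape c i x).

Inductive tm_reach (Sigma : finType) (m : nat) (M : ntm Sigma m)
    (c : tconfig M) : nat -> tconfig M -> Prop :=
| tm_reach0 : tm_reach c 0 c
| tm_reachS t c1 c2 : tm_reach c t c1 -> tm_step c1 c2 -> tm_reach c t.+1 c2.

Definition tm_accepts (Sigma : finType) (m : nat) (M : ntm Sigma m)
    (w : seq Sigma) : Prop :=
  exists (t : nat) (c : tconfig M),
    tm_reach (tm_start M w) t c /\ tc_state c \in tm_acc M.

(* Every computation path, accepting or not, halts within n ^ e + e steps. *)
Definition tm_polytime (Sigma : finType) (m : nat) (M : ntm Sigma m) : Prop :=
  exists e : nat, forall (w : seq Sigma) (t : nat) (c : tconfig M),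
    tm_reach (tm_start M w) t c -> t <= size w ^ e + e.

Definition NP (Sigma : finType) (L : seq Sigma -> Prop) : Prop :=
  exists (m : nat) (M : ntm Sigma m),
    tm_polytime M /\ forall w : seq Sigma, L w <-> tm_accepts M w.

(* Main.v *)
(* NP in R: an accepting computation is a word of letters.  A word over {0, 1} is
   stored in the position of a single mark by the Chinese remainder theorem: for
   each letter one odd modulus, read off by walking to the mark while counting
   modulo that modulus on counters held by the input heads.  The automaton checks
   the computation one tape cell at a time, rereading the whole word for each
   watched cell, so that polynomially bounded counters suffice.

   R in NP: with the marks and their symbols fixed, the automaton runs on k.+1
   gaps.  Inside a gap it reads only zeros, so it either leaves by a minus move or
   accepts after a short run (the gap is at least that long), or meets the mark
   after a short run or in a short cycle (the gap length is a given number or lies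
   in a given arithmetic progression).  A nondeterministic machine guesses the mark
   symbols and the way each gap is traversed and logs these constraints.  Finitely
   many points, rays and progressions have a common element once every two of them
   meet, which the machine checks by walking on two blocks of the log at once. *)

From HB Require Import structures.
From mathcomp Require Import all_boot all_order all_algebra.
From mathcomp Require Import zify.
From Stdlib Require Classical_Prop.
Require Import Defs.

Set Implicit Arguments.
Unset Strict Implicit.
Unset Printing Implicit Defensive.

(** Heads yield counters of polynomial range only, while the mark may lie exponentially far away, so
    its position is visible through residues alone. The automaton need not know which moduli were
    meant to carry letters, because all others are made silent. This dictates the moduli: they are
    odd so that the residue 1 is silent, and the carriers are primes above the square root of the
    bound so that no composite modulus can speak. Chebyshev's estimate supplies enough such primes.
    Conversely, gap lengths and running times may be exponential, so a machine can neither guess a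
    length in unary nor replay a run. What is short is the orbit inside a gap of zeros: there are
    polynomially many configurations, hence a short lead-in and a short period. The obstacle is that
    a gap is crossed many times and all crossings must agree on one length; a Helly property of
    points, rays and progressions reduces this to pairs. Since [NP] asks every path to halt, the
    guessing machine runs under a clock made of the same counters as in the first half. *)

Definition move_code (d : move) : option bool :=
  match d with MLeft => Some false | MStay => None | MRight => Some true end.

Definition move_decode (o : option bool) : move :=
  match o with Some false => MLeft | None => MStay | Some true => MRight end.

Lemma move_codeK : cancel move_code move_decode.
Proof. by case. Qed.

Module MoveFinite.
HB.instance Definition _ := Equality.copy move (can_type move_codeK).
HB.instance Definition _ := Choice.copy move (can_type move_codeK).
HB.instance Definition _ := Countable.copy move (can_type move_codeK).
HB.instance Definition _ := Finite.copy move (can_type move_codeK).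
End MoveFinite.
Export MoveFinite.

(** * Numbers written in base [b] *)

Section Digits.
Variable b : nat.
Implicit Types (d : nat -> nat) (e j : nat).

Definition numval e d := \sum_(j < e) d j * b ^ j.

Definition carry d j := all (fun i => d i == b.-1) (iota 0 j).
Definition borrow d j := all (fun i => d i == 0) (iota 0 j).

(** Carries are not propagated: each digit decides from the old digits below it whether it changes.
    All digits can thus change simultaneously, so heads update a counter in one step. *)
Definition digit_inc d j :=
  if carry d j then if d j == b.-1 then 0 else (d j).+1 else d j.
Definition digit_dec d j :=
  if borrow d j then if d j == 0 then b.-1 else (d j).-1 else d j.

Lemma carryS d j : carry d j.+1 = carry d j && (d j == b.-1).
Proof. by rewrite /carry -addn1 iotaD all_cat /= andbT. Qed.

Lemma borrowS d j : borrow d j.+1 = borrow d j && (d j == 0).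
Proof. by rewrite /borrow -addn1 iotaD all_cat /= andbT. Qed.

Lemma numvalS e d : numval e.+1 d = numval e d + d e * b ^ e.
Proof. exact: big_ord_recr. Qed.

Lemma eq_numval e d d' : (forall j, j < e -> d j = d' j) ->
  numval e d = numval e d'.
Proof. by move=> eqd; apply: eq_bigr => j _; rewrite eqd. Qed.

(** At each place, new digit + b times carry out = old digit + carry in; weighted with the powers of
    [b], the carries telescope to the overflow term. *)
Lemma numval_inc e d : 0 < b ->
  numval e (digit_inc d) + carry d e * b ^ e = (numval e d).+1.
Proof.
move=> b0; elim: e => [|e IH]; first by rewrite /numval !big_ord0.
have step : digit_inc d e + carry d e.+1 * b = d e + carry d e.
  rewrite /digit_inc carryS; case: (carry d e) => /=; last by rewrite mul0n.
  by case: eqP => [->|_] /=; lia.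
rewrite !numvalS expnS.
have -> : carry d e.+1 * (b * b ^ e) = carry d e.+1 * b * b ^ e by rewrite mulnA.
by rewrite -addnA -mulnDl step mulnDl; lia.
Qed.

Lemma numval_dec e d : 0 < b ->
  (numval e (digit_dec d)).+1 = numval e d + borrow d e * b ^ e.
Proof.
move=> b0; elim: e => [|e IH]; first by rewrite /numval !big_ord0.
have step : digit_dec d e + borrow d e = d e + borrow d e.+1 * b.
  rewrite /digit_dec borrowS; case: (borrow d e) => /=; last by rewrite mul0n.
  by case: eqP => [->|/eqP] /=; lia.
rewrite !numvalS expnS.
have -> : borrow d e.+1 * (b * b ^ e) = borrow d e.+1 * b * b ^ e by rewrite mulnA.
have : (digit_dec d e + borrow d e) * b ^ e = (d e + borrow d e.+1 * b) * b ^ e.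
  by rewrite step.
rewrite !mulnDl; lia.
Qed.

Lemma numval_eq0 e d : 0 < b -> (numval e d == 0) = borrow d e.
Proof.
move=> b0; elim: e => [|e IH]; first by rewrite /numval big_ord0.
by rewrite numvalS addn_eq0 IH muln_eq0 expn_eq0 borrowS (negbTE (lt0n_neq0 b0)) orbF.
Qed.

Lemma numval_lt e d : 0 < b -> (forall j, j < e -> d j < b) -> numval e d < b ^ e.
Proof.
move=> b0; elim: e => [|e IH] db; first by rewrite /numval big_ord0.
have H1 := IH (fun j ltj => db j (ltnW ltj)); have H2 := db e (ltnSn e).
rewrite numvalS expnS.
have : (d e).+1 * b ^ e <= b * b ^ e by rewrite leq_mul2r H2 orbT.
by rewrite mulSn; lia.
Qed.

End Digits.

(** The wraparound is put to use: it represents negative head positions, and a counter that returns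
    to zero after [N] increments reveals [N] to a machine that does not know it. *)
Definition ctr_op (N : nat) (d : move) (v : nat) : nat :=
  match d with
  | MLeft => if v == 0 then N.-1 else v.-1
  | MStay => v
  | MRight => if v.+1 == N then 0 else v.+1
  end.

Lemma ctr_op_lt N d v : v < N -> ctr_op N d v < N.
Proof. by case: d => //=; case: ifP; lia. Qed.

Lemma numval_inc_ctr b e d : 0 < b -> (forall j, j < e -> d j < b) ->
  (forall j, j < e -> digit_inc b d j < b) ->
  numval b e (digit_inc b d) = ctr_op (b ^ e) MRight (numval b e d).
Proof.
move=> b0 db db'; have := numval_inc e d b0; have := numval_lt b0 db.
have := numval_lt b0 db'; rewrite /=; case: ifP; case: carry; rewrite /=; lia.
Qed.

Lemma numval_dec_ctr b e d : 0 < b ->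
  numval b e (digit_dec b d) = ctr_op (b ^ e) MLeft (numval b e d).
Proof.
move=> b0; have := numval_dec e d b0; have := numval_eq0 e d b0; rewrite /=.
by case: borrow => /=; case: eqP => //= ; lia.
Qed.

Lemma digit_inc_lt b d j : d j < b -> digit_inc b d j < b.
Proof. by rewrite /digit_inc; case: carry => //; case: eqP; lia. Qed.

(** * Counters carried by input heads *)

(* A digit is a head position [p] in [0, n.+1] together with a direction bit:
   its value is [p] or [n.+1 - p].  Flipping the bit exchanges the digits [0]
   and [n.+1], so a carry or a borrow needs no motion and every counter
   operation takes a single step. *)

Section HeadDigits.
Implicit Types (dir atl atr : nat -> bool) (pos : nat -> nat).

Definition digit_val n dir pos j := if dir j then pos j else n.+1 - pos j.

Definition sees_zero dir atl atr j := if dir j then atl j else atr j.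
Definition sees_max dir atl atr j := if dir j then atr j else atl j.

Definition digit_acts (op : move) dir atl atr j :=
  match op with
  | MLeft => all (sees_zero dir atl atr) (iota 0 j)
  | MStay => false
  | MRight => all (sees_max dir atl atr) (iota 0 j)
  end.

Definition digit_wraps (op : move) dir atl atr j :=
  match op with
  | MLeft => sees_zero dir atl atr j
  | MStay => false
  | MRight => sees_max dir atl atr j
  end.

Definition digit_dir op dir atl atr j :=
  dir j (+) (digit_acts op dir atl atr j && digit_wraps op dir atl atr j).

Definition digit_move op dir atl atr j :=
  if digit_acts op dir atl atr j && ~~ digit_wraps op dir atl atr j then
    match op with
    | MLeft => if dir j then MLeft else MRight
    | MStay => MStay
    | MRight => if dir j then MRight else MLeft
    end
  else MStay.

Variables (n e : nat) (dir atl atr : nat -> bool) (pos : nat -> nat).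
Hypothesis pos_le : forall j, j < e -> pos j <= n.+1.
Hypothesis atlE : forall j, j < e -> atl j = (pos j == 0).
Hypothesis atrE : forall j, j < e -> atr j = (pos j == n.+1).

Lemma sees_zeroE j : j < e ->
  sees_zero dir atl atr j = (digit_val n dir pos j == 0).
Proof.
move=> je; rewrite /sees_zero /digit_val atlE // atrE //.
by have := pos_le je; case: (dir j) => //=; lia.
Qed.

Lemma sees_maxE j : j < e ->
  sees_max dir atl atr j = (digit_val n dir pos j == n.+1).
Proof.
move=> je; rewrite /sees_max /digit_val atlE // atrE //.
by have := pos_le je; case: (dir j) => //=; lia.
Qed.

Lemma all_sees_zero j : j <= e ->
  all (sees_zero dir atl atr) (iota 0 j) = borrow (digit_val n dir pos) j.
Proof.
move=> je; apply: eq_in_all => i; rewrite mem_iota /= add0n => ij.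
by rewrite sees_zeroE //; lia.
Qed.

Lemma all_sees_max j : j <= e ->
  all (sees_max dir atl atr) (iota 0 j) = carry n.+2 (digit_val n dir pos) j.
Proof.
move=> je; apply: eq_in_all => i; rewrite mem_iota /= add0n => ij.
by rewrite sees_maxE //; lia.
Qed.

Lemma digit_val_lt j : j < e -> digit_val n dir pos j < n.+2.
Proof. by move=> /pos_le; rewrite /digit_val; case: (dir j); lia. Qed.

(** No counter head is pushed beyond an endmarker, so the truncation in [head_move] never acts. The
    clock of the Turing machine, whose heads move on the integers, relies on this. *)
Lemma digit_move_in op j : j < e ->
  match digit_move op dir atl atr j with
  | MLeft => 0 < pos j
  | MStay => true
  | MRight => pos j < n.+1
  end.
Proof.
move=> je; rewrite /digit_move; have pj := pos_le je.
case: ifP => // /andP[_].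
case: op => //=; rewrite /sees_zero /sees_max; case: (dir j);
  by rewrite ?atlE ?atrE //; lia.
Qed.

Lemma digit_step_val op j : j < e ->
  digit_val n (digit_dir op dir atl atr)
     (fun j => head_move n (digit_move op dir atl atr j) (pos j)) j =
  match op with
  | MLeft => digit_dec n.+2 (digit_val n dir pos) j
  | MStay => digit_val n dir pos j
  | MRight => digit_inc n.+2 (digit_val n dir pos) j
  end.
Proof.
move=> je; have pj := pos_le je.
rewrite /digit_dec /digit_inc /digit_move {1}/digit_val /digit_dir.
case: op => /=.
- rewrite all_sees_zero ?(ltnW je) //; case: borrow => /=; last by rewrite addbF.
  rewrite sees_zeroE // /digit_val.
  by case: (dir j) => /=; case: eqP => //=; lia.
- by rewrite addbF.
- rewrite all_sees_max ?(ltnW je) //; case: carry => /=; last by rewrite addbF.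
  rewrite sees_maxE // /digit_val.
  by case: (dir j) => /=; case: eqP => //=; lia.
Qed.

Lemma counter_step op :
  numval n.+2 e (digit_val n (digit_dir op dir atl atr)
     (fun j => head_move n (digit_move op dir atl atr j) (pos j))) =
  ctr_op (n.+2 ^ e) op (numval n.+2 e (digit_val n dir pos)).
Proof.
rewrite (eq_numval _ (fun j je => digit_step_val op je)).
case: op => //; first exact: numval_dec_ctr.
apply: numval_inc_ctr => // j je; first exact: digit_val_lt.
exact/digit_inc_lt/digit_val_lt.
Qed.

Lemma counter_zeroE :
  all (sees_zero dir atl atr) (iota 0 e) =
  (numval n.+2 e (digit_val n dir pos) == 0).
Proof. by rewrite all_sees_zero // numval_eq0. Qed.

Lemma counter_maxE :
  all (sees_max dir atl atr) (iota 0 e) =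
  ((numval n.+2 e (digit_val n dir pos)).+1 == n.+2 ^ e).
Proof.
rewrite all_sees_max //.
have := numval_inc e (digit_val n dir pos) (ltn0Sn n.+1).
have := numval_lt (ltn0Sn n.+1) digit_val_lt.
have := @numval_lt n.+2 e (digit_inc n.+2 (digit_val n dir pos)) (ltn0Sn n.+1)
  (fun j je => digit_inc_lt (digit_val_lt je)).
case: carry => /=; lia.
Qed.

End HeadDigits.

(** * Counter machines and their compilation to multihead automata *)

Record counter_machine (Sigma : finType) := CounterMachine {
  cm_state : finType;
  cm_ctr : finType;
  cm_trans : cm_state -> insym Sigma -> {ffun cm_ctr -> bool} -> bool ->
             cm_state * move * (cm_ctr -> move) * memop;
  cm_init : cm_state;
  cm_acc : pred cm_state
}.

Record cm_config (Sigma : finType) (C : counter_machine Sigma) := CmConfig {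
  cc_state : cm_state C;
  cc_raw : nat;
  cc_ctr : cm_ctr C -> nat;
  cc_cell : nat
}.

Section CounterMachine.
Variables (Sigma : finType) (C : counter_machine Sigma).

Definition cm_start : cm_config C := CmConfig (cm_init C) 1 (fun _ => 0) 0.

(** The modulus [N] belongs to the run and not to the machine, so one finite machine serves all
    input lengths; the compiled automaton realizes [N = (n+2)^(e+1)]. *)
Definition cm_step N (w : seq Sigma) (mu : nat -> bool) (x : cm_config C) :=
  let: (q, rm, ops, mo) :=
    cm_trans (cc_state x) (insym_at w (cc_raw x))
      [ffun k => cc_ctr x k == 0] (mu (cc_cell x)) in
  CmConfig q (head_move (size w) rm (cc_raw x))
    (fun k => ctr_op N (ops k) (cc_ctr x k)) (w15_move mo (cc_cell x)).

Definition cm_accepts N w mu :=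
  exists t, cm_acc (cc_state (iter t (cm_step N w mu) cm_start)).

Variable e : nat.
Local Notation K := (cm_ctr C).
Local Notation T := (option (K * 'I_e.+1)).
Local Notation h := #|{: T}|.

Definition at_left (s : insym Sigma) := if s is LEnd then true else false.
Definition at_right (s : insym Sigma) := if s is REnd then true else false.

Definition digit_flag (f : insym Sigma -> bool) (s : {ffun 'I_h -> insym Sigma})
    (k : K) (j : nat) :=
  f (s (enum_rank (Some (k, inord j)))).

(** The state [None] lasts one step: heads start on cell 1, and it brings the counter heads to the
    left endmarker, where with direction bit [true] they represent zero. Each counter takes [e.+1]
    heads, one per digit in base [n+2]. *)
Definition compiled_trans (st : option (cm_state C * {ffun K * 'I_e.+1 -> bool}))
    (s : {ffun 'I_h -> insym Sigma}) (mk : bool) :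
    option (cm_state C * {ffun K * 'I_e.+1 -> bool}) * {ffun 'I_h -> move} * memop :=
  if st is Some (q, dirs) then
    let dir k j := dirs (k, inord j) in
    let l := digit_flag at_left s in let r := digit_flag at_right s in
    let: (q', rm, ops, mo) :=
      cm_trans q (s (enum_rank None))
        [ffun k => all (sees_zero (dir k) (l k) (r k)) (iota 0 e.+1)] mk in
    (Some (q', [ffun kj : K * 'I_e.+1 => digit_dir (ops kj.1) (dir kj.1) (l kj.1) (r kj.1) kj.2]),
     [ffun i : 'I_h => if (enum_val i : T) is Some kj
                then digit_move (ops kj.1) (dir kj.1) (l kj.1) (r kj.1) kj.2
                else rm],
     mo)
  else (Some (cm_init C, [ffun => true]),
        [ffun i : 'I_h => if (enum_val i : T) is Some _ then MLeft else MStay], MemStay).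

Definition compiled : automaton Sigma h :=
  @Automaton Sigma h _ bool false compiled_trans None
    [set st | if st is Some (q, _) then cm_acc q else false].

Definition ctr_sim (w : seq Sigma) (c : aconfig compiled) (x : cm_config C) :=
  exists dirs : {ffun K * 'I_e.+1 -> bool},
  let pos k j := ac_head c (enum_rank (Some (k, inord j))) in
  [/\ ac_state c = Some (cc_state x, dirs),
      ac_head c (enum_rank None) = cc_raw x,
      forall k j, pos k j <= (size w).+1,
      forall k, cc_ctr x k = numval (size w).+2 e.+1
        (digit_val (size w) (fun j => dirs (k, inord j)) (pos k))
    & ac_cell c = cc_cell x].

Lemma insym_at_left (w : seq Sigma) p : at_left (insym_at w p) = (p == 0).
Proof.
case: p => [|p] //; rewrite /insym_at /=.
by elim: w p => [|a w IH] [|p] //=; exact: IH.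
Qed.

Lemma insym_at_right (w : seq Sigma) p : p <= (size w).+1 ->
  at_right (insym_at w p) = (p == (size w).+1).
Proof.
case: p => [|p] //; rewrite /insym_at /= ltnS eqSS.
by elim: w p => [|a w IH] [|p] //=; exact: IH.
Qed.

Lemma ctr_sim_step w mu c x : ctr_sim w c x ->
  ctr_sim w (aut_step w mu c) (cm_step ((size w).+2 ^ e.+1) w mu x).
Proof.
case=> dirs /= [Es Er Hp Hv Ec].
rewrite /aut_step /cm_step Es; set s := [ffun i => insym_at w (ac_head c i)].
change (aut_trans _ _ _) with
  (compiled_trans (Some (cc_state x, dirs)) s (mu (ac_cell c))).
rewrite /compiled_trans; set pos := fun k j => ac_head c (enum_rank (Some (k, inord j))).
have El k j : digit_flag at_left s k j = (pos k j == 0).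
  by rewrite /digit_flag ffunE insym_at_left.
have Ert k j : digit_flag at_right s k j = (pos k j == (size w).+1).
  by rewrite /digit_flag ffunE insym_at_right //; apply: Hp.
have -> : [ffun k => all (sees_zero (fun j => dirs (k, inord j))
     (digit_flag at_left s k) (digit_flag at_right s k)) (iota 0 e.+1)] =
   [ffun k => cc_ctr x k == 0].
  apply/ffunP=> k; rewrite !ffunE Hv.
  by apply: counter_zeroE => j _; [exact: Hp | exact: El | exact: Ert].
rewrite [s _]ffunE Er -Ec.
case: (cm_trans _ _ _ _) => [[[q' rm] ops] mo].
exists [ffun kj : K * 'I_e.+1 => digit_dir (ops kj.1) (fun j => dirs (kj.1, inord j))
          (digit_flag at_left s kj.1) (digit_flag at_right s kj.1) kj.2].
split=> //=.
- by rewrite ffunE enum_rankK Er.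
- by move=> k j; rewrite ffunE enum_rankK; case: digit_move => /=; have := Hp k j; lia.
- move=> k; rewrite Hv -(@counter_step _ _ _ (digit_flag at_left s k)
    (digit_flag at_right s k)) //.
  apply: eq_numval => j je; rewrite /digit_val !ffunE /= enum_rankK /=.
  by rewrite inordK.
Qed.

Lemma ctr_sim_start w mu :
  ctr_sim w (aut_step w mu (aut_start compiled)) cm_start.
Proof.
exists [ffun => true]; split=> //=.
- by rewrite ffunE enum_rankK.
- by move=> k j; rewrite ffunE enum_rankK.
- move=> k; rewrite (@eq_numval _ _ _ (fun => 0)) ?/numval ?big1 // => j je.
  by rewrite /digit_val !ffunE enum_rankK.
Qed.

Lemma ctr_sim_iter w mu t :
  ctr_sim w (iter t.+1 (aut_step w mu) (aut_start compiled))
    (iter t (cm_step ((size w).+2 ^ e.+1) w mu) cm_start).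
Proof.
elim: t => [|t IH]; first exact: ctr_sim_start.
by rewrite iterS [iter t.+1 _ cm_start]iterS; apply: ctr_sim_step.
Qed.

Lemma compiled_accepts w (mu : nat -> bool) :
  @aut_accepts _ _ compiled w mu <-> cm_accepts ((size w).+2 ^ e.+1) w mu.
Proof.
split=> [] [t].
  case: t => [|t]; first by rewrite inE.
  by have [d [-> _ _ _ _]] := ctr_sim_iter w mu t; rewrite inE => ?; exists t.
move=> Ht; exists t.+1.
by have [d [-> _ _ _ _]] := ctr_sim_iter w mu t; rewrite inE.
Qed.

End CounterMachine.

(** * Encoding words by residues *)

(** Legendre's formula: the exponent of [p] is the sum over [k] of floor(2m/p^k) - 2 floor(m/p^k).
    Each term is at most 1 and vanishes once [p^k] exceeds 2m, so the exponent is at most the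
    logarithm of 2m to base [p]. *)
Lemma logn_central_bin p m : prime p -> p ^ logn p 'C(m.*2, m) <= m.*2 \/ m = 0.
Proof.
move=> pp; case: m => [|m]; [by right | left].
set M := m.+1; have M0 : 0 < M.*2 by rewrite double_gt0.
have p1 := prime_gt1 pp.
suff le : logn p 'C(M.*2, M) <= trunc_log p M.*2.
  by apply: leq_trans (trunc_logP p1 M0); rewrite leq_pexp2l // prime_gt0.
have /(congr1 (logn p)) : 'C(M.*2, M) * (M`! * M`!) = (M.*2)`!.
  by rewrite -(@bin_fact M.*2 M) -addnn ?leq_addr // addnK.
rewrite lognM ?muln_gt0 ?fact_gt0 ?bin_gt0 -?addnn ?leq_addr //.
rewrite lognM ?fact_gt0 // !logn_fact // addnn.
set L := trunc_log p M.*2; rewrite -addnn.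
have LM : L <= M + M by rewrite addnn ltnW // (leq_trans (ltn_expl _ p1)) ?trunc_logP.
have splitS x : x <= M + M -> \sum_(1 <= k < x.+1) x %/ p ^ k =
    \sum_(1 <= k < (M + M).+1) x %/ p ^ k.
  move=> xM; rewrite [RHS](big_cat_nat _ (n := x.+1)) //=.
  rewrite [X in _ = _ + X]big_nat [X in _ = _ + X]big1 ?addn0 // => k /andP[xk _].
  by rewrite divn_small // (leq_trans _ (ltnW (ltn_expl k p1))).
rewrite (splitS M) ?leq_addr // => E.
suff H : \sum_(1 <= k < (M + M).+1) (M + M) %/ p ^ k <=
    L + (\sum_(1 <= k < (M + M).+1) M %/ p ^ k + \sum_(1 <= k < (M + M).+1) M %/ p ^ k).
  by move: H; rewrite -E leq_add2r.
rewrite -big_split /= (big_cat_nat _ (n := L.+1)) //=.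
rewrite [X in _ <= _ + X](big_cat_nat _ (n := L.+1)) //= addnA leq_add //.
  apply: (@leq_trans (\sum_(1 <= k < L.+1) (1 + (M %/ p ^ k + M %/ p ^ k)))); last first.
    by rewrite [X in X <= _]big_split /= sum_nat_const_nat muln1 subn1.
  apply: leq_sum => k _.
  have pk : 0 < p ^ k by rewrite expn_gt0 prime_gt0.
  by rewrite divnD // [X in _ <= X]addnC leq_add2l leq_b1.
rewrite [X in X <= _]big_nat [X in X <= _]big1 // => k /andP[Lk _].
apply: divn_small; rewrite addnn.
by apply: leq_trans (trunc_log_ltn _ p1) _; rewrite leq_pexp2l // prime_gt0.
Qed.

Lemma exp2_central_bin m : 2 ^ m <= 'C(m.*2, m).
Proof.
elim: m => [|m IH]; first by rewrite bin0.
rewrite doubleS.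
have H : 'C(m.*2.+1, m.+1) + 'C(m.*2.+1, m) = 'C(m.*2.+2, m.+1) by rewrite binS.
have H' : 'C(m.*2, m.+1) + 'C(m.*2, m) = 'C(m.*2.+1, m.+1) by rewrite binS.
have H2 : 'C(m.*2, m) <= 'C(m.*2.+1, m).
  by case: (m) (m.*2) => [|j] i; rewrite ?bin0 // binS leq_addr.
by rewrite expnS; lia.
Qed.

(** Chebyshev's argument: the central binomial coefficient is at least [2^m] and is a product of
    prime powers, each at most 2m and belonging to a prime at most 2m. *)
Lemma exp2_le_primes m : 2 ^ m <= m.*2 ^ size [seq q <- iota 0 m.*2.+1 | prime q].
Proof.
case: m => [|m]; first by [].
set M := m.+1; apply: leq_trans (exp2_central_bin M) _.
have C0 : 0 < 'C(M.*2, M) by rewrite bin_gt0 -addnn leq_addr.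
rewrite {1}[X in X <= _](prod_prime_decomp C0) prime_decompE big_map.
apply: (@leq_trans (M.*2 ^ size (primes 'C(M.*2, M)))).
  apply: (@leq_trans (\prod_(p <- primes 'C(M.*2, M)) M.*2)).
    rewrite big_seq [X in _ <= X]big_seq; apply: leq_prod => p /=.
    by rewrite mem_primes => /andP[/(logn_central_bin M) []].
  by rewrite big_const_seq count_predT iter_muln muln1.
apply: leq_pexp2l; first by rewrite double_gt0.
apply: uniq_leq_size (primes_uniq _) _ => p.
rewrite mem_primes mem_filter mem_iota => /and3P[pp _ pC]; rewrite pp /= add0n ltnS.
have : p %| (M.*2)`! by rewrite -(@bin_fact M.*2 M) ?dvdn_mulr // -addnn leq_addr.
elim: (M.*2) => [|j IH]; first by rewrite fact0 Euclid_dvd1.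
rewrite factS Euclid_dvdM // => /orP[/dvdn_leq -> //|/IH]; lia.
Qed.

Definition odds (q N : nat) := [seq r <- iota q (N - q) | odd r].

Lemma odds_cons q N : odd q -> q < N -> odds q N = q :: odds q.+2 N.
Proof.
move=> oq qN; rewrite /odds -[N - q]prednK ?subn_gt0 //= oq; congr cons.
case E: (N - q).-1 => [|j] /=; first by have -> : N - q.+2 = 0 by lia.
by rewrite oq /=; have -> : N - q.+2 = j by lia.
Qed.

Lemma odds_nil q N : N <= q -> odds q N = [::].
Proof. by rewrite /odds -subn_eq0 => /eqP->. Qed.

(** If there were fewer, at most [2 b^f] primes would lie below [N = b^(2f)], of which at most [b^f]
    are too small to be listed. Chebyshev's bound would then make N/2 at most about [2 b^f] times
    the binary logarithm of [N], itself at most [2fb]; this is too small. *)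
Lemma many_primes b f : 1 < b -> 7 < f ->
  b ^ f <= size [seq q <- odds 3 (b ^ f.*2) | prime q && (b ^ f < q)].
Proof.
move=> b1 f7; set N := b ^ f.*2; set P := [seq q <- odds 3 N | _].
have bf : 2 <= b ^ f by rewrite (leq_trans _ (ltn_expl f b1)); lia.
have NE : N = b ^ f * b ^ f by rewrite -expnD addnn.
pose M := N.-1./2.
have M2 : M.*2 <= N.-1 by rewrite -[X in _ <= X]odd_double_half leq_addl.
have M3 : N.-1 <= M.*2.+1.
  by rewrite -[X in X <= _]odd_double_half -addn1 addnC leq_add2l leq_b1.
have Mpos : 0 < M.*2 by lia.
have := exp2_le_primes M; set Q := filter _ _ => H.
have sQ : size Q <= b ^ f + size P.
  rewrite -(size_iota 1 (b ^ f)) -size_cat; apply: uniq_leq_size.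
    by rewrite filter_uniq ?iota_uniq.
  move=> q; rewrite !(mem_cat, mem_filter, mem_iota) /= => /andP[pq qM].
  have q0 := prime_gt1 pq; have [le|lt] := leqP q (b ^ f).
    by apply/orP; left; lia.
  apply/orP; right; rewrite pq /=.
  by have [E|->] := even_prime pq; [move: lt; rewrite E; lia | lia].
rewrite leqNgt; apply/negP => ltP.
have : M <= b * f.*2 * (b ^ f).*2.
  rewrite -(@leq_exp2l 2) // (leq_trans H) //.
  apply: (@leq_trans (N ^ size Q)); first by case: (size Q) => [|s] //; rewrite leq_exp2r //; lia.
  apply: (@leq_trans (N ^ (b ^ f).*2)); first by apply: leq_pexp2l; lia.
  rewrite (expnM 2) leq_exp2r; last by lia.
  by rewrite (expnM 2) /N leq_exp2r ?(ltnW (ltn_expl _ _)) //; lia.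
(* The origin of [7 < f]: the induction for 8f + 2 <= 2^(f-1), on which the contradiction rests,
   starts at 8. *)
have : 8 * f + 2 <= b ^ f.-1.
  have : 8 * f + 2 <= 2 ^ f.-1.
    rewrite -(subnK f7); elim: (f - 8) => [|j IH] //.
    have -> : (j.+1 + 8).-1 = (j + 8).-1.+1 by lia.
    by rewrite expnS; move: IH; set X := 2 ^ _; lia.
  by move/leq_trans; apply; rewrite leq_exp2r //; lia.
have EN : N = b ^ f.-1 * (b * b ^ f) by rewrite NE -{1}(ltn_predK f7) expnSr mulnA.
have EM : b * f.*2 * (b ^ f).*2 = 4 * f * (b * b ^ f) by rewrite -!muln2; lia.
have X2 : 2 <= b * b ^ f by rewrite (@leq_mul 1 2) // ltnW.
rewrite EM; move: (b * b ^ f) (b ^ f.-1) X2 EN => X Y X2 EN HY HM.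
have : (8 * f + 2) * X <= N by rewrite EN leq_mul2r HY orbT.
by rewrite mulnDl -mulnA; move: HM; rewrite -mulnA; lia.
Qed.

Lemma crt_seq (qs : seq nat) (r : nat -> nat) :
    uniq qs -> {in qs &, forall q q', q != q' -> coprime q q'} ->
  exists x, forall q, q \in qs -> x = r q %[mod q].
Proof.
elim: qs => [|q qs IH] /=; first by exists 0.
case/andP=> qqs uqs cop.
have [|x Hx] := IH uqs; first by move=> ? ? H1 H2; apply: cop; rewrite inE ?H1 ?H2 orbT.
have cq : coprime q (\prod_(q' <- qs) q').
  rewrite big_seq; elim/big_ind: _ => [|? ? ? ?|q' q'qs]; rewrite ?coprimen1 ?coprimeMr //.
    exact/andP.
  by apply: cop; rewrite ?inE ?eqxx ?q'qs ?orbT //; apply: contraNneq qqs => ->.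
exists (chinese q (\prod_(q' <- qs) q') (r q) x) => q'; rewrite inE => /orP[/eqP->|q'qs].
  exact: chinese_modl.
rewrite -(Hx _ q'qs).
have /dvdnP[z Ez] : q' %| \prod_(q' <- qs) q' by rewrite (big_rem q') //= dvdn_mulr.
have := chinese_modr cq (r q) x; move/eqP; rewrite Ez => /eqP /(congr1 (modn ^~ q')).
by rewrite !modn_dvdm ?dvdn_mull.
Qed.

(** The residues 0 and -1 are those that zero tests recognize: during the walk one counter holds the
    residue and another its complement to [q]. At the mark either the first is empty, or the second
    becomes empty after one further unit. *)
Definition letter (p q : nat) : option bool :=
  if q %| p then Some true else if q %| p.+1 then Some false else None.

(* Choosing [p] congruent to [0] or [-1] modulo the primes that carry a letter
   and to [1] modulo the other odd primes leaves every other odd modulus silent,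
   because the carrying primes exceed the square root of the bound. *)
Lemma letters_onto b f (bits : seq bool) : 1 < b -> 7 < f -> size bits <= b ^ f ->
  exists p, pmap (letter p) (odds 3 (b ^ f.*2)) = bits.
Proof.
move=> b1 f7 sb; set N := b ^ f.*2.
have NE : N = b ^ f * b ^ f by rewrite -expnD addnn.
pose P := [seq q <- odds 3 N | prime q && (b ^ f < q)].
pose sel := take (size bits) P.
have ssel : size sel = size bits by rewrite size_takel // (leq_trans sb) ?many_primes.
have uP : uniq P by rewrite !filter_uniq ?iota_uniq.
have usel : uniq sel by rewrite take_uniq.
have selP q : q \in sel -> prime q /\ b ^ f < q.
  by move/mem_take; rewrite mem_filter => /andP[/andP[]].
pose qs := [seq q <- odds 3 N | prime q].
pose r q := if q \in sel then if nth false bits (index q sel) then 0 else q.-1 else 1.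
have [||p Hp] := @crt_seq qs r.
- by rewrite !filter_uniq ?iota_uniq.
- move=> q q'; rewrite !mem_filter => /andP[pq _] /andP[pq' _] ne.
  by rewrite prime_coprime // dvdn_prime2.
exists p.
have sub : subseq sel (odds 3 N) by rewrite (subseq_trans (take_subseq _ _)) ?filter_subseq.
have uo : uniq (odds 3 N) by rewrite filter_uniq ?iota_uniq.
have prq q : prime q -> odd q -> q < N -> p = r q %[mod q].
  move=> pq oq qN; apply: Hp; rewrite !mem_filter pq oq mem_iota /=.
  by have := prime_gt1 pq; case: q pq oq qN => [|[|[|q]]] //; lia.
have L0 q : prime q -> odd q -> q < N -> q %| p -> q \in sel.
  move=> pq oq qN /eqP; rewrite (prq q pq oq qN) /r; case: ifP => // _.
  by rewrite modn_small ?prime_gt1.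
(* Here the oddness of the moduli matters: for a prime outside [sel], [p.+1] is congruent to 2,
   which an odd prime does not divide. *)
have L1 q : prime q -> odd q -> q < N -> q %| p.+1 -> q \in sel.
  move=> pq oq qN; rewrite -addn1 /dvdn -modnDml (prq q pq oq qN) modnDml /r.
  case: ifP => // _; rewrite -/(dvdn q 2) dvdn_prime2 // => /eqP E.
  by rewrite E in oq.
have Ls q : q \in odds 3 N -> (q %| p) || (q %| p.+1) -> q \in sel.
  rewrite mem_filter mem_iota => /andP[oq /andP[q3 qN]] H.
  have {}qN : q < N by lia.
  have Lq x : prime x -> x %| q -> x \in sel.
    move=> px xq; have ox : odd x by apply: dvdn_odd xq oq.
    have xN : x < N by rewrite (leq_ltn_trans (dvdn_leq _ xq)) //; lia.
    by case/orP: H => /(dvdn_trans xq); [apply: L0 | apply: L1].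
  have q1 : 1 < q by lia.
  have [pq|/primePn] := boolP (prime q); first exact: Lq.
  (* A speaking composite modulus would have two prime factors, counted with multiplicity, that are
     both selected; their product exceeds [N]. *)
  case=> [|[d /andP[d1 dq] dvd]]; first by lia.
  have [s1 s2] : pdiv d \in sel /\ pdiv (q %/ d) \in sel.
    have q2 : 1 < q %/ d by rewrite ltn_divRL // mul1n.
    split; apply: Lq; rewrite ?pdiv_prime //.
      exact: dvdn_trans (pdiv_dvd _) dvd.
    by apply: dvdn_trans (pdiv_dvd _) _; rewrite dvdn_div.
  have [_ b1'] := selP _ s1; have [_ b2'] := selP _ s2.
  have : pdiv d * pdiv (q %/ d) <= q.
    rewrite -{2}(divnK dvd) mulnC leq_mul // dvdn_leq ?pdiv_dvd //; last by lia.
    by rewrite divn_gt0; lia.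
  by have := ltn_mul b1' b2'; rewrite -NE; lia.
have letE q : q \in odds 3 N ->
    letter p q = if q \in sel then Some (nth false bits (index q sel)) else None.
  move=> qo; case: ifP => qs_; last first.
    rewrite /letter; have := Ls q qo; rewrite qs_.
    case: (q %| p) => [/(_ isT) //|/=].
    by case: (q %| p.+1) => // /(_ isT).
  have [pq _] := selP _ qs_; have oq : odd q by move: qo; rewrite mem_filter => /andP[].
  have qN : q < N by move: qo; rewrite mem_filter mem_iota; lia.
  have q1 := prime_gt1 pq.
  have := prq q pq oq qN; rewrite /r qs_ /letter /dvdn => Ep.
  rewrite -(addn1 p) -(modnDml p 1) Ep modnDml.
  case: nth; first by rewrite mod0n eqxx.
  rewrite addn1 prednK ?prime_gt0 // modnn eqxx modn_small; last by lia.
  by case: eqP => //; lia.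
have -> : pmap (letter p) (odds 3 N) =
    [seq nth false bits (index q sel) | q <- [seq q <- odds 3 N | q \in sel]].
  elim: (odds 3 N) letE => //= q s IH letE.
  rewrite letE ?mem_head // {}IH; first by case: ifP.
  by move=> x xs; apply: letE; rewrite inE xs orbT.
rewrite -(elimT (subseq_uniqP uo) sub).
apply: (@eq_from_nth _ false); rewrite size_map ssel // => i ib.
by rewrite (nth_map 0) ?ssel // index_uniq ?ssel.
Qed.

Import Order.TTheory GRing.Theory Num.Theory.

(** * Checking a trace one tape cell at a time *)

Fixpoint ofold (S A : Type) (f : S -> A -> option S) (x : S) (s : seq A) : option S :=
  if s is a :: s' then if f x a is Some y then ofold f y s' else None else Some x.

Lemma ofold_cat (S A : Type) (f : S -> A -> option S) x s1 s2 :
  ofold f x (s1 ++ s2) = obind (fun y => ofold f y s2) (ofold f x s1).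
Proof. by elim: s1 x => //= a s1 IH x; case: (f x a). Qed.

Section Trace.
Variables (Sigma : finType) (m : nat) (M : ntm Sigma m).
Local Notation T := 'I_m.+1.
Local Notation sym := (tm_sym M).

(** An instruction repeats the symbols read. A check that watches a single cell can then apply the
    whole transition relation and compare only the reads made at its own cell, leaving the others to
    other cells. *)
Definition instr : finType :=
  ({ffun T -> sym} * tm_state M * {ffun T -> sym} * {ffun T -> move})%type.
Definition in_read (a : instr) := a.1.1.1.
Definition in_state (a : instr) := a.1.1.2.
Definition in_write (a : instr) := a.1.2.
Definition in_move (a : instr) := a.2.

Definition tm_reads (c : tconfig M) : {ffun T -> sym} :=
  [ffun i => tc_tape c i (tc_head c i)].

Definition tm_next (c : tconfig M) (a : instr) : tconfig M :=
  TConfig (in_state a) (fun i => move_int (in_move a i) (tc_head c i))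
    (fun i x => if x == tc_head c i then in_write a i else tc_tape c i x).

Definition tm_exec (c : tconfig M) (a : instr) : option (tconfig M) :=
  if (in_read a == tm_reads c) &&
     tm_trans (tc_state c) (in_read a) (in_state a) (in_write a) (in_move a)
  then Some (tm_next c a) else None.

Lemma tm_step_exec c c' : tm_step c c' <-> exists a, tm_exec c a = Some c'.
Proof.
split=> [[q [s [d [Ht ->]]]]|[[[[r q] s] d]]].
  by exists (tm_reads c, q, s, d); rewrite /tm_exec eqxx Ht.
rewrite /tm_exec; case: ifP => // /andP[/eqP Er Ht] [<-].
by exists q, s, d; rewrite -[X in tm_trans _ X]Er.
Qed.

Lemma tm_reach_exec c t c' :
  tm_reach c t c' <-> exists2 tau, size tau = t & ofold tm_exec c tau = Some c'.
Proof.
split=> [|[tau <-]].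
  elim=> [|{}t c1 c2 _ [tau st Ht] /tm_step_exec[a Ha]]; first by exists [::].
  exists (rcons tau a); first by rewrite size_rcons st.
  by rewrite -cats1 ofold_cat Ht /= Ha.
elim/last_ind: tau c' => [|tau a IH] c' /=; first by case=> <-; exact: tm_reach0.
rewrite -cats1 ofold_cat size_cat addn1; case E: (ofold _ _ _) => [c1|] //= H.
apply: tm_reachS (IH _ E) _; apply/tm_step_exec; exists a.
by move: H; case: (tm_exec c1 a).
Qed.

(* [ps_cont] is the content of the watched cell of each tape, [ps_D] the head
   position relative to the watched cell and [ps_E] minus the head position,
   both modulo [N]. *)
Record pstate := PState {
  ps_state : tm_state M;
  ps_cont : {ffun T -> sym};
  ps_D : T -> nat;
  ps_E : T -> nat
}.

Definition opp_move (d : move) : move :=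
  match d with MLeft => MRight | MStay => MStay | MRight => MLeft end.

Definition watch_ok (q : tm_state M) (c : {ffun T -> sym}) (z : {ffun T -> bool})
    (a : instr) :=
  tm_trans q (in_read a) (in_state a) (in_write a) (in_move a) &&
  [forall i, z i ==> (c i == in_read a i)].

Definition watch_cont (c : {ffun T -> sym}) (z : {ffun T -> bool}) (a : instr) :
    {ffun T -> sym} :=
  [ffun i => if z i then in_write a i else c i].

Variable N : nat.
Hypothesis N0 : 0 < N.

Definition ps_step (p : pstate) (a : instr) : option pstate :=
  let z := [ffun i => ps_D p i == 0] in
  if watch_ok (ps_state p) (ps_cont p) z a then
    Some (PState (in_state a) (watch_cont (ps_cont p) z a)
            (fun i => ctr_op N (in_move a i) (ps_D p i))
            (fun i => ctr_op N (opp_move (in_move a i)) (ps_E p i)))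
  else None.

Lemma ctr_op_cong d v : (N%:Z %| ((ctr_op N d v)%:Z - move_int d v%:Z)%R)%Z.
Proof.
rewrite /ctr_op; case: d.
- case: eqP => [->|E]; first by apply/dvdzP; exists 1%R; rewrite /move_int; lia.
  by apply/dvdzP; exists 0%R; rewrite /move_int; lia.
- by rewrite subrr dvdz0.
- case: eqP => [E|_]; last by apply/dvdzP; exists 0%R; rewrite /move_int; lia.
  by apply/dvdzP; exists (-1)%R; rewrite /move_int; lia.
Qed.

Lemma move_intB d x y : (move_int d x - y = move_int d 0 + (x - y))%R.
Proof. by case: d => /=; lia. Qed.

(** Cells are known only modulo [N]. In a run of fewer than N/2 steps every visited cell [z]
    satisfies 2|z| < N, and in this window a residue class has at most one cell, so no two visited
    cells are confused. *)
Definition watches x j (p : pstate) (c : tconfig M) :=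
  [/\ ps_state p = tc_state c,
      forall i, ps_D p i < N /\ (N%:Z %| ((ps_D p i)%:Z - (tc_head c i - x%:Z))%R)%Z,
      forall i, (`|tc_head c i| <= j)%N
    & forall i (z : int), (2 * `|z| < N)%N -> (N%:Z %| (z - x%:Z)%R)%Z ->
        ps_cont p i = tc_tape c i z].

Lemma dvdz_small (z : int) : (N%:Z %| z)%Z -> (`|z| < N)%N -> z = 0%R.
Proof.
rewrite dvdzE /= => dv lt; apply/eqP; rewrite -absz_eq0.
by apply: contraLR dv => nz; rewrite gtnNdvd // lt0n.
Qed.

Lemma watched_now x j p c i : watches x j p c ->
  (ps_D p i == 0) = (N%:Z %| (tc_head c i - x%:Z)%R)%Z.
Proof.
case=> _ /(_ i)[lt dv] _ _; apply/eqP/idP => [E|dv2].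
  by move: dv; rewrite E sub0r rpredN.
have := dvdz_small (z := (ps_D p i)%:Z); rewrite -(subrK (tc_head c i - x%:Z)%R (ps_D p i)%:Z%R).
by rewrite rpredD // subrK => /(_ isT lt) [].
Qed.

Lemma watches_step x j p c a p' : (2 * j < N)%N -> watches x j p c ->
  ps_step p a = Some p' -> watches x j.+1 p' (tm_next c a).
Proof.
move=> jN W; have Z i := watched_now i W; case: W => Es ED Eh Ec.
rewrite /ps_step; case: ifP => // _ [<-]; split=> //=.
- move=> i; have [lt dv] := ED i; split; first exact: ctr_op_lt.
  rewrite [X in (_ - X)%R]move_intB.
  rewrite (_ : (_ - _ = (ctr_op N (in_move a i) (ps_D p i))%:Z - move_int (in_move a i) (ps_D p i)%:Z
     + ((ps_D p i)%:Z - (tc_head c i - x%:Z)))%R).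
    by rewrite rpredD ?ctr_op_cong.
  by case: (in_move a i) => /=; lia.
- by move=> i; have := Eh i; case: (in_move a i) => /=; lia.
- move=> i z zN dz; rewrite !ffunE Z.
  have [Ez|ne] := eqVneq z (tc_head c i); first by rewrite -Ez dz.
  rewrite (Ec i z) //; case: ifP => // dv.
  case/eqP: ne; apply/eqP; rewrite -subr_eq0; apply/eqP; apply: dvdz_small.
    have -> : (z - tc_head c i = (z - x%:Z) - (tc_head c i - x%:Z))%R by lia.
    exact: rpredB.
  by have := Eh i; lia.
Qed.

Definition ps_acc (o : option pstate) :=
  if o is Some p then ps_state p \in tm_acc M else false.
Definition tc_acc (o : option (tconfig M)) :=
  if o is Some c then tc_state c \in tm_acc M else false.

(** For the direction from the watches to the machine, the watch of cell 0 already checks the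
    transition, and the read on tape [i] is checked by the watch at the residue of that head's
    position. *)
Lemma exec_watch j p c a : (2 * j < N)%N ->
    (forall x, x < N -> watches x j (p x) c) ->
  (tm_exec c a : bool) <-> (forall x, x < N -> ps_step (p x) a : bool).
Proof.
move=> jN W; rewrite /tm_exec /ps_step; split.
  case: ifP => // /andP[/eqP Er Ht] _ x xN; have Wx := W _ xN.
  case: ifP => // /negP[]; apply/andP; split; first by case: Wx => ->.
  apply/forallP => i; apply/implyP; rewrite ffunE (watched_now i Wx) => dv.
  case: Wx => _ _ Eh Ec; rewrite Er ffunE (Ec i _ _ dv) //.
  by have := Eh i; lia.
move=> H; case: ifP => // /negP[]; apply/andP; split; last first.
  by have := H 0 N0; case: ifP => // /andP[+ _]; case: (W 0 N0) => ->.
apply/eqP/ffunP => i; rewrite ffunE.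
pose x := `|(tc_head c i %% N)%Z|%N.
have Ex : Posz x = (tc_head c i %% N)%Z by rewrite /x gez0_abs ?modz_ge0 //; lia.
have xN : (x < N)%N by rewrite -ltz_nat Ex ltz_pmod //; lia.
have dv : (N%:Z %| (tc_head c i - x%:Z)%R)%Z.
  by rewrite Ex {1}(divz_eq (tc_head c i) N) addrK dvdz_mull.
have Wx := W x xN; have := H x xN; case: ifP => // /andP[_ /forallP /(_ i)].
rewrite ffunE (watched_now i Wx) dv /= => /eqP <- _.
by case: Wx => _ _ Eh Ec; apply: Ec => //; have := Eh i; lia.
Qed.

Lemma watch_all tau j p c : (2 * (j + size tau) < N)%N ->
    (forall x, x < N -> watches x j (p x) c) ->
  tc_acc (ofold tm_exec c tau) <->
  (forall x, x < N -> ps_acc (ofold ps_step (p x) tau)).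
Proof.
elim: tau j p c => [|a tau IH] j p c jN W /=.
  split=> [Ha x xN|/(_ 0 N0)]; first by case: (W x xN) => ->.
  by case: (W 0 N0) => ->.
have jN' : (2 * j < N)%N by move: jN => /=; lia.
have EW := exec_watch a jN' W.
case E: (tm_exec c a) EW => [c'|] EW; last first.
  split=> // H; suff: false by [].
  by apply/EW => x xN; have := H x xN; case: (ps_step _ a).
have {}EW := EW.1 isT.
pose p' x := odflt (p x) (ps_step (p x) a).
have Ep x : x < N -> ps_step (p x) a = Some (p' x).
  by move=> xN; have := EW x xN; rewrite /p'; case: (ps_step _ a).
have Ec : c' = tm_next c a by move: E; rewrite /tm_exec; case: ifP => // _ [].
have := IH j.+1 p' c'; move=> /(_ _ _)[||IH1 IH2].
- by move: jN => /=; lia.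
- by move=> x xN; rewrite Ec; apply: watches_step (W x xN) (Ep x xN).
split=> [/IH1 H x xN|H]; first by rewrite (Ep _ xN) H.
by apply: IH2 => x xN; have := H x xN; rewrite (Ep _ xN).
Qed.

Definition ps_start (w : seq Sigma) (x : nat) : pstate :=
  PState (tm_init M)
    [ffun i => if i == ord0 then nth (tm_blank M) (map (@tm_letter _ _ M) w) x
               else tm_blank M]
    (fun _ => if x == 0 then 0 else N - x) (fun _ => 0).

Lemma watches_start w x : x < N -> (2 * size w <= N)%N ->
  watches x 0 (ps_start w x) (tm_start M w).
Proof.
move=> xN wN; split=> //=.
- move=> _; case: eqP => [->|x0]; first by rewrite !subr0 dvdz0.
  split; first by lia.
  by have -> : ((N - x)%N%:Z - (0 - x%:Z) = N%:Z)%R by lia.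
- move=> i z zN dz; rewrite ffunE; case: eqP => //= _.
  case: z zN dz => [z|z] zN dz.
    by have E : (z%:Z - x%:Z = 0)%R; [apply: dvdz_small; lia | have -> : x = z by lia].
  (* A negative cell has residue [z + N], which lies beyond the input because the input fills at
     most half of the range; the blank default of [nth] is then the right content. *)
  have E : (Negz z - x%:Z + N%:Z = 0)%R.
    by apply: dvdz_small; [rewrite rpredD // dvdzz | move: zN; lia].
  by rewrite nth_default // size_map; move: zN; lia.
Qed.

Lemma trace_watch w tau : (2 * size w <= N)%N -> (2 * size tau < N)%N ->
  tc_acc (ofold tm_exec (tm_start M w) tau) <->
  (forall x, x < N -> ps_acc (ofold ps_step (ps_start w x) tau)).
Proof.
by move=> wN tN; apply: (@watch_all _ 0) => // x xN; apply: watches_start.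
Qed.

(** [ps_E] exists for this invariant: the sum keeps its initial value, the offset of the watched
    cell, so after a trace the verifier recovers that offset by emptying one counter into the other,
    without a stored copy. *)
Lemma ps_sum p a p' i : ps_step p a = Some p' ->
  ((ps_D p' i + ps_E p' i) = (ps_D p i + ps_E p i) %[mod N])%N.
Proof.
rewrite /ps_step; case: ifP => // _ [<-] /=; apply/eqP.
rewrite -eqz_nat -!modz_nat eqz_mod_dvd !PoszD.
have := rpredD (ctr_op_cong (in_move a i) (ps_D p i))
  (ctr_op_cong (opp_move (in_move a i)) (ps_E p i)).
move: (ctr_op N _ (ps_D p i)) (ctr_op N _ (ps_E p i)) => D' E' H.
rewrite (_ : _ - _ = (D'%:Z - move_int (in_move a i) (ps_D p i)%:Z) +
  (E'%:Z - move_int (opp_move (in_move a i)) (ps_E p i)%:Z))%R //.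
by case: (in_move a i); rewrite /opp_move /move_int; lia.
Qed.

Lemma ofold_ps_sum p tau p' i : ofold ps_step p tau = Some p' ->
  ((ps_D p' i + ps_E p' i) = (ps_D p i + ps_E p i) %[mod N])%N.
Proof.
elim: tau p => [|a tau IH] p /=; first by case=> <-.
by case E: (ps_step p a) => [p1|] // /IH ->; apply: ps_sum E.
Qed.

Lemma ps_step_lt p a p' : (forall i, ps_D p i < N /\ ps_E p i < N) ->
  ps_step p a = Some p' -> forall i, ps_D p' i < N /\ ps_E p' i < N.
Proof.
rewrite /ps_step; case: ifP => // _ lt [<-] i /=.
by have [? ?] := lt i; rewrite !ctr_op_lt.
Qed.

End Trace.

(** * The verifying counter machine *)

Inductive label := LLoad | LNext1 | LNext2 | LNext3 | LWalk | LRefill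
  | LTest of bool | LBack | LEnd_ | LRestore | LLoop | LAcc | LRej.

Definition label_code (l : label) : nat :=
  match l with
  | LLoad => 0 | LNext1 => 1 | LNext2 => 2 | LNext3 => 3 | LWalk => 4
  | LRefill => 5 | LTest true => 6 | LTest false => 7 | LBack => 8 | LEnd_ => 9
  | LRestore => 10 | LLoop => 11 | LAcc => 12 | LRej => 13
  end.

Definition label_seq := [:: LLoad; LNext1; LNext2; LNext3; LWalk; LRefill;
  LTest true; LTest false; LBack; LEnd_; LRestore; LLoop; LAcc; LRej].

Lemma label_codeK : cancel (fun l => inord (label_code l) : 'I_14)
  (fun i => nth LRej label_seq i).
Proof. by case=> [||||||[]||||||]; rewrite /= inordK. Qed.

Module LabelFinite.
HB.instance Definition _ := Equality.copy label (can_type label_codeK).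
HB.instance Definition _ := Choice.copy label (can_type label_codeK).
HB.instance Definition _ := Countable.copy label (can_type label_codeK).
HB.instance Definition _ := Finite.copy label (can_type label_codeK).
End LabelFinite.
Export LabelFinite.

Section Verifier.
Variables (Sigma : finType) (m : nat) (M : ntm Sigma m).
Local Notation T := 'I_m.+1.
Local Notation sym := (tm_sym M).
Local Notation G := (instr M).
Local Notation g := #|{: G}|.

Definition instr0 : G :=
  ([ffun => tm_blank M], tm_init M, [ffun => tm_blank M], [ffun => MStay]).

Definition instr_at (j : nat) : G := nth instr0 (enum {: G}) j.

(* The letter [true] increments a symbol counter, the letter [false] executes
   the instruction with that number. *)
Fixpoint decode (cnt : 'I_g.+1) (bits : seq bool) : seq G :=
  match bits with
  | [::] => [::]
  | true :: bits' => decode (inord cnt.+1) bits'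
  | false :: bits' => instr_at cnt :: decode ord0 bits'
  end.

Definition encode (tau : seq G) : seq bool :=
  flatten [seq rcons (nseq (enum_rank a) true) false | a <- tau].

(** Decoding is total, so any mark whatever yields some trace, and this bound keeps it short.
    Soundness therefore requires no check that the mark is a proper code. *)
Lemma size_decode cnt bits : size (decode cnt bits) <= size bits.
Proof.
by elim: bits cnt => [|[] bits IH] cnt //=; apply: leq_trans (IH _) _.
Qed.

Lemma size_encode tau : size (encode tau) <= size tau * g.
Proof.
elim: tau => //= a tau IH; rewrite /encode /= size_cat size_rcons size_nseq mulSn.
exact: leq_add (ltn_ord _) IH.
Qed.

Lemma encodeK tau : decode ord0 (encode tau) = tau.
Proof.
elim: tau => //= a tau IH; rewrite /encode /= -/(encode tau).
have key j (cnt : 'I_g.+1) s : cnt + j < g.+1 ->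
    decode cnt (rcons (nseq j true) false ++ s) = instr_at (cnt + j) :: decode ord0 s.
  elim: j cnt => [|j IHj] cnt lt /=; first by rewrite addn0.
  have lt' : cnt.+1 < g.+1 by lia.
  by rewrite IHj inordK // addSnnS.
rewrite key /=; last by rewrite add0n ltnW // ltnS ltn_ord.
by rewrite add0n IH /instr_at -[nth _ _ _]/(nth instr0 (enum {: G}) (enum_rank a)) nth_enum_rank.
Qed.

Local Notation K := (bool + T * bool)%type.
Local Notation data := (tm_state M * {ffun T -> sym} * 'I_g.+1)%type.

Definition ops_RS (dR dS : move) (k : K) : move :=
  if k is inl x then if x then dR else dS else MStay.

Definition ops_DE (dD dE : T -> move) (k : K) : move :=
  if k is inr (i, x) then if x then dD i else dE i else MStay.

Definition zR (z : {ffun K -> bool}) := z (inl true).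
Definition zS (z : {ffun K -> bool}) := z (inl false).
Definition zD (z : {ffun K -> bool}) : {ffun T -> bool} := [ffun i => z (inr (i, true))].
Definition zE (z : {ffun K -> bool}) (i : T) := z (inr (i, false)).

Definition no_ops (k : K) := MStay.

(** While a letter is read, [R + S] is the current modulus. [LLoad] sets [R] to 1, and [LNext1] to
    [LNext3] raise it by two to the next odd modulus; its wraparound to zero tells that [N] is
    reached. [LWalk] moves units from [R] to [S] along the memory, [LRefill] starts a new period,
    [LTest] consumes a letter, and [LBack] resets the memory and returns [S] to [R]. The input head
    stays on the letter of the watched cell, or on the right endmarker for a blank. [LRestore] and
    [LLoop] prepare the next cell. *)
Definition verifier_trans (st : label * data) (s : insym Sigma)
    (z : {ffun K -> bool}) (mk : bool) :
    label * data * move * (K -> move) * memop :=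
  let: (l, (q, c, cnt)) := st in
  match l with
  | LLoad =>
      (LNext1, (tm_init M,
         [ffun i => if i == ord0
                    then if s is Letter a then tm_letter M a else tm_blank M
                    else tm_blank M], ord0), MStay, ops_RS MRight MStay, MemStay)
  | LNext1 => (LNext2, st.2, MStay, ops_RS MRight MStay, MemStay)
  | LNext2 => if zR z then (LEnd_, st.2, MStay, no_ops, MemStay)
              else (LNext3, st.2, MStay, ops_RS MRight MStay, MemStay)
  | LNext3 => if zR z then (LEnd_, st.2, MStay, no_ops, MemStay)
              else (LWalk, st.2, MStay, no_ops, MemStay)
  | LWalk => if zR z then (LRefill, st.2, MStay, no_ops, MemStay)
             else if mk then (LTest (zS z), st.2, MStay, ops_RS MLeft MRight, MemStay)
             else (LWalk, st.2, MStay, ops_RS MLeft MRight, MemPlus)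
  | LRefill => if zS z then (LWalk, st.2, MStay, no_ops, MemStay)
               else (LRefill, st.2, MStay, ops_RS MRight MLeft, MemStay)
  | LTest a =>
      if a then (LBack, (q, c, inord cnt.+1), MStay, no_ops, MemStay)
      else if zR z then
        let ins := instr_at cnt in
        if watch_ok q c (zD z) ins then
          (LBack, (in_state ins, watch_cont c (zD z) ins, ord0), MStay,
           ops_DE (in_move ins) (fun i => opp_move (in_move ins i)), MemStay)
        else (LRej, st.2, MStay, no_ops, MemStay)
      else (LBack, st.2, MStay, no_ops, MemStay)
  | LBack => if zS z then (LNext1, st.2, MStay, no_ops, MemMinus)
             else (LBack, st.2, MStay, ops_RS MRight MLeft, MemMinus)
  | LEnd_ => (if q \in tm_acc M then LRestore else LRej, st.2, MStay, no_ops, MemStay)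
  | LRestore =>
      if [forall i, zE z i] then
        (LLoop, st.2, MRight, ops_DE (fun _ => MLeft) (fun _ => MStay), MemStay)
      else (LRestore, st.2, MStay,
            ops_DE (fun i => if zE z i then MStay else MLeft)
                   (fun i => if zE z i then MStay else MRight), MemStay)
  | LLoop => (if zD z ord0 then LAcc else LLoad, st.2, MStay, no_ops, MemStay)
  | LAcc | LRej => (l, st.2, MStay, no_ops, MemStay)
  end.

Definition verifier : counter_machine Sigma :=
  @CounterMachine Sigma (label * data)%type K verifier_trans
    (LLoad, (tm_init M, [ffun => tm_blank M], ord0)) (fun st => st.1 == LAcc).

Variables (N : nat) (w : seq Sigma) (mu : nat -> bool) (p : nat).
Hypotheses (N3 : 3 < N) (mu_p : mu p) (mu_lt : forall j, j < p -> mu j = false).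

Local Notation config := (cm_config verifier).
Local Notation step := (@cm_step Sigma verifier N w mu).

Record at_config (l : label) (d : data) (raw R S : nat) (D E : T -> nat)
    (cell : nat) (x : config) : Prop := AtConfig {
  at_state : cc_state x = (l, d);
  at_raw : cc_raw x = raw;
  at_R : cc_ctr x (inl true) = R;
  at_S : cc_ctr x (inl false) = S;
  at_D : forall i, cc_ctr x (inr (i, true)) = D i;
  at_E : forall i, cc_ctr x (inr (i, false)) = E i;
  at_cell : cc_cell x = cell
}.

(** No step count is kept: the automaton has no time bound, and its walks may be exponentially
    long. *)
Definition leads (P Q : config -> Prop) :=
  forall x, P x -> exists t, Q (iter t step x).

Lemma leads_refl (P Q : config -> Prop) : (forall x, P x -> Q x) -> leads P Q.
Proof. by move=> H x Px; exists 0; apply: H. Qed.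

Lemma leads_trans Q P R : leads P Q -> leads Q R -> leads P R.
Proof.
move=> PQ QR x /PQ[t1 /QR[t2 H]]; exists (t2 + t1); by rewrite iterD.
Qed.

Lemma leads1 (P Q : config -> Prop) : (forall x, P x -> Q (step x)) -> leads P Q.
Proof. by move=> H x Px; exists 1; apply: H. Qed.

Definition zeros R S (D E : T -> nat) : {ffun K -> bool} :=
  [ffun k => match k with
             | inl x => if x then R == 0 else S == 0
             | inr (i, x) => if x then D i == 0 else E i == 0
             end].

Lemma leads_one l d raw R S D E cell l' d' raw' R' S' D' E' cell' :
    (let: (l1, d1, rm, ops, mo) :=
       verifier_trans (l, d) (insym_at w raw) (zeros R S D E) (mu cell) in
     [/\ (l1, d1) = (l', d'), head_move (size w) rm raw = raw',
         w15_move mo cell = cell', ctr_op N (ops (inl true)) R = R'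
       & [/\ ctr_op N (ops (inl false)) S = S',
             forall i, ctr_op N (ops (inr (i, true))) (D i) = D' i
           & forall i, ctr_op N (ops (inr (i, false))) (E i) = E' i]]) ->
  leads (at_config l d raw R S D E cell) (at_config l' d' raw' R' S' D' E' cell').
Proof.
move=> H; apply: leads1 => x [Es Er ER ES ED EE Ec].
rewrite /cm_step Es Er Ec.
have -> : [ffun k => cc_ctr x k == 0] = zeros R S D E.
  by apply/ffunP => -[[]|[i []]]; rewrite !ffunE ?ER ?ES ?ED ?EE.
change (cm_trans _ _ _ _) with
  (verifier_trans (l, d) (insym_at w raw) (zeros R S D E) (mu cell)).
move: H; case: (verifier_trans _ _ _ _) => [[[[l1 d1] rm] ops] mo].
case=> -[-> ->] H1 H2 H3 [H4 H5 H6]; split=> //=; rewrite ?ER ?ES // => i.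
  by rewrite ED.
by rewrite EE.
Qed.

Lemma refill_run d raw R S D E cell : R + S < N ->
  leads (at_config LRefill d raw R S D E cell)
        (at_config LWalk d raw (R + S) 0 D E cell).
Proof.
case: d => [[q c] cnt]; elim: S R => [|S IH] R lt.
  by rewrite addn0; apply: leads_one; rewrite /= /zS ffunE.
rewrite -addSnnS; apply: leads_trans (IH R.+1 _); last by lia.
apply: leads_one; rewrite /= /zS ffunE /=; split=> //.
by case: eqP => //; lia.
Qed.

Lemma back_run d raw R S D E cell : R + S < N ->
  leads (at_config LBack d raw R S D E cell)
        (at_config LNext1 d raw (R + S) 0 D E 0).
Proof.
case: d => [[q c] cnt]; elim: S R cell => [|S IH] R cell lt.
  by rewrite addn0; apply: leads_one; rewrite /= /zS ffunE.
rewrite -addSnnS; apply: leads_trans (IH R.+1 0 _); last by lia.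
apply: leads_one; rewrite /= /zS ffunE /=; split=> //.
by case: eqP => //; lia.
Qed.

(* Walking to the mark while moving [q] units between [R] and [S] computes
   [p] modulo [q]. *)
Lemma walk_run d raw q D E j : 0 < q < N -> j <= p ->
  leads (at_config LWalk d raw (q - j %% q) (j %% q) D E j)
        (at_config (LTest (q %| p)) d raw (q - p %% q).-1 (p %% q).+1 D E p).
Proof.
case: d => [[s c] cnt] /andP[q0 qN] jp.
rewrite -(subKn jp); elim: (p - j) (leq_subr j p) => {j jp} [|i IH] ip.
  rewrite subn0; have lt := ltn_pmod p q0.
  apply: leads_one; rewrite /= /zR /zS !ffunE mu_p /= subn_eq0 leqNgt lt /=.
  split=> //; first by rewrite subn_eq0 leqNgt lt.
  by split=> //; case: eqP => //; lia.
apply: leads_trans (IH (ltnW ip)).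
have -> : p - i = (p - i.+1).+1 by lia.
have : p - i.+1 < p by lia.
move: (p - i.+1) => {ip IH}j jp; have lt := ltn_pmod j q0.
have E1 : leads (at_config LWalk (s, c, cnt) raw (q - j %% q) (j %% q) D E j)
   (at_config LWalk (s, c, cnt) raw (q - j %% q).-1 (j %% q).+1 D E j.+1).
  apply: leads_one; rewrite /= /zR /zS !ffunE mu_lt //= subn_eq0 leqNgt lt /=.
  split=> //; first by rewrite subn_eq0 leqNgt lt.
  by split=> //; case: eqP => //; lia.
apply: leads_trans E1 _.
have [Eq|ne] := eqVneq (j %% q).+1 q; last first.
  have -> : j.+1 %% q = (j %% q).+1 by rewrite -addn1 -modnDml addn1 modn_small //; lia.
  by apply: leads_refl => x; rewrite subnS.
have -> : j.+1 %% q = 0 by rewrite -addn1 -modnDml addn1 Eq modnn.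
rewrite subn0 Eq; have -> : (q - j %% q).-1 = 0 by lia.
apply: leads_trans (@refill_run _ _ 0 q _ _ _ qN).
by apply: leads_one; rewrite /= /zR ffunE.
Qed.

(* [f] consists of the symbol counter of [decode] and the watched cell. *)
Definition feed (f : 'I_g.+1 * pstate M) (l : bool) : option ('I_g.+1 * pstate M) :=
  if l then Some (inord f.1.+1, f.2)
  else if ps_step N f.2 (instr_at f.1) is Some s then Some (ord0, s) else None.

Definition at_feed l (f : 'I_g.+1 * pstate M) raw R S cell :=
  at_config l (ps_state f.2, ps_cont f.2, f.1) raw R S (ps_D f.2) (ps_E f.2) cell.

Definition rejected (x : config) := (cc_state x).1 = LRej.

Definition letter_feed f q : option ('I_g.+1 * pstate M) :=
  if letter p q is Some l then feed f l else Some f.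

Lemma test_run f raw q : 2 < q < N ->
  leads (at_feed (LTest (q %| p)) f raw (q - p %% q).-1 (p %% q).+1 p)
    (if letter_feed f q is Some f' then at_feed LNext1 f' raw q 0 0 else rejected).
Proof.
case: f => [cnt s] /andP[q2 qN]; rewrite /at_feed /letter_feed /letter /=.
have lt : p %% q < q by rewrite ltn_pmod //; lia.
have Er : (q - p %% q).-1 + (p %% q).+1 = q by lia.
have Ez : ((q - p %% q).-1 == 0) = (q %| p.+1).
  rewrite /dvdn -addn1 -modnDml addn1; move: (p %% q) lt {Er} => r rq.
  have [Eq|ne] := eqVneq r.+1 q; first by rewrite Eq modnn eqxx; apply/eqP; lia.
  by rewrite modn_small; [case: eqP => //; lia | lia].
have back f' : leads (at_feed LBack f' raw (q - p %% q).-1 (p %% q).+1 p)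
   (at_feed LNext1 f' raw q 0 0) by rewrite -[q in X in leads _ X]Er; apply: back_run; lia.
case: ifP => _.
  apply: leads_trans (back (inord cnt.+1, s)).
  by apply: leads_one; rewrite /=.
rewrite -Ez /feed /=; case E0: (_ == 0); last first.
  apply: leads_trans (back (cnt, s)).
  by apply: leads_one; rewrite /= /zR ffunE E0.
rewrite /ps_step /=.
have EzD : zD (zeros (q - p %% q).-1 (p %% q).+1 (ps_D s) (ps_E s)) =
    [ffun i => ps_D s i == 0] by apply/ffunP => i; rewrite !ffunE.
case: ifP => ok.
  set s' := PState _ _ _ _; apply: leads_trans (back (ord0, s')).
  by apply: leads_one; rewrite /= /zR ffunE E0 EzD ok.
apply: leads1 => x [Es Er' ER ES ED EE Ec]; rewrite /rejected /cm_step Es Er' Ec.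
have -> : [ffun k => cc_ctr x k == 0] = zeros (q - p %% q).-1 (p %% q).+1 (ps_D s) (ps_E s).
  by apply/ffunP => -[[]|[i []]]; rewrite !ffunE ?ER ?ES ?ED ?EE.
by rewrite /= /zR ffunE E0 EzD ok.
Qed.

Lemma rejected_step x : rejected x -> rejected (step x).
Proof.
by rewrite /rejected /cm_step; case: (cc_state x) => [l [[q c] cnt]] /= ->.
Qed.

(** [q] is the last modulus already treated, so the initial value 1 makes 3 the first one to be
    tried. The stream ends when [R] wraps around at [N]. *)
Lemma stream_run f raw q : odd q -> q < N ->
  leads (at_feed LNext1 f raw q 0 0)
    (if ofold letter_feed f (odds q.+2 N) is Some f'
     then at_feed LEnd_ f' raw 0 0 0 else rejected).
Proof.
move: {2}(N - q) (leqnn (N - q)) => n; elim: n f q => [|n IH] f q le oq qN; first by lia.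
have S1 : leads (at_feed LNext1 f raw q 0 0)
    (at_feed LNext2 f raw (if q.+1 == N then 0 else q.+1) 0 0).
  by apply: leads_one.
apply: leads_trans S1 _.
have End l R : l = LNext2 \/ l = LNext3 -> R = 0 ->
    leads (at_feed l f raw R 0 0) (at_feed LEnd_ f raw 0 0 0).
  by case=> -> ->; apply: leads_one; rewrite /= /zR ffunE.
have [E|ne] := eqVneq q.+1 N.
  by rewrite odds_nil; [apply: End; auto | lia].
have S2 : leads (at_feed LNext2 f raw q.+1 0 0)
    (at_feed LNext3 f raw (if q.+2 == N then 0 else q.+2) 0 0).
  by apply: leads_one; rewrite /= /zR ffunE.
apply: leads_trans S2 _.
have [E|ne2] := eqVneq q.+2 N.
  by rewrite odds_nil; [apply: End; auto | lia].
have q2N : q.+2 < N by lia.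
have oq2 : odd q.+2 by rewrite /= negbK.
rewrite odds_cons //=.
have S3 : leads (at_feed LNext3 f raw q.+2 0 0)
    (at_feed (LTest (q.+2 %| p)) f raw (q.+2 - p %% q.+2).-1 (p %% q.+2).+1 p).
  apply: (@leads_trans (at_feed LWalk f raw (q.+2 - 0 %% q.+2) (0 %% q.+2) 0)).
    by rewrite mod0n subn0; apply: leads_one; rewrite /= /zR ffunE.
  by apply: walk_run.
have q3 : 2 < q.+2 < N by rewrite q2N andbT; case: (q) oq.
apply: leads_trans S3 _; apply: leads_trans (@test_run f raw q.+2 q3) _.
case: (letter_feed f q.+2) => [f'|]; last exact: leads_refl.
by apply: IH => //; lia.
Qed.

Definition bits := pmap (letter p) (odds 3 N).

Lemma ofold_letters f s : ofold letter_feed f s = ofold feed f (pmap (letter p) s).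
Proof.
by elim: s f => //= q s IH f; rewrite /letter_feed; case: (letter p q) => [l|] //=;
  case: (feed f l).
Qed.

Lemma ofold_feed cnt s bs :
  omap snd (ofold feed (cnt, s) bs) = ofold (ps_step N) s (decode cnt bs).
Proof.
elim: bs cnt s => [|[] bs IH] cnt s //=; rewrite /feed /=.
by case: (ps_step _ _ _) => // s'.
Qed.

Lemma ofold_ps_lt (s : pstate M) tau s' : (forall i, ps_D s i < N /\ ps_E s i < N) ->
  ofold (ps_step N) s tau = Some s' -> forall i, ps_D s' i < N /\ ps_E s' i < N.
Proof.
elim: tau s => [|a tau IH] s lt /=; first by case=> <-.
by case E: (ps_step N s a) => [s1|] //; apply/IH/(ps_step_lt lt E).
Qed.

(** Raising E and lowering D together until E wraps to zero takes N - E rounds and leaves D - (N -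
    E), which is D + E modulo [N]. Tapes that finish early wait. *)
Lemma restore_run d raw D E : (forall i, D i < N /\ E i < N) ->
  leads (at_config LRestore d raw 0 0 D E 0)
        (at_config LRestore d raw 0 0 (fun i => (D i + E i) %% N) (fun _ => 0) 0).
Proof.
case: d => [[q c] cnt] lt.
have [B] : exists B, forall i, E i != 0 -> N - E i <= B by exists N => i _; lia.
elim: B D E lt => [|B IH] D E lt le.
  have E0 i : E i = 0.
    by have := le i; have [_] := lt i; case: (E i) => // e eN /(_ isT); lia.
  apply: leads_refl => x [? ? ? ? ED EE ?]; split=> // i; rewrite ?EE ?ED E0 //.
  by rewrite addn0 modn_small //; case: (lt i).
have [/forallP E0|nE0] := boolP [forall i, E i == 0].
  apply: leads_refl => x [? ? ? ? ED EE ?]; split=> // i; rewrite ?EE ?ED (eqP (E0 i)) //.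
  by rewrite addn0 modn_small //; case: (lt i).
pose D' i := if E i == 0 then D i else ctr_op N MLeft (D i).
pose E' i := if E i == 0 then E i else ctr_op N MRight (E i).
have step1 : leads (at_config LRestore (q, c, cnt) raw 0 0 D E 0)
    (at_config LRestore (q, c, cnt) raw 0 0 D' E' 0).
  apply: leads_one; rewrite /=.
  have -> : [forall i, zE (zeros 0 0 D E) i] = [forall i, E i == 0].
    by apply: eq_forallb => i; rewrite /zE ffunE.
  rewrite (negbTE nE0); split=> //; split=> // i; rewrite /= /zE ffunE /D' /E';
    by case: (E i == 0).
apply: leads_trans step1 _; apply: leads_trans (IH D' E' _ _) _.
- by move=> i; have [? ?] := lt i; rewrite /D' /E'; case: eqP; rewrite ?ctr_op_lt.
- move=> i; have := le i; rewrite /E'; have [_] := lt i.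
  case: (E i) => [|e] // eN /(_ isT) le'.
  by rewrite /=; case: (e.+2 =P N) => // ne _; move: le' ne; lia.
apply: leads_refl => x [? ? ? ? ED EE ?]; split=> // i; rewrite ED /D' /E'.
case: eqP => // /eqP e0 /=; have [Dl El] := lt i.
case: eqP => [D0|D0]; case: eqP => [EN|EN].
- by rewrite D0 add0n addn0 -EN modn_small // modn_small //; lia.
- by rewrite D0 add0n (_ : N.-1 + (E i).+1 = E i + N) ?modnDr //; lia.
- rewrite addn0 (_ : D i + E i = (D i).-1 + N) ?modnDr //; lia.
- by congr (_ %% _); lia.
Qed.

Definition offset x := if x == 0 then 0 else N - x.

Definition at_cell_start x (y : config) :=
  exists d, at_config LLoad d (minn x.+1 (size w).+1) 0 0 (fun _ => offset x)
    (fun _ => 0) 0 y.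

Definition cell_ok x :=
  ps_acc (ofold (ps_step N) (ps_start M N w x) (decode ord0 bits)).

Definition accepted (x : config) := (cc_state x).1 = LAcc.

Lemma load_symbol x :
  (if insym_at w (minn x.+1 (size w).+1) is Letter a then tm_letter M a
   else tm_blank M) = nth (tm_blank M) (map (@tm_letter _ _ M) w) x.
Proof.
rewrite minnSS /insym_at /=.
by elim: w x => [|a v IH] [|x] //=; rewrite ?minn0 ?minnSS //= ?nth_nil.
Qed.

Lemma cell_run x : x < N ->
  leads (at_cell_start x)
    (if cell_ok x then if x.+1 == N then accepted else at_cell_start x.+1
     else rejected).
Proof.
move=> xN; set raw := minn x.+1 (size w).+1; have N0 : 0 < N by lia.
pose f0 : 'I_g.+1 * pstate M := (ord0, ps_start M N w x).
have S1 : leads (at_cell_start x) (at_feed LNext1 f0 raw 1 0 0).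
  move=> y [[[q c] cnt]]; move: y; apply: leads_one; rewrite /=; split=> //.
    congr (_, (_, _, _)); apply/ffunP => i; rewrite !ffunE.
    by case: eqP => // _; apply: load_symbol.
  by case: eqP => //; lia.
apply: leads_trans S1 _; apply: leads_trans (@stream_run f0 raw 1 isT _) _; first by lia.
rewrite ofold_letters -/bits /cell_ok -ofold_feed.
case E: (ofold feed f0 bits) => [[cnt s]|] /=; last exact: leads_refl.
have Es : ofold (ps_step N) (ps_start M N w x) (decode ord0 bits) = Some s.
  by rewrite -ofold_feed -/f0 E.
have lt i : ps_D s i < N /\ ps_E s i < N.
  by apply: ofold_ps_lt Es _ => {}i /=; case: eqP; lia.
have S2 : leads (at_feed LEnd_ (cnt, s) raw 0 0 0)
   (at_feed (if ps_state s \in tm_acc M then LRestore else LRej) (cnt, s) raw 0 0 0).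
  by apply: leads_one.
apply: leads_trans S2 _; case: ifP => acc; last by apply: leads_refl => y []; rewrite /rejected => ->.
apply: leads_trans (@restore_run (ps_state s, ps_cont s, cnt) raw _ _ lt) _.
(* By the sum invariant every D is the offset -x again; this step lowers it to -(x+1), which is zero
   modulo [N] exactly after the last cell. *)
have S3 : leads (at_config LRestore (ps_state s, ps_cont s, cnt) raw 0 0
     (fun i => (ps_D s i + ps_E s i) %% N) (fun _ => 0) 0)
   (at_config LLoop (ps_state s, ps_cont s, cnt) (minn x.+2 (size w).+1) 0 0
     (fun _ => if x.+1 == N then 0 else N - x.+1) (fun _ => 0) 0).
  apply: leads_one; rewrite /=.
  have -> : [forall i, zE (zeros 0 0 (fun i => (ps_D s i + ps_E s i) %% N) (fun=> 0)) i].
    by apply/forallP => i; rewrite /zE ffunE.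
  split=> //; first by rewrite /raw /=; lia.
  split=> // i /=; rewrite (ofold_ps_sum N0 i Es) /=.
  rewrite addn0 (modn_small (_ : (if x == 0 then 0 else N - x) < N)); last by case: eqP; lia.
  by case: (x =P 0) => [->|x0]; case: eqP; case: eqP; lia.
apply: leads_trans S3 _.
apply: (@leads_trans (at_config (if x.+1 == N then LAcc else LLoad)
   (ps_state s, ps_cont s, cnt) (minn x.+2 (size w).+1) 0 0
     (fun _ => if x.+1 == N then 0 else N - x.+1) (fun _ => 0) 0)).
  apply: leads_one; rewrite /= !ffunE; split=> //.
  by case: (x.+1 =P N) => // ne; case: eqP => //; lia.
case: eqP => [E1|E1]; apply: leads_refl => y; first by case; rewrite /accepted => ->.
by move=> Hy; exists (ps_state s, ps_cont s, cnt).
Qed.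

Lemma cells_run x : x < N ->
  leads (at_cell_start x)
    (if all cell_ok (iota x (N - x)) then accepted else rejected).
Proof.
move: {2}(N - x) (leqnn (N - x)) => n; elim: n x => [|n IH] x le xN; first by lia.
apply: leads_trans (cell_run xN) _.
rewrite -[N - x]prednK ?subn_gt0 //= -subnS.
case: (cell_ok x) => /=; last exact: leads_refl.
case: eqP => [<-|ne]; first by rewrite subnn; apply: leads_refl.
by apply: IH; lia.
Qed.

(** [cells_run] ends in one of two absorbing labels. An acceptance at any time excludes the
    rejecting one, as is seen by continuing each of the two runs for the length of the other. *)
Lemma verifier_accepts :
  cm_accepts verifier N w mu <-> forall x, x < N -> cell_ok x.
Proof.
have N0 : 0 < N by lia.
have [|t0 H] := @cells_run 0 N0 (cm_start verifier).
  by exists (tm_init M, [ffun => tm_blank M], ord0); split=> //=; rewrite minnSS min0n.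
rewrite subn0 in H; split=> [[t acc] x xN|all_ok]; last first.
  have {}all_ok : all cell_ok (iota 0 N).
    by apply/allP => x; rewrite mem_iota => xN; apply: all_ok.
  by move: H; rewrite all_ok => H; exists t0; apply/eqP.
case E: (all _ _) H => H.
  by move/allP: E; apply; rewrite mem_iota.
have acc_step y : accepted y -> accepted (step y).
  by rewrite /accepted /cm_step; case: (cc_state y) => [l [[q c] cnt]] /= ->.
have iter_acc n y : accepted y -> accepted (iter n step y).
  by move=> Hy; elim: n => //= n; apply: acc_step.
have iter_rej n y : rejected y -> rejected (iter n step y).
  by move=> Hy; elim: n => //= n; apply: rejected_step.
move/eqP: acc => acc.
have := iter_acc t0 _ acc; have := iter_rej t _ H.
by rewrite -!iterD addnC /rejected /accepted => ->.
Qed.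

End Verifier.

(** Only every second number is a modulus, so a decoded trace has fewer than N/2 instructions and
    stays in the window that [watches] requires. *)
Lemma size_odds q N : odd q -> 2 * size (odds q N) <= (N - q).+1.
Proof.
move: {2}(N - q) (leqnn (N - q)) => n; elim: n q => [|n IH] q le oq.
  by rewrite odds_nil //; lia.
have [Nq|qN] := leqP N q; first by rewrite odds_nil.
rewrite odds_cons //=; have oq2 : odd q.+2 by rewrite /= negbK.
have [Nq|qN2] := leqP N q.+2; first by rewrite odds_nil //= ; lia.
by have := IH q.+2 _ oq2; rewrite mulnS; lia.
Qed.

Lemma cm_cell_le (Sigma : finType) (C : counter_machine Sigma) N w mu t :
  cc_cell (iter t (@cm_step Sigma C N w mu) (cm_start C)) <= t.
Proof.
elim: t => //= t; move: (iter t _ _) => y yt.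
rewrite /cm_step; case: (cm_trans _ _ _ _) => [[[q rm] ops] mo] /=.
by case: mo => //=; apply: leqW.
Qed.

Lemma cm_iter_prefix (Sigma : finType) (C : counter_machine Sigma) N w mu mu' t :
    (forall x, x < t -> mu x = mu' x) ->
  iter t (@cm_step Sigma C N w mu) (cm_start C) =
  iter t (@cm_step Sigma C N w mu') (cm_start C).
Proof.
move=> eq_mu; have key i : i <= t -> iter i (@cm_step Sigma C N w mu) (cm_start C) =
    iter i (@cm_step Sigma C N w mu') (cm_start C).
  elim: i => //= i IH it; rewrite -IH; last by lia.
  rewrite {1 3}/cm_step eq_mu //; have := @cm_cell_le _ C N w mu i; lia.
exact: key.
Qed.

Lemma NP_sub_R_W15 (k : nat) (Sigma : finType) (L : seq Sigma -> Prop) :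
  0 < k -> NP L -> R_W15 (sparse k) L.
Proof.
move=> k0 [m [M [[e0 poly] LM]]].
(* [e0 + 1] covers the running time, at most [2 b^e0]; the number [g] of instructions covers the
   unary code of one instruction, since g <= b^g; 8 serves the prime count. *)
pose f := e0 + 1 + #|{: instr M}| + 8.
pose C := verifier M; exists _, (compiled C f.*2.-1) => w.
set b := (size w).+2; set N := b ^ f.*2.
have EN : b ^ f.*2.-1.+1 = N by rewrite prednK // double_gt0 /f; lia.
have f7 : 7 < f by rewrite /f; lia.
have bb : b ^ 2 <= N by rewrite leq_pexp2l //; lia.
have N3 : 3 < N by apply: leq_trans bb; rewrite -mulnn (@leq_mul 2 2).
have wN : 2 * size w <= N by apply: leq_trans bb; rewrite -mulnn leq_mul // /b; lia.
have N0 : 0 < N by lia.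
have sz p : 2 * size (decode (M := M) ord0 (bits N p)) < N.
  have := size_decode (M := M) ord0 (bits N p).
  have : size (bits N p) <= size (odds 3 N) by rewrite size_pmap count_size.
  by have := @size_odds 3 N isT; lia.
split=> [/LM[t [c [Hr acc]]]|[mu [_ /compiled_accepts]]].
  have tb := poly _ _ _ Hr; have [tau st Ht] := (tm_reach_exec _ _ _).1 Hr.
  have [||p Hp] := @letters_onto b f (encode tau) _ f7; first by [].
    apply: leq_trans (size_encode tau) _; rewrite st /f -!addnA expnD.
    rewrite [#|_| + 8]addnC addnA expnD mulnA leq_mul //.
      have b2 : 1 < b by [].
      have e0b := ltnW (ltn_expl e0 b2).
      have wb : size w ^ e0 <= b ^ e0 by case: (e0) => // e; rewrite leq_exp2r // /b; lia.
      apply: leq_trans tb (leq_trans (leq_add wb e0b) _).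
      by rewrite addnn -muln2 leq_mul // expnS (@leq_mul 2 1) // expn_gt0.
    exact/ltnW/ltn_expl.
  exists (fun x => x == p); split.
    by exists [:: p]; split=> // x /=; rewrite inE; case: (x == p).
  apply/compiled_accepts; rewrite EN; apply/(@verifier_accepts _ _ _ _ _ _ p) => //.
    by move=> j jp; apply/eqP; lia.
  apply: (@trace_watch _ _ M N N0 w _ wN (sz p)).1.
  by rewrite /bits Hp encodeK Ht.
rewrite EN => -[t acc].
(* The content may have no mark at all. Marks from cell [t] on are invisible during [t] steps and
   guarantee that a first mark exists. *)
pose mu' x := mu x || (t <= x).
have Ex : exists x, mu' x by exists t; rewrite /mu' leqnn orbT.
case: (ex_minnP Ex) => p mp minp.
have acc' : cm_accepts C N w mu'.
  by exists t; rewrite -(@cm_iter_prefix _ _ _ _ mu) // => x xt; rewrite /mu' leqNgt xt orbF.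
have mu_lt j : j < p -> mu' j = false.
  by move=> jp; apply/negP => /minp; lia.
move/(@verifier_accepts _ _ _ _ _ _ p N3 mp mu_lt): acc'.
move/(@trace_watch _ _ M N N0 w _ wN (sz p)).2.
case E: (ofold _ _ _) => [c|] //= Hc; apply/LM.
exists (size (decode (M := M) ord0 (bits N p))), c; split=> //.
by apply/tm_reach_exec; exists (decode ord0 (bits N p)).
Qed.

Import Order.TTheory GRing.Theory Num.Theory.

(** * Clocked machines whose tapes all carry the input *)

Record tape_machine (Sigma : finType) := TapeMachine {
  xm_tape : finType;
  xm_state : finType;
  xm_sym : finType;
  xm_blank : xm_sym;
  xm_in : insym Sigma -> xm_sym;
  xm_in_inj : injective xm_in;
  xm_in_blank : forall s, xm_in s != xm_blank;
  xm_trans : xm_state -> {ffun xm_tape -> xm_sym} ->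
             xm_state -> {ffun xm_tape -> xm_sym} -> {ffun xm_tape -> move} -> bool;
  xm_init : xm_state;
  xm_acc : pred xm_state
}.

Record xconfig (Sigma : finType) (X : tape_machine Sigma) := XConfig {
  xc_state : xm_state X;
  xc_head : xm_tape X -> int;
  xc_tape : xm_tape X -> int -> xm_sym X
}.

Section TapeMachine.
Variables (Sigma : finType) (X : tape_machine Sigma).
Local Notation J := (xm_tape X).
Local Notation sym := (xm_sym X).

(* The input with its endmarkers occupies the cells [-1], ..., [size w]. *)
Definition xinput (w : seq Sigma) (z : int) : sym :=
  if (-1 <= z <= (size w)%:Z)%R then xm_in X (insym_at w (absz (z + 1)%R)) else xm_blank X.

Definition xm_start w : xconfig X :=
  XConfig (xm_init X) (fun _ => 0%R) (fun _ => xinput w).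

(** Stated pointwise on heads and tapes, so that a simulation may supply any extensionally equal
    configuration. *)
Definition xm_step (c c' : xconfig X) : Prop :=
  exists (q : xm_state X) (s : {ffun J -> sym}) (d : {ffun J -> move}),
    [/\ xm_trans (xc_state c) [ffun j => xc_tape c j (xc_head c j)] q s d,
        xc_state c' = q,
        forall j, xc_head c' j = move_int (d j) (xc_head c j)
      & forall j z, xc_tape c' j z =
          if z == xc_head c j then s j else xc_tape c j z].

Inductive xm_reach (c : xconfig X) : nat -> xconfig X -> Prop :=
| xm_reach0 : xm_reach c 0 c
| xm_reachS t c1 c2 : xm_reach c t c1 -> xm_step c1 c2 -> xm_reach c t.+1 c2.

Definition xm_accepts_within (w : seq Sigma) (t : nat) :=
  exists s c, [/\ s <= t, xm_reach (xm_start w) s c & xm_acc (xc_state c)].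

Variable e : nat.
Local Notation J' := (J + 'I_e.+1)%type.
Local Notation m := #|{: J'}|.
Local Notation tstate := ('I_4 + xm_state X * {ffun 'I_e.+1 -> bool})%type.

Definition tix (j : J') : 'I_m.+1 := lift ord0 (enum_rank j).

Definition tfun (U : Type) (u : U) (F : J' -> U) : {ffun 'I_m.+1 -> U} :=
  [ffun i => if unlift ord0 i is Some r then F (enum_val r) else u].

Lemma tfunE U (u : U) F j : tfun u F (tix j) = F j.
Proof. by rewrite ffunE /tix liftK enum_rankK. Qed.

Lemma tfun0 U (u : U) F : tfun u F ord0 = u.
Proof. by rewrite ffunE unlift_none. Qed.

Lemma tixP (P : 'I_m.+1 -> Prop) : P ord0 -> (forall j, P (tix j)) -> forall i, P i.
Proof.
move=> P0 Pj i; case: (unliftP ord0 i) => [r ->|-> //].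
by rewrite -(enum_valK r); apply: Pj.
Qed.

(** The phases step left, write the left endmarker, copy the input from tape [ord0] to all tapes and
    close it with the right endmarker, and rewind. Finally the main heads go to cell 0, while the
    clock heads stay on the left endmarker, which is clock value zero. All this takes 2n + 4
    steps. *)
Definition setup (ph : 'I_4) (s : {ffun 'I_m.+1 -> sym}) :
    tstate * {ffun 'I_m.+1 -> sym} * {ffun 'I_m.+1 -> move} :=
  match nat_of_ord ph with
  | 0 => (inl (inord 1), s, [ffun => MLeft])
  | 1 => (inl (inord 2), [ffun => xm_in X LEnd], [ffun => MRight])
  | 2 => if s ord0 == xm_blank X
         then (inl (inord 3), [ffun => xm_in X REnd], [ffun => MLeft])
         else (inl (inord 2), [ffun => s ord0], [ffun => MRight])
  | _ => if s ord0 == xm_in X LEnd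
         then (inr (xm_init X, [ffun => true]), s,
               tfun MRight (fun j => if j is inl _ then MRight else MStay))
         else (inl (inord 3), s, [ffun => MLeft])
  end.

Definition clk_dir (dirs : {ffun 'I_e.+1 -> bool}) (j : nat) := dirs (inord j).
Definition clk_flag (x : insym Sigma) (s : {ffun 'I_m.+1 -> sym}) (j : nat) :=
  s (tix (inr (inord j))) == xm_in X x.

(** The clock advances with every step and blocks all transitions once it is full; this bounds
    rejecting paths as well. *)
Definition clocked_trans (st : tstate) (s : {ffun 'I_m.+1 -> sym})
    (st' : tstate) (s' : {ffun 'I_m.+1 -> sym}) (d : {ffun 'I_m.+1 -> move}) : bool :=
  match st, st' with
  | inl ph, _ => (st', s', d) == setup ph s
  | inr (q, dirs), inr (q', dirs') =>
      let dir := clk_dir dirs in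
      let l := clk_flag LEnd s in let r := clk_flag REnd s in
      [&& ~~ all (sees_max dir l r) (iota 0 e.+1),
          xm_trans q [ffun j => s (tix (inl j))] q' [ffun j => s' (tix (inl j))]
            [ffun j => d (tix (inl j))],
          dirs' == [ffun j : 'I_e.+1 => digit_dir MRight dir l r j],
          [forall j : 'I_e.+1, (s' (tix (inr j)) == s (tix (inr j))) &&
             (d (tix (inr j)) == digit_move MRight dir l r j)]
        & (s' ord0 == s ord0) && (d ord0 == MStay)]
  | inr _, inl _ => false
  end.

Lemma clocked_letter_inj : injective (fun a => xm_in X (Letter a)).
Proof. by move=> a b /xm_in_inj[]. Qed.

Definition clocked : ntm Sigma m :=
  @Ntm Sigma m tstate sym (xm_blank X) (fun a => xm_in X (Letter a))
    clocked_letter_inj (fun a => xm_in_blank X (Letter a)) clocked_trans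
    (inl ord0) [set st | if st is inr (q, _) then xm_acc q else false].

Variable w : seq Sigma.
Local Notation n := (size w).
Local Notation start := (tm_start clocked w).

Definition reads (c : tconfig clocked) : {ffun 'I_m.+1 -> sym} :=
  [ffun i => tc_tape c i (tc_head c i)].

Definition apply_instr (c : tconfig clocked) (a : tstate * {ffun 'I_m.+1 -> sym} *
    {ffun 'I_m.+1 -> move}) : tconfig clocked :=
  @TConfig _ _ clocked a.1.1 (fun i => move_int (a.2 i) (tc_head c i))
    (fun i x => if x == tc_head c i then a.1.2 i else tc_tape c i x).

Lemma setup_step (c c' : tconfig clocked) ph : tc_state c = inl ph ->
  tm_step c c' <-> c' = apply_instr c (setup ph (reads c)).
Proof.
move=> Es; split=> [[q [s [d [Ht ->]]]]|->].
  by move: Ht; rewrite Es /= => /eqP; rewrite -/(reads c) => <-.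
case E: (setup ph (reads c)) => [[q s] d]; exists q, s, d; split=> //.
by rewrite Es /= -/(reads c) E eqxx.
Qed.

Definition uniform (c : tconfig clocked) (ph : nat) (h : int)
    (T : 'I_m.+1 -> int -> sym) :=
  [/\ tc_state c = inl (inord ph), forall i, tc_head c i = h
    & forall i z, tc_tape c i z = T i z].

Definition partial (j : int) (i : 'I_m.+1) (z : int) : sym :=
  if (-1 <= z < j)%R then xinput w z else tc_tape start i z.

Lemma start_tape0 (z : int) :
  tc_tape start ord0 z =
    if (0 <= z < n%:Z)%R then xinput w z else xm_blank X.
Proof.
rewrite /= /xinput; case: z => j; last by [].
case: ifP => jn; last by rewrite nth_default // size_map; lia.
have -> : (-1 <= Posz j <= n)%R by lia.
have jn' : j < n by lia.
have -> : absz (Posz j + 1)%R = j.+1 by lia.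
rewrite /insym_at /=; elim: (w) j jn' {jn} => //= a v IH [|j] // lt.
exact: IH.
Qed.

Lemma uniform0 : uniform start 0 0 (fun i z => tc_tape start i z).
Proof. by split=> //=; congr inl; apply/val_inj; rewrite /= inordK. Qed.

Lemma setup_inord (ph : nat) s : ph < 4 -> setup (inord ph) s =
  match ph with
  | 0 => (inl (inord 1), s, [ffun => MLeft])
  | 1 => (inl (inord 2), [ffun => xm_in X LEnd], [ffun => MRight])
  | 2 => if s ord0 == xm_blank X
         then (inl (inord 3), [ffun => xm_in X REnd], [ffun => MLeft])
         else (inl (inord 2), [ffun => s ord0], [ffun => MRight])
  | _ => if s ord0 == xm_in X LEnd
         then (inr (xm_init X, [ffun => true]), s,
               tfun MRight (fun j => if j is inl _ then MRight else MStay))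
         else (inl (inord 3), s, [ffun => MLeft])
  end.
Proof. by move=> ph4; rewrite /setup inordK. Qed.

Definition setup_at (t : nat) (c : tconfig clocked) :=
  match t with
  | 0 => uniform c 0 0 (fun i z => tc_tape start i z)
  | 1 => uniform c 1 (-1) (fun i z => tc_tape start i z)
  | t'.+2 => if t' <= n then uniform c 2 t'%:Z (partial t'%:Z)
             else uniform c 3 ((n.*2)%:Z - t'%:Z)%R (fun _ => xinput w)
  end.

Definition run_at (s : nat) (c : tconfig clocked) (x : xconfig X) :=
  exists dirs (pos : nat -> nat),
    [/\ tc_state c = inr (xc_state x, dirs),
        forall j, tc_head c (tix (inl j)) = xc_head x j,
        forall j z, tc_tape c (tix (inl j)) z = xc_tape x j z,
        forall j z, tc_tape c (tix (inr j)) z = xinput w z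
      & [/\ forall j, pos j <= n.+1,
            forall j : 'I_e.+1, tc_head c (tix (inr j)) = ((pos j)%:Z - 1)%R
          & numval n.+2 e.+1 (digit_val n (clk_dir dirs) pos) = s]].

Lemma xinput_pos (p : nat) : p <= n.+1 -> xinput w (p%:Z - 1)%R = xm_in X (insym_at w p).
Proof.
move=> pn; rewrite /xinput; have -> : (-1 <= p%:Z - 1 <= n%:Z)%R by lia.
by congr (xm_in X (insym_at w _)); lia.
Qed.

Lemma setup_stepP t c : t < n.*2.+3 -> setup_at t c -> exists ph, tc_state c = inl ph /\
  setup_at t.+1 (apply_instr c (setup ph (reads c))).
Proof.
case: t => [|[|t]] tn.
- case=> Es Eh Et; exists (inord 0); split=> //; rewrite setup_inord //; split=> //.
    by move=> i; rewrite /= ffunE Eh.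
  by move=> i z; rewrite -Et [LHS]/= ffunE Eh; case: eqP => [->|//].
- case=> Es Eh Et; exists (inord 1); split=> //; rewrite setup_inord //.
  rewrite /setup_at leq0n; split=> //.
    by move=> i; rewrite /= ffunE Eh.
  move=> i z; rewrite [LHS]/= ffunE Eh Et /partial; case: eqP => [->|zn].
    by rewrite (_ : (-1 <= -1 < _)%R) // /xinput (_ : (-1 <= -1 <= n%:Z)%R) //; lia.
  by rewrite (_ : (-1 <= z < _)%R = false) //; lia.
rewrite /setup_at; case: (leqP t n) => tn1.
  case=> Es Eh Et; exists (inord 2); split=> //; rewrite setup_inord //.
  have E0 : reads c ord0 = if t < n then xinput w t%:Z else xm_blank X.
    rewrite ffunE Eh Et /partial (_ : (-1 <= t%:Z < t%:Z)%R = false); last by lia.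
    by rewrite start_tape0; congr (if _ then _ else _); lia.
  rewrite E0; case: ltnP => ltn.
    rewrite (_ : (xinput w t%:Z == xm_blank X) = false); last first.
      rewrite /xinput (_ : (-1 <= t%:Z <= n%:Z)%R); last by lia.
      exact/negbTE/xm_in_blank.
    split=> // [i|i z]; first by rewrite /= ffunE Eh /=; lia.
    rewrite [LHS]/= ffunE Eh Et /partial; case: eqP => [->|zt].
      by rewrite (_ : (-1 <= t%:Z < t.+1%:Z)%R) //; lia.
    by congr (if _ then _ else _); lia.
  have {tn1 ltn}Etn : t = n by lia.
  rewrite eqxx; split=> // [i|i z]; first by rewrite /= ffunE Eh /=; lia.
  rewrite [LHS]/= ffunE Eh Et Etn /partial; case: eqP => [->|zt].
    rewrite /xinput (_ : (-1 <= n%:Z <= n%:Z)%R); last by lia.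
    by rewrite (_ : absz _ = n.+1) /insym_at ?nth_default //= ?size_map; lia.
  case: ifP => // zn; rewrite /xinput (_ : (-1 <= z <= n%:Z)%R = false); last by lia.
  move: i; apply: tixP; first by rewrite start_tape0 (_ : (0 <= z < n%:Z)%R = false) //; lia.
  by [].
rewrite ltnNge (ltnW tn1).
case=> Es Eh Et; exists (inord 3); split=> //; rewrite setup_inord //.
rewrite (_ : (reads c ord0 == xm_in X LEnd) = false).
  split=> // [i|i z]; first by rewrite /= ffunE Eh /=; lia.
  by rewrite [LHS]/= ffunE Eh Et; case: eqP => // ->.
rewrite ffunE Eh Et.
have -> : ((n.*2)%:Z - t%:Z)%R = ((n.*2.+1 - t)%:Z - 1)%R by lia.
rewrite xinput_pos; last by lia.
apply/negP => /eqP/xm_in_inj E; have := insym_at_left w (n.*2.+1 - t).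
by rewrite E /=; lia.
Qed.

Lemma setup_last c : setup_at n.*2.+3 c -> exists ph, tc_state c = inl ph /\
  run_at 0 (apply_instr c (setup ph (reads c))) (xm_start w).
Proof.
rewrite /setup_at ifN; last by lia.
case=> Es Eh Et; exists (inord 3); split=> //; rewrite setup_inord //.
have E1 : ((n.*2)%:Z - ((n.*2).+1)%:Z)%R = (0%:Z - 1)%R by lia.
rewrite E1 in Eh.
have E0 i : reads c i = xm_in X LEnd by rewrite ffunE Eh Et xinput_pos.
rewrite E0 eqxx; exists [ffun => true], (fun=> 0); split=> //.
- by move=> j; rewrite /= tfunE Eh.
- by move=> j z; rewrite [LHS]/= E0 Eh Et; case: eqP => // ->; symmetry; exact: (@xinput_pos 0).
- by move=> j z; rewrite [LHS]/= E0 Eh Et; case: eqP => // ->; symmetry; exact: (@xinput_pos 0).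
split=> // [j|]; first by rewrite /= tfunE Eh.
rewrite /numval big1 // => j _; by rewrite /digit_val /clk_dir ffunE.
Qed.

Local Notation N := (n.+2 ^ e.+1).

Section RunStep.
Variables (s : nat) (c : tconfig clocked) (x : xconfig X).
Variables (dirs : {ffun 'I_e.+1 -> bool}) (pos : nat -> nat).
Hypothesis (Es : tc_state c = inr (xc_state x, dirs)).
Hypothesis (Eh : forall j, tc_head c (tix (inl j)) = xc_head x j).
Hypothesis (Et : forall j z, tc_tape c (tix (inl j)) z = xc_tape x j z).
Hypothesis (Ek : forall j z, tc_tape c (tix (inr j)) z = xinput w z).
Hypothesis (pn : forall j, pos j <= n.+1).
Hypothesis (Ep : forall j : 'I_e.+1, tc_head c (tix (inr j)) = ((pos j)%:Z - 1)%R).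
Hypothesis (Ev : numval n.+2 e.+1 (digit_val n (clk_dir dirs) pos) = s).

Let l := clk_flag LEnd (reads c).
Let r := clk_flag REnd (reads c).

Lemma clk_leftE j : j < e.+1 -> l j = (pos j == 0).
Proof.
move=> je; rewrite /l /clk_flag ffunE Ek Ep xinput_pos // inordK //.
rewrite -(insym_at_left w); apply/eqP/idP => [/xm_in_inj -> //|].
by case: (insym_at w _).
Qed.

Lemma clk_rightE j : j < e.+1 -> r j = (pos j == n.+1).
Proof.
move=> je; rewrite /r /clk_flag ffunE Ek Ep xinput_pos // inordK //.
rewrite -(insym_at_right (pn j)); apply/eqP/idP => [/xm_in_inj -> //|].
by case: (insym_at w _).
Qed.

Lemma clk_maxE : all (sees_max (clk_dir dirs) l r) (iota 0 e.+1) = (s.+1 == N).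
Proof.
rewrite -Ev; apply: counter_maxE => j je; [exact: pn | exact: clk_leftE | exact: clk_rightE].
Qed.

Lemma numval_lt_N : s < N.
Proof.
rewrite -Ev; apply: numval_lt => // j je.
by have := pn j; rewrite /digit_val; case: clk_dir; lia.
Qed.

Lemma reads_main : [ffun j => reads c (tix (inl j))] =
  [ffun j => xc_tape x j (xc_head x j)] :> {ffun J -> sym}.
Proof. by apply/ffunP => j; rewrite !ffunE Eh Et. Qed.

Lemma clk_move_pos (j : 'I_e.+1) :
  move_int (digit_move MRight (clk_dir dirs) l r j) (tc_head c (tix (inr j))) =
  ((head_move n (digit_move MRight (clk_dir dirs) l r j) (pos j))%:Z - 1)%R.
Proof.
have := @digit_move_in n e.+1 (clk_dir dirs) l r pos (fun j _ => pn j)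
  clk_leftE clk_rightE MRight j (ltn_ord j).
by rewrite Ep; have := pn j; case: digit_move => /=; lia.
Qed.

Lemma run_clock dirs' (c' : tconfig clocked) :
    dirs' = [ffun j : 'I_e.+1 => digit_dir MRight (clk_dir dirs) l r j] ->
    (forall j : 'I_e.+1, tc_head c' (tix (inr j)) =
       move_int (digit_move MRight (clk_dir dirs) l r j) (tc_head c (tix (inr j)))) ->
    s.+1 != N ->
  let pos' j := head_move n (digit_move MRight (clk_dir dirs) l r j) (pos j) in
  [/\ forall j, pos' j <= n.+1,
      forall j : 'I_e.+1, tc_head c' (tix (inr j)) = ((pos' j)%:Z - 1)%R
    & numval n.+2 e.+1 (digit_val n (clk_dir dirs') pos') = s.+1].
Proof.
move=> -> Hc' sN pos'; split=> [j|j|].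
- by rewrite /pos'; have := pn j; case: digit_move => /=; lia.
- by rewrite Hc' clk_move_pos.
rewrite (_ : s.+1 = ctr_op N MRight s); last by rewrite /= (negbTE sN).
rewrite -Ev -(@counter_step n e.+1 (clk_dir dirs) l r pos (fun j _ => pn j)
  clk_leftE clk_rightE).
by apply: eq_numval => j je; rewrite /digit_val /clk_dir ffunE inordK.
Qed.

Lemma run_sound c' : tm_step c c' -> exists2 x', xm_step x x' & run_at s.+1 c' x'.
Proof.
case=> -[ph|[q' dirs']] [t [d [Ht ->]]]; move: Ht; rewrite Es //.
change (tm_trans _ _ _ _ _) with
  (clocked_trans (inr (xc_state x, dirs)) (reads c) (inr (q', dirs')) t d).
case/and5P; rewrite -/l -/r clk_maxE reads_main.
move=> sN Hx /eqP Ed /forallP Hk _.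
exists (@XConfig _ X q' (fun j => move_int (d (tix (inl j))) (xc_head x j))
   (fun j z => if z == xc_head x j then t (tix (inl j)) else xc_tape x j z)).
  by exists q', [ffun j => t (tix (inl j))], [ffun j => d (tix (inl j))];
    split=> //= [j|j z]; rewrite ffunE.
exists dirs', (fun j => head_move n (digit_move MRight (clk_dir dirs) l r j) (pos j)).
split=> //.
- by move=> j; rewrite /= Eh.
- by move=> j z; rewrite /= Eh Et.
- move=> j z; rewrite /=; case: eqP => [->|_]; last exact: Ek.
  by have /andP[/eqP -> _] := Hk j; rewrite ffunE Ek.
apply: run_clock => // j.
by have /andP[_ /eqP E] := Hk j; rewrite /= E.
Qed.

Lemma run_complete x' : s.+1 != N -> xm_step x x' ->
  exists2 c', tm_step c c' & run_at s.+1 c' x'.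
Proof.
move=> sN [q [t [d [Ht Eq Eh' Et']]]].
pose dirs' := [ffun j : 'I_e.+1 => digit_dir MRight (clk_dir dirs) l r j].
pose t' := tfun (reads c ord0) (fun j => if j is inl i then t i else reads c (tix j)).
pose d' := tfun MStay (fun j =>
  match j with inl i => d i | inr i => digit_move MRight (clk_dir dirs) l r i end).
exists (apply_instr c (inr (q, dirs'), t', d')).
  exists (inr (q, dirs')), t', d'; split=> //.
  rewrite Es; change (tm_trans _ _ _ _ _) with
    (clocked_trans (inr (xc_state x, dirs)) (reads c) (inr (q, dirs')) t' d').
  apply/and5P; rewrite -/l -/r clk_maxE reads_main.
  split=> //.
  - have -> : [ffun j => t' (tix (inl j))] = t by apply/ffunP => j; rewrite ffunE tfunE.
    by have -> : [ffun j => d' (tix (inl j))] = d by apply/ffunP => j; rewrite ffunE tfunE.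
  - by apply/forallP => j; rewrite !tfunE !eqxx.
  - by rewrite !tfun0 !eqxx.
exists dirs', (fun j => head_move n (digit_move MRight (clk_dir dirs) l r j) (pos j)).
split=> //; rewrite ?Eq //.
- by move=> j; rewrite /= tfunE Eh' Eh.
- by move=> j z; rewrite /= tfunE Eh Et Et'.
- by move=> j z; rewrite /= tfunE ffunE !Ek; case: eqP => // ->.
by apply: run_clock => // j; rewrite /= tfunE.
Qed.
End RunStep.

Lemma clocked_inv t c : tm_reach start t c ->
  (t <= n.*2.+3 /\ setup_at t c) \/
  exists s x, [/\ t = n.*2 + 4 + s, s < N, xm_reach (xm_start w) s x & run_at s c x].
Proof.
elim=> [|{}t c1 c2 _ IH st]; first by left; split; [|apply uniform0].
case: IH => [[]|[s [x [-> sN rx [dirs [pos [Es Eh Et Ek [pn Ep Ev]]]]]]]]; last first.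
  have [x' sx rx'] := run_sound Es Eh Et Ek pn Ep Ev st.
  right; exists s.+1, x'; split=> //; [by lia | | exact: xm_reachS rx sx].
  by case: rx' => d' [p' [_ _ _ _ [pn' _ Ev']]]; apply: numval_lt_N pn' Ev'.
rewrite leq_eqVlt => /orP[/eqP ->|tn] Hs.
  have [ph [Eph rc]] := setup_last Hs; right; exists 0, (xm_start w).
  move/(setup_step _ Eph): st => ->; split=> //; [by lia | by rewrite expn_gt0|].
  exact: xm_reach0.
have [ph [Eph rc]] := setup_stepP tn Hs.
by move/(setup_step _ Eph): st => ->; left.
Qed.

Lemma clocked_setup : exists2 c, tm_reach start (n.*2 + 4) c & run_at 0 c (xm_start w).
Proof.
have key t : t <= n.*2.+3 -> exists2 c, tm_reach start t c & setup_at t c.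
  elim: t => [|t IH] tn; first by exists start; [exact: tm_reach0 | apply uniform0].
  have [c rc Hc] := IH (ltnW tn); have [ph [Eph Hc']] := setup_stepP tn Hc.
  by eexists; last exact: Hc'; apply: tm_reachS rc _; apply/(setup_step _ Eph).
have [c rc Hc] := key _ (leqnn _); have [ph [Eph Hc']] := setup_last Hc.
eexists; last exact: Hc'; rewrite (_ : n.*2 + 4 = n.*2.+4); last by lia.
by apply: tm_reachS rc _; apply/(setup_step _ Eph).
Qed.

Lemma clocked_run s x : xm_reach (xm_start w) s x -> s < N ->
  exists2 c, tm_reach start (n.*2 + 4 + s) c & run_at s c x.
Proof.
elim=> [|{}s x1 x2 _ IH sx] sN; first by rewrite addn0; exact: clocked_setup.
have [c rc [dirs [pos [Es Eh Et Ek [pn Ep Ev]]]]] := IH (ltnW sN).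
have [|c' sc rc'] := run_complete Es Eh Et Ek pn Ep Ev _ sx; first by lia.
by exists c' => //; rewrite -addSnnS addSn; apply: tm_reachS rc sc.
Qed.

Lemma clocked_accepts : tm_accepts clocked w <-> xm_accepts_within w N.-1.
Proof.
have N0 : 0 < N by rewrite expn_gt0.
split=> [[t [c [rc]]]|[s [x [sN rx acc]]]].
  rewrite inE; case: (clocked_inv rc) => [[_]|[s [x [_ sN rx [d [p [-> _ _ _ _]]]]]] acc].
    by case: t {rc} => [|[|t]] /=; [case=> -> | case=> -> | case: ifP => _ [->]].
  by exists s, x; split=> //; lia.
have [|c rc [d [p [Es _ _ _ _]]]] := clocked_run rx; first by lia.
by exists (n.*2 + 4 + s), c; rewrite inE Es.
Qed.

Lemma clocked_time t c : tm_reach start t c -> t <= n.*2 + 4 + N.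
Proof.
by case/clocked_inv => [[tn _]|[s [x [-> sN _ _]]]]; lia.
Qed.
End TapeMachine.

(** The additive constant serves n = 0 and n = 1, where powers of [n] do not grow. For n >= 2 the
    inequalities n + 2 <= n^2 and 2n + 4 <= n^3 let the power suffice. *)
Lemma poly_bound e n : n.*2 + 4 + n.+2 ^ e <= n ^ (3 ^ e + e.*2 + 8) + (3 ^ e + e.*2 + 8).
Proof.
have e23 : 2 ^ e <= 3 ^ e by case: (e) => // ?; rewrite leq_exp2r.
case: n => [|[|n]]; [by lia | by rewrite exp1n; lia | ].
set m := n.+2; apply: (@leq_trans (m ^ (3 ^ e + e.*2 + 8))); last exact: leq_addr.
have m1 : 1 < m by [].
have H1 : m.+2 ^ e <= m ^ e.*2.
  rewrite -mul2n expnM; case: (e) => // ?; rewrite leq_exp2r // -mulnn.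
  by rewrite /m; nia.
have H2 : m.*2 + 4 <= m ^ 3 by rewrite !expnS expn0 /m; nia.
have H3 : m ^ 3 + m ^ e.*2 <= m ^ (e.*2 + 4).
  have p1 : 0 < m ^ 3 by rewrite expn_gt0.
  have p2 : 0 < m ^ e.*2 by rewrite expn_gt0.
  rewrite expnD (expnS m 3) mulnCA; move: (m ^ 3) (m ^ e.*2) p1 p2 => a b p1 p2.
  apply: (@leq_trans (2 * (b * a))); last by rewrite leq_mul2r m1 orbT.
  by rewrite mul2n -addnn leq_add ?leq_pmull ?leq_pmulr.
apply: leq_trans (leq_add H2 H1) (leq_trans H3 _).
by rewrite leq_exp2l //; lia.
Qed.

Lemma NP_of_clocked (Sigma : finType) (X : tape_machine Sigma) (e : nat)
    (L : seq Sigma -> Prop) :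
    (forall w, L w <-> xm_accepts_within X w ((size w).+2 ^ e.+1).-1) ->
  NP L.
Proof.
move=> LX; exists _, (clocked X e); split; last first.
  by move=> w; rewrite LX; split=> /clocked_accepts.
exists (3 ^ e.+1 + e.+1.*2 + 8) => w t c /clocked_time le.
exact: leq_trans le (poly_bound _ _).
Qed.

Import Order.Theory.

(** * Constraints on gap lengths *)

(* [BCyc r m] stands for the progression [r + (m.+1) i]. *)
Inductive block := BExact of nat | BGe of nat | BCyc of nat & nat.

Definition block_code (b : block) : nat + (nat + nat * nat) :=
  match b with BExact r => inl r | BGe r => inr (inl r) | BCyc r m => inr (inr (r, m)) end.

Definition block_decode (c : nat + (nat + nat * nat)) : block :=
  match c with inl r => BExact r | inr (inl r) => BGe r | inr (inr (r, m)) => BCyc r m end.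

Lemma block_codeK : cancel block_code block_decode.
Proof. by case. Qed.

Module BlockFinite.
HB.instance Definition _ := Equality.copy block (can_type block_codeK).
End BlockFinite.
Export BlockFinite.

Definition in_block (l : nat) (b : block) : bool :=
  match b with
  | BExact r => l == r
  | BGe r => r <= l
  | BCyc r m => (r <= l) && (m.+1 %| l - r)
  end.

Definition meets (b b' : block) := exists l, in_block l b && in_block l b'.

(** Divisibility is a distributive lattice; this law is what makes pairwise compatible congruences
    jointly solvable. *)
Lemma gcdn_lcml a b c : gcdn (lcmn a b) c = lcmn (gcdn a c) (gcdn b c).
Proof. exact: (@meetUl _ natdvd a b c). Qed.

Lemma crt2 a c M m : 0 < m -> a = c %[mod gcdn M m] ->
  exists x, x = a %[mod M] /\ x = c %[mod m].
Proof.
move=> m0 ac; set g := gcdn M m.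
have g0 : 0 < g by rewrite gcdn_gt0 m0 orbT.
(* [u * M] is congruent to -g modulo [m], so adding [d] copies of it to [a] changes the residue
   modulo [m] by a multiple of [g] and keeps the one modulo [M]. The summand [c * m] below keeps the
   difference natural. *)
have [u _ /dvdnP[v Hv]] := Bezoutr M m0; rewrite -/g in Hv.
have cle : c <= a + c * m by nia.
have /dvdnP[d Hd] : g %| a + c * m - c.
  rewrite -eqn_mod_dvd //; apply/eqP; rewrite -modnDmr.
  by have /eqP -> : g %| c * m; rewrite ?addn0 // dvdn_mull // dvdn_gcdr.
exists (a + u * M * d); split; first by rewrite mulnAC addnC modnMDl.
apply/eqP; rewrite -(eqn_modDr (d * g)) -[c + d * g](_ : a + c * m = _); last by lia.
apply/eqP; rewrite (_ : a + u * M * d + d * g = v * d * m + a); last first.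
  by have := congr1 (muln d) Hv; lia.
by rewrite modnMDl addnC modnMDl.
Qed.

Lemma crt_general (s : seq (nat * nat)) :
    (forall c, c \in s -> 0 < c.2) ->
    (forall c c', c \in s -> c' \in s -> exists x, x = c.1 %[mod c.2] /\ x = c'.1 %[mod c'.2]) ->
  exists x, forall c, c \in s -> x = c.1 %[mod c.2].
Proof.
move=> pos pair.
(* The divisibility clause is carried along so that a congruence modulo the common multiple
   specializes to each modulus. *)
suff [x [H _]] : exists x, (forall c, c \in s -> x = c.1 %[mod c.2]) /\
    forall c, c \in s -> c.2 %| \big[lcmn/1]_(c' <- s) c'.2 by exists x.
elim: s pos pair => [|[r m] s IH] pos pair; first by exists 0.
have [||x [Hx Hd]] := IH; [by move=> c cs; apply: pos; rewrite inE cs orbT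
  | by move=> c c' cs cs'; apply: pair; rewrite inE ?cs ?cs' orbT |].
have m0 : 0 < m by apply: (pos (r, m)); rewrite mem_head.
rewrite big_cons /=; set M := \big[lcmn/1]_(c' <- s) c'.2 in Hd *.
have [|y [yx yr]] := @crt2 x r M m m0.
  have : forall c, c \in s -> x = r %[mod gcdn c.2 m].
    move=> c cs; have [|z [z1 z2]] := pair c (r, m) _ (mem_head _ _); first by rewrite inE cs orbT.
    have E1 : x = z %[mod gcdn c.2 m].
      have := Hx c cs; rewrite -z1 => /(congr1 (modn ^~ (gcdn c.2 m))).
      by rewrite !modn_dvdm ?dvdn_gcdl.
    by rewrite E1; move: z2 => /= /(congr1 (modn ^~ (gcdn c.2 m))); rewrite !modn_dvdm ?dvdn_gcdr.
  rewrite /M; elim: (s) => [|c s' IHs] H.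
    by rewrite big_nil gcd1n !modn1.
  rewrite big_cons gcdn_lcml.
  have H1 := H c (mem_head _ _); have {}IHs : x = r %[mod gcdn (\big[lcmn/1]_(c' <- s') c'.2) m].
    by apply: IHs => c' cs; apply: H; rewrite inE cs orbT.
  move: H1 IHs; move: (gcdn c.2 m) (gcdn _ m) => g1 g2; clear.
  wlog le : x r / x <= r.
    by move=> W H1 H2; case: (leqP x r) => [/W|/ltnW /W ->]; auto.
  move=> H1 H2.
  apply/esym/eqP; rewrite eqn_mod_dvd // dvdn_lcm -!eqn_mod_dvd //.
  by apply/andP; split; apply/eqP.
exists y; split=> c; rewrite inE => /orP[/eqP -> //|cs].
- rewrite -(Hx c cs); move/(congr1 (modn ^~ c.2)): yx.
  by rewrite !modn_dvdm ?Hd.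
- by rewrite dvdn_lcml.
- by apply: dvdn_trans (Hd c cs) _; rewrite dvdn_lcmr.
Qed.

(** A Helly property. If some block is a single point, that point lies in all of them. Otherwise
    rays count as progressions of modulus 1, pairwise solvability gives a common residue, and a
    shift by a multiple of all moduli passes every starting point. *)
Lemma blocks_meet (bs : seq block) :
    (forall b b', b \in bs -> b' \in bs -> meets b b') ->
  exists l, all (in_block l) bs.
Proof.
pose b0 := BGe 0; move=> pair.
have [/hasP|] := boolP (has (fun i => if nth b0 bs i is BExact _ then true else false) (iota 0 (size bs))).
  case=> i; rewrite mem_iota add0n /= => isz; case Ei: (nth b0 bs i) => [r||] // _.
  exists r; apply/(all_nthP b0) => j jsz; have [l] := pair _ _ (mem_nth b0 isz) (mem_nth b0 jsz).
  by rewrite -/b0 Ei /= => /andP[/eqP ->].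
move/hasPn => noex.
pose ap b : nat * nat := match b with BCyc r m => (r, m.+1) | BGe r => (r, 1) | BExact r => (r, 1) end.
have apP l i : i < size bs -> in_block l (nth b0 bs i) =
    ((ap (nth b0 bs i)).1 <= l) && ((ap (nth b0 bs i)).2 %| l - (ap (nth b0 bs i)).1).
  move=> isz; have := noex i; rewrite mem_iota add0n isz => /(_ isT).
  by case: (nth b0 bs i) => //= r; rewrite dvd1n andbT.
pose s := [seq ap b | b <- bs].
have nthE i : i < size bs -> nth (0, 1) s i = ap (nth b0 bs i) by move=> isz; rewrite (nth_map b0).
have pos c : c \in s -> 0 < c.2.
  case/(nthP (0, 1)) => i; rewrite size_map => isz <-.
  by rewrite nthE //; case: (nth b0 bs i).
have [|x Hx] := crt_general pos.
  move=> c c' /(nthP (0, 1))[i isz <-] /(nthP (0, 1))[j jsz <-].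
  rewrite size_map in isz jsz; have [l] := pair _ _ (mem_nth b0 isz) (mem_nth b0 jsz).
  rewrite !apP // -!nthE // => /andP[/andP[l1 l2] /andP[l3 l4]].
  by exists l; split; apply/eqP; rewrite eqn_mod_dvd.
pose B := \sum_(c <- s) c.1; pose P := \prod_(c <- s) c.2.
exists (x + B * P); apply/(all_nthP b0) => i isz; rewrite apP //.
have cs : ap (nth b0 bs i) \in s by rewrite -nthE // mem_nth ?size_map.
move: (ap _) cs => c cs.
have P0 : 0 < P by rewrite /P big_seq prodn_cond_gt0 // => c' /pos.
have cB : c.1 <= B by rewrite /B (big_rem c) //= leq_addr.
have cP : c.2 %| P by rewrite /P (big_rem c) //= dvdn_mulr.
have le : c.1 <= x + B * P by nia.
rewrite le -eqn_mod_dvd //= -modnDmr (_ : B * P %% c.2 = 0) ?addn0 ?Hx //.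
by apply/eqP; rewrite -/(dvdn _ _) dvdn_mull.
Qed.

(** * Comparing the blocks of a log *)

Inductive lsym := SBegin | SZero | SLeft | SRight | SExact | SGe | SStop.

Definition lsym_seq := [:: SBegin; SZero; SLeft; SRight; SExact; SGe; SStop].

Definition lsym_code (s : lsym) : nat :=
  match s with SBegin => 0 | SZero => 1 | SLeft => 2 | SRight => 3 | SExact => 4
  | SGe => 5 | SStop => 6 end.

Lemma lsym_codeK : cancel (fun s => inord (lsym_code s) : 'I_7)
  (fun i => nth SStop lsym_seq i).
Proof. by case; rewrite /= inordK. Qed.

Module LsymFinite.
HB.instance Definition _ := Equality.copy lsym (can_type lsym_codeK).
HB.instance Definition _ := Choice.copy lsym (can_type lsym_codeK).
HB.instance Definition _ := Countable.copy lsym (can_type lsym_codeK).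
HB.instance Definition _ := Finite.copy lsym (can_type lsym_codeK).
End LsymFinite.
Export LsymFinite.

Definition block_tail (b : block) : seq lsym :=
  match b with
  | BExact r => [:: SExact]
  | BGe r => [:: SGe]
  | BCyc r m => SLeft :: rcons (nseq m SZero) SRight
  end.

Definition block_offset (b : block) : nat :=
  match b with BExact r => r | BGe r => r | BCyc r m => r end.

(** Unary on purpose: a head that has walked over the block for [t] steps tests the gap length [t].
    The distance from [SLeft] to [SRight] is the period [m.+1]. *)
Definition enc (b : block) : seq lsym :=
  SBegin :: nseq (block_offset b) SZero ++ block_tail b.

(** [V1] and [V3] rewind the first and the second head, [V2] and [V4] move them on to the next
    block, [VW] walks both in step, [V5] returns the first head to the start of its block, and [V6]
    steps it off that start. *)
Inductive vphase := V1 | V2 | V3 | V4 | VW | V5 | V6 | VD.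

Definition vphase_code (v : vphase) : nat :=
  match v with V1 => 0 | V2 => 1 | V3 => 2 | V4 => 3 | VW => 4 | V5 => 5 | V6 => 6
  | VD => 7 end.

Lemma vphase_codeK : cancel (fun s => inord (vphase_code s) : 'I_8)
  (fun i => nth VD [:: V1; V2; V3; V4; VW; V5; V6; VD] i).
Proof. by case; rewrite /= inordK. Qed.

Module VphaseFinite.
HB.instance Definition _ := Equality.copy vphase (can_type vphase_codeK).
HB.instance Definition _ := Choice.copy vphase (can_type vphase_codeK).
HB.instance Definition _ := Countable.copy vphase (can_type vphase_codeK).
HB.instance Definition _ := Finite.copy vphase (can_type vphase_codeK).
End VphaseFinite.
Export VphaseFinite.

(* A walking head bounces between [SLeft] and [SRight], so that it is on one of
   them exactly at the times of the progression. *)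
Definition walk1 (d : bool) (s : option lsym) : option (bool * move) :=
  match s with
  | Some SBegin | Some SLeft => Some (true, MRight)
  | Some SZero => Some (d, if d then MRight else MLeft)
  | Some SRight => Some (false, MLeft)
  | Some SGe => Some (d, MStay)
  | _ => None
  end.

Definition cand (s : option lsym) : bool :=
  match s with
  | Some SLeft | Some SRight | Some SExact | Some SGe => true
  | _ => false
  end.

Definition vstate := (vphase * bool * bool)%type.

Definition vopt (st : vstate) (sa sb : option lsym) : seq (vstate * move * move) :=
  let: (ph, da, db) := st in
  match ph with
  | V1 => if sa is Some _ then [:: (V1, da, db, MLeft, MStay)]
          else [:: (V2, da, db, MRight, MStay)]
  | V2 => match sa with
          | None => [::]
          | Some SBegin => [:: (V3, da, db, MStay, MStay)]
          | Some SStop => [:: (VD, da, db, MStay, MStay)]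
          | Some _ => [:: (V2, da, db, MRight, MStay)]
          end
  | V3 => if sb is Some _ then [:: (V3, da, db, MStay, MLeft)]
          else [:: (V4, da, db, MStay, MRight)]
  | V4 => match sb with
          | None => [::]
          | Some SBegin => [:: (VW, true, true, MStay, MStay)]
          | Some SStop => [:: (V6, da, db, MStay, MStay)]
          | Some _ => [:: (V4, da, db, MStay, MRight)]
          end
  | VW => (if cand sa && cand sb then [:: (V5, da, db, MStay, MStay)] else [::]) ++
          (if walk1 da sa is Some (da', ma) then
             if walk1 db sb is Some (db', mb) then [:: (VW, da', db', ma, mb)] else [::]
           else [::])
  | V5 => match sa with
          | None => [::]
          | Some SBegin => [:: (V4, da, db, MStay, MStay)]
          | Some _ => [:: (V5, da, db, MLeft, MStay)]
          end
  | V6 => if sa is Some SBegin then [:: (V2, da, db, MRight, MStay)] else [::]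
  | VD => [::]
  end.

Definition mv (d : move) (x : nat) : nat :=
  match d with MLeft => x.-1 | MStay => x | MRight => x.+1 end.

(* Position [0] is the left endmarker, position [(size u).+1] the stop symbol. *)
Definition rd (u : seq lsym) (x : nat) : option lsym :=
  nth (Some SStop) (None :: map Some u) x.

Definition vrel (u : seq lsym) (c c' : vstate * nat * nat) : bool :=
  has (fun o => c' == (o.1.1, mv o.1.2 c.1.2, mv o.2 c.2))
    (vopt c.1.1 (rd u c.1.2) (rd u c.2)).

Definition can_move (u : seq lsym) (d : move) (x : nat) :=
  match d with MLeft => 0 < x | MStay => true | MRight => x <= size u end.

Lemma rd_none u x : (rd u x == None) = (x == 0).
Proof.
case: x => [|x] //=; rewrite /rd /=.
by elim: u x => [|s u IH] [|x] //=; exact: IH.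
Qed.

Lemma rd_stop u x : size u < x -> rd u x = Some SStop.
Proof. by move=> ux; rewrite /rd nth_default //= size_map. Qed.

(** The heads stay between the left endmarker and the stop symbol, so the truncated predecessor in
    [mv] agrees with a move on the integers and only finitely many configurations arise. *)
Lemma vopt_can_move u st x y o : o \in vopt st (rd u x) (rd u y) ->
  can_move u o.1.2 x && can_move u o.2 y.
Proof.
have cx z s : rd u z = Some s -> 0 < z by move=> E; rewrite lt0n -(rd_none u) E.
have c0 z : rd u z = None -> z <= size u.
  by move/eqP; rewrite rd_none => /eqP ->.
have cr z s : rd u z = Some s -> s <> SStop -> z <= size u.
  by move=> E; case: leqP => // /rd_stop; rewrite E => -[->].
case: st => [[ph da] db]; rewrite /vopt.
case: ph => //; rewrite /walk1.
- case E: (rd u x) => [s|]; rewrite inE => /eqP -> /=; rewrite andbT.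
    exact: cx E.
  exact: c0.
- case E: (rd u x) => [[]|] //; rewrite inE => /eqP -> //=; rewrite andbT;
  by apply: cr E _.
- case E: (rd u y) => [s|]; rewrite inE => /eqP -> /=.
    exact: cx E.
  exact: c0.
- case E: (rd u y) => [[]|] //; rewrite inE => /eqP -> //=; by apply: cr E _.
- rewrite mem_cat => /orP[]; first by case: ifP => // _; rewrite inE => /eqP ->.
  have W z s d d' m : rd u z = s -> walk1 d s = Some (d', m) -> can_move u m z.
    move=> E; rewrite /walk1; case: s E => [[]|] //= E [_ <-] //=.
    all: rewrite ?(cr _ _ E) ?(cx _ _ E) //.
    by case: d; rewrite /= ?(cr _ _ E) ?(cx _ _ E).
  rewrite -/(walk1 da (rd u x)) -/(walk1 db (rd u y)).
  case E1: (walk1 da _) => [[da' ma]|] //; case E2: (walk1 db _) => [[db' mb]|] //.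
  by rewrite inE => /eqP -> /=; rewrite (W _ _ _ _ _ erefl E1) (W _ _ _ _ _ erefl E2).
- case E: (rd u x) => [[]|] //; rewrite inE => /eqP -> //=; rewrite andbT;
  by apply: cx E.
- by case E: (rd u x) => [[]|] //; rewrite inE => /eqP -> /=; rewrite andbT; apply: cr E _.
Qed.

(* [o] is the position of a walking head [t] steps after it left the first cell
   of the block. *)
Definition walk_at (b : block) (t : nat) (d : bool) (o : nat) : Prop :=
  match b with
  | BExact r => [/\ d, o = t.+1 & t <= r]
  | BGe r => d /\ o = (minn t r).+1
  | BCyc r m =>
      [\/ [/\ d, o = t.+1 & t <= r],
          exists s, [/\ d, 0 < s <= m.+1, o = r.+1 + s, r + s <= t & m.+1 %| t - (r + s)]
        | exists s, [/\ ~~ d, s <= m, o = r.+1 + s, r <= t & m.+1 %| t - r + s]]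
  end.

Lemma nth_enc b o : nth SStop (enc b) o.+1 =
  if o < block_offset b then SZero else nth SStop (block_tail b) (o - block_offset b).
Proof. by rewrite /= nth_cat size_nseq nth_nseq; case: (o < _). Qed.

Lemma size_enc b : size (enc b) = (block_offset b + size (block_tail b)).+1.
Proof. by rewrite /= size_cat size_nseq. Qed.

Lemma walk_at_in b t d o : walk_at b t d o -> 0 < o < size (enc b).
Proof.
rewrite size_enc; case: b => [r|r|r m] /=.
- by case=> _ -> ?; lia.
- by case=> _ ->; lia.
by rewrite size_rcons size_nseq => -[[_ -> ?]|[s [_ ? -> _ _]]|[s [_ ? -> _ _]]]; lia.
Qed.

Lemma nth_cyc r m s : nth SStop (block_tail (BCyc r m)) s =
  if s == 0 then SLeft else if s <= m then SZero else if s == m.+1 then SRight else SStop.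
Proof.
case: s => [|s] //=; rewrite nth_rcons nth_nseq size_nseq eqSS.
by case: (ltngtP s m).
Qed.

(** In the cyclic case the distance [s] from [SLeft] is, up to sign, the elapsed time modulo the
    period; it is a multiple of the period only at the two turning points. *)
Lemma walk_at_cand b t d o : walk_at b t d o ->
  cand (Some (nth SStop (enc b) o)) = in_block t b.
Proof.
case: b => [r|r|r m].
- case=> _ -> tr; rewrite nth_enc /=; case: ltnP => rt; first by case: eqP => //; lia.
  by rewrite (_ : t - r = 0) //=; [case: eqP => //; lia | lia].
- case=> _ ->; rewrite nth_enc /=; case: ltnP => rt; first by case: leqP => //; lia.
  by rewrite (_ : minn t r - r = 0) //=; [case: leqP => //; lia | lia].
case=> [[_ -> tr]|[s [_ sm -> rt dv]]|[s [_ sm -> rt dv]]].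
- rewrite nth_enc [block_offset _]/=; case: ltnP => rt.
    by rewrite /= leqNgt rt.
  have -> : t = r by lia.
  by rewrite subnn /= leqnn subnn dvdn0.
- rewrite addSn nth_enc [block_offset _]/= ltnNge leq_addr /= -[SLeft :: _]/(block_tail (BCyc r m)) addKn nth_cyc.
  have -> : r <= t by lia.
  have E : t - r = t - (r + s) + s by lia.
  rewrite E dvdn_addr //.
  case: (posnP s) => [s0|s0]; first by lia.
  case: (leqP s m) => sm'; first by rewrite gtnNdvd.
  have -> : s = m.+1 by lia.
  by rewrite /= ?ltnn ?eqxx dvdnn.
- rewrite addSn nth_enc [block_offset _]/= ltnNge leq_addr /= -[SLeft :: _]/(block_tail (BCyc r m)) addKn nth_cyc.
  rewrite rt sm; case: (posnP s) => [s0|s0] /=; first by rewrite s0 addn0 in dv; rewrite dv.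
  apply/esym/negbTE/negP => dv2; move: dv; rewrite dvdn_addr //.
  by rewrite gtnNdvd.
Qed.

Lemma walk_at_step b t d o d' m : walk_at b t d o ->
  walk1 d (Some (nth SStop (enc b) o)) = Some (d', m) -> walk_at b t.+1 d' (mv m o).
Proof.
case: b => [r|r|r p].
- case=> dT -> tr; rewrite nth_enc /=; case: ltnP => rt.
    by rewrite dT /= => -[<- <-].
  by rewrite (_ : t - r = 0) //; lia.
- case=> dT ->; rewrite nth_enc /=; case: ltnP => rt.
    by rewrite dT /= => -[<- <-] /=; split=> //; lia.
  by rewrite (_ : minn t r - r = 0) /= ?dT; [case=> <- <- /=; split=> //; lia | lia].
case=> [[dT -> tr]|[s [dT sm -> rt dv]]|[s [dF sm -> rt dv]]].
- rewrite nth_enc [block_offset _]/=; case: ltnP => rt.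
    by rewrite dT /= => -[<- <-]; constructor 1.
  have -> : t = r by lia.
  rewrite subnn /= => -[<- <-]; constructor 2; exists 1; split=> //=; try lia.
  by rewrite addn1 subnn dvdn0.
- rewrite addSn nth_enc [block_offset _]/= ltnNge leq_addr /= -[SLeft :: _]/(block_tail (BCyc r p)) addKn nth_cyc.
  case: (s =P 0) => s0; first by lia.
  case: (leqP s p) => sp.
    rewrite dT /= => -[<- <-]; constructor 2; exists s.+1; split=> //=; try lia.
    by rewrite addnS subSS.
  have Es : s = p.+1 by lia.
  rewrite Es eqxx /= => -[<- <-]; constructor 3; exists p; split=> //=; try lia.
  by rewrite (_ : t.+1 - r + p = t - (r + s) + 2 * p.+1) ?dvdn_addr ?dvdn_mull //; lia.
- rewrite addSn nth_enc [block_offset _]/= ltnNge leq_addr /= -[SLeft :: _]/(block_tail (BCyc r p)) addKn nth_cyc.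
  rewrite sm; case: (s =P 0) => [s0|s0] /=.
    case=> <- <-; constructor 2; exists 1; split=> //=; try lia.
    by rewrite s0 addn0 in dv; rewrite addn1 subSS.
  rewrite (negbTE dF) => -[<- <-]; constructor 3; exists s.-1; split=> //=; try lia.
  by rewrite (_ : t.+1 - r + s.-1 = t - r + s) //; lia.
Qed.


(** Only a point block can stop its walker, and it does so at its own length, so a walker aiming at
    a length in the block is not stopped before. *)
Lemma walk_at_moves b t d o l : walk_at b t d o -> t < l -> in_block l b ->
  exists d' m, walk1 d (Some (nth SStop (enc b) o)) = Some (d', m).
Proof.
have get s : s <> SExact -> s <> SStop -> exists d' m, walk1 d (Some s) = Some (d', m).
  by case: s => // _ _; repeat eexists.
move=> W tl lb; apply: get; have := walk_at_in W; move: W lb; case: b => [r|r|r m].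
- by case=> _ -> _ /eqP lr _; rewrite nth_enc /=; case: ltnP => //; lia.
- by case=> _ -> _ _; rewrite nth_enc /=; case: ltnP => //; case: (_ - _) => [|[|?]].
- move=> _ _; case: o => [|o] // /andP[_ sz]; rewrite nth_enc; case: ltnP => // _.
  by rewrite nth_cyc; do 3 (case: ifP => //).
- by case=> _ -> _ /eqP lr _; rewrite nth_enc /=; case: ltnP => //; lia.
- by case=> _ -> _ _; rewrite nth_enc /=; case: ltnP => // rt; rewrite (_ : _ - _ = 0) //; lia.
- move=> _ _; case: o => [|o] // /andP[_]; rewrite size_enc nth_enc.
  rewrite [size _]/= size_rcons size_nseq [block_offset _]/= => om.
  case: (ltnP o r) => // ro; rewrite nth_cyc.
  case: (o - r =P 0) => // e1; case: (leqP (o - r) m) => // e2.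
  by case: (o - r =P m.+1) => // e3 _; lia.
Qed.

Definition log_word (bs : seq block) : seq lsym := flatten (map enc bs).

Definition base (bs : seq block) : nat := (size (log_word bs)).+1.

Lemma log_word_cat bs1 bs2 : log_word (bs1 ++ bs2) = log_word bs1 ++ log_word bs2.
Proof. by rewrite /log_word map_cat flatten_cat. Qed.

Lemma base_rcons bs b : base (rcons bs b) = base bs + size (enc b).
Proof. by rewrite /base -cats1 log_word_cat size_cat /log_word /= cats0 addSn. Qed.

Lemma rd_cat bs1 bs2 o : rd (log_word (bs1 ++ bs2)) (base bs1 + o) = rd (log_word bs2) o.+1.
Proof.
rewrite /rd log_word_cat map_cat /base addSn /= nth_cat size_map ltnNge leq_addr /=.
by rewrite addKn.
Qed.

Lemma rd_block bs1 b bs2 o : o < size (enc b) ->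
  rd (log_word (bs1 ++ b :: bs2)) (base bs1 + o) = Some (nth SStop (enc b) o).
Proof.
move=> ob; rewrite rd_cat -cat1s log_word_cat /rd map_cat.
have -> : log_word [:: b] = enc b by exact: cats0.
change (nth (Some SStop) (map Some (enc b) ++ map Some (log_word bs2)) o =
  Some (nth SStop (enc b) o)).
by rewrite nth_cat size_map ob (nth_map SStop).
Qed.

Lemma rd_base bs1 b bs2 : rd (log_word (bs1 ++ b :: bs2)) (base bs1) = Some SBegin.
Proof. by rewrite -[base bs1]addn0 rd_block. Qed.

Lemma rd_end bs : rd (log_word bs) (base bs) = Some SStop.
Proof. by rewrite rd_stop. Qed.

Lemma enc_inner b o : 0 < o < size (enc b) ->
  nth SStop (enc b) o <> SBegin /\ nth SStop (enc b) o <> SStop.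
Proof.
case: o => // o /andP[_]; rewrite size_enc ltnS nth_enc.
case: (ltnP o (block_offset b)) => // bo ob; case: b bo ob => [r|r|r m].
- by move=> /= ro ob; rewrite (_ : o - r = 0) //; lia.
- by move=> /= ro ob; rewrite (_ : o - r = 0) //; lia.
rewrite nth_cyc [size _]/= size_rcons size_nseq [block_offset _]/= => ro ob.
case: (o - r =P 0) => // e1; case: (leqP (o - r) m) => // e2.
by case: (o - r =P m.+1) => // e3; exfalso; lia.
Qed.

(** * Soundness and completeness of the block comparison *)

Section Verify.
Variable bs : seq block.
Local Notation u := (log_word bs).

Definition clear (x y : nat) := x <= y /\
  forall z, x <= z < y -> exists s, [/\ rd u z = Some s, s <> SBegin & s <> SStop].

Definition all_meet (l : seq block) := forall b b', b \in l -> b' \in bs -> meets b b'.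
Definition meets_all b (l : seq block) := forall b', b' \in l -> meets b b'.

Lemma all_meet_rcons l b : all_meet l -> meets_all b bs -> all_meet (rcons l b).
Proof. by move=> H1 H2 c c'; rewrite mem_rcons inE => /orP[/eqP ->|]; [apply: H2 | apply: H1]. Qed.

Lemma meets_all_rcons l b c : meets_all b l -> meets b c -> meets_all b (rcons l c).
Proof. by move=> H1 H2 c'; rewrite mem_rcons inE => /orP[/eqP ->|/H1]. Qed.

Lemma clear_refl x : clear x x.
Proof. by split=> // z; lia. Qed.

Lemma clear_block bs1 b bs2 o : bs = bs1 ++ b :: bs2 -> 0 < o <= size (enc b) ->
  clear (base bs1 + o) (base (rcons bs1 b)).
Proof.
move=> E ob; rewrite base_rcons; split; first by lia.
move=> z zb; exists (nth SStop (enc b) (z - base bs1)).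
have H : 0 < z - base bs1 < size (enc b) by lia.
have [? ?] := enc_inner H; split=> //.
by rewrite E -(rd_block bs1 bs2) ?subnKC //; lia.
Qed.

Lemma clear_stop x bs1 bs2 : bs = bs1 ++ bs2 -> clear x (base bs1) ->
    rd u x = Some SBegin \/ rd u x = Some SStop ->
  x = base bs1 /\ rd u x = if bs2 is [::] then Some SStop else Some SBegin.
Proof.
move=> E [le cl] H; have Ex : x = base bs1.
  case: (ltngtP x (base bs1)) le => // lt _.
  by have [|s [Es s1 s2]] := cl x; [lia | move: H; rewrite Es => -[[]|[]]].
split=> //; rewrite Ex E; case: bs2 E H => [|b bs2] E H; last exact: rd_base.
by rewrite cats0 rd_end.
Qed.

Lemma clear_next x y : clear x y -> (exists s, rd u x = Some s) ->
  rd u x <> Some SBegin -> rd u x <> Some SStop ->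
  (forall bs1 bs2, bs = bs1 ++ bs2 -> y = base bs1 -> clear x.+1 y).
Proof.
move=> [le cl] _ H1 H2 bs1 bs2 E Ey.
have lt : x < y.
  rewrite ltn_neqAle le andbT; apply/eqP => Exy.
  case: bs2 E => [|b bs2] E; [apply: H2 | apply: H1]; rewrite Exy Ey E ?rd_base //.
  by rewrite cats0 rd_end.
by split=> // z zy; apply: cl; lia.
Qed.

(** [bs1] are the blocks already compared with all, [b] is the current one, and [cs1] are those
    compared with [b]. In [VW] both walkers share one time [t], which is the common length once both
    stand on candidate cells. *)
Definition vinv (c : vstate * nat * nat) : Prop :=
  let: (ph, da, db, x, y) := c in
  match ph with
  | V1 => True
  | V2 => exists bs1 bs2, [/\ bs = bs1 ++ bs2, all_meet bs1 & clear x (base bs1)]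
  | V3 => exists bs1 b bs2, [/\ bs = bs1 ++ b :: bs2, all_meet bs1 & x = base bs1]
  | V4 => exists bs1 b bs2 cs1 cs2, [/\ bs = bs1 ++ b :: bs2, all_meet bs1,
            x = base bs1, bs = cs1 ++ cs2 & meets_all b cs1 /\ clear y (base cs1)]
  | VW => exists bs1 b bs2 cs1 c cs2, [/\ bs = bs1 ++ b :: bs2, all_meet bs1,
            bs = cs1 ++ c :: cs2, meets_all b cs1 &
            [/\ x = base bs1, y = base cs1, da & db] \/
            exists t o o', [/\ x = base bs1 + o, y = base cs1 + o',
              walk_at b t da o & walk_at c t db o']]
  | V5 => exists bs1 b bs2 cs1 cs2, [/\ bs = bs1 ++ b :: bs2, all_meet bs1,
            bs = cs1 ++ cs2, meets_all b cs1 &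
            clear y (base cs1) /\ exists2 o, o < size (enc b) & x = base bs1 + o]
  | V6 => exists bs1 b bs2, [/\ bs = bs1 ++ b :: bs2, all_meet bs1,
            meets_all b bs & x = base bs1]
  | VD => all_meet bs
  end.

Lemma mv_add m x o : 0 < o -> mv m (x + o) = x + mv m o.
Proof. by case: m => /=; lia. Qed.

Lemma walk_at0 b : walk_at b 0 true 1.
Proof.
case: b => [r|r|r m] /=; [by split | by rewrite min0n | by constructor 1].
Qed.

Lemma vinv_step c c' : vinv c -> vrel u c c' -> vinv c'.
Proof.
case: c => [[[[ph da] db] x] y]; rewrite /vrel /=.
case: ph => //=.
- move=> _; case E: (rd u x) => [s|]; rewrite /= orbF => /eqP -> //=.
  have -> : x = 0 by apply/eqP; rewrite -(rd_none u) E.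
  exists [::], bs; split=> //; exact: clear_refl.
- case=> bs1 [bs2 [E ok cl]].
  have nx := @clear_next _ _ cl.
  case Es: (rd u x) nx => [s|] nx; last by [].
  have [Ex|nb] := eqVneq s SBegin.
    rewrite Ex /= orbF => /eqP -> /=; rewrite Ex in Es.
    have [Ex' ] := clear_stop E cl (or_introl Es); rewrite Es.
    by case: bs2 E => [|b bs2] E // _; exists bs1, b, bs2.
  have [Ex|ns] := eqVneq s SStop.
    rewrite Ex /= orbF => /eqP -> /=; rewrite Ex in Es.
    have [Ex' ] := clear_stop E cl (or_intror Es); rewrite Es.
    by case: bs2 E => [|b bs2] E // _; rewrite E cats0 in ok *.
  have cl' : clear x.+1 (base bs1).
    by apply: nx E _ => //; [exists s | move=> [/eqP] | move=> [/eqP]]; rewrite ?(negbTE nb) ?(negbTE ns).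
  move=> H; have : c' = (V2, da, db, x.+1, y).
    by move: H; case: s {Es nx} nb ns => nb ns /=; rewrite ?orbF => /eqP -> //;
      [move: nb | move: ns]; rewrite eqxx.
  by move=> -> /=; exists bs1, bs2.
- case=> bs1 [b [bs2 [E ok Ex]]]; case Es: (rd u y) => [s|]; rewrite /= orbF => /eqP -> /=.
    by exists bs1, b, bs2.
  have -> : y = 0 by apply/eqP; rewrite -(rd_none u) Es.
  by exists bs1, b, bs2, [::], bs; split=> //; split=> //; exact: clear_refl.
- case=> bs1 [b [bs2 [cs1 [cs2 [E ok Ex E' [okb cl]]]]]].
  have nx := @clear_next _ _ cl.
  case Es: (rd u y) nx => [s|] nx; last by [].
  have [Ey|nb] := eqVneq s SBegin.
    rewrite Ey /= orbF => /eqP -> /=; rewrite Ey in Es.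
    have [Ey' ] := clear_stop E' cl (or_introl Es); rewrite Es.
    case: cs2 E' => [|c cs2] E' // _; exists bs1, b, bs2, cs1, c, cs2; split=> //.
    by left.
  have [Ey|ns] := eqVneq s SStop.
    rewrite Ey /= orbF => /eqP -> /=; rewrite Ey in Es.
    have [Ey' ] := clear_stop E' cl (or_intror Es); rewrite Es.
    case: cs2 E' => [|c cs2] E' // _; exists bs1, b, bs2; split=> //.
    by rewrite E' cats0.
  have cl' : clear y.+1 (base cs1).
    by apply: nx E' _ => //; [exists s | move=> [/eqP] | move=> [/eqP]]; rewrite ?(negbTE nb) ?(negbTE ns).
  move=> H; have : c' = (V4, da, db, x, y.+1).
    by move: H; case: s {Es nx} nb ns => nb ns /=; rewrite ?orbF => /eqP -> //;
      [move: nb | move: ns]; rewrite eqxx.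
  by move=> -> /=; exists bs1, b, bs2, cs1, cs2.
- case=> bs1 [b [bs2 [cs1 [c [cs2 [E ok E' okb H]]]]]].
  rewrite has_cat => /orP[].
    case: ifP => // /andP[ca cb]; rewrite /= orbF => /eqP -> /=.
    case: H ca cb => [[-> -> _ _]|[t [o [o' [-> -> W W']]]]].
      by rewrite {1}E rd_base.
    have /andP[o0 ob] := walk_at_in W; have /andP[o0' ob'] := walk_at_in W'.
    rewrite {1}E {1}E' !rd_block // (walk_at_cand W) (walk_at_cand W') => tb tc.
    exists bs1, b, bs2, (rcons cs1 c), cs2; split=> //; first by rewrite cat_rcons.
      by apply: meets_all_rcons => //; exists t; rewrite tb tc.
    by split; [apply: (clear_block E'); lia | exists o].
  case E1: (walk1 da _) => [[da' ma]|] //; case E2: (walk1 db _) => [[db' mb]|] //=.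
  rewrite orbF => /eqP -> /=.
  case: H E1 E2 => [[-> -> da1 db1]|[t [o [o' [-> -> W W']]]]].
    rewrite {1}E {1}E' !rd_base /= => -[<- <-] [<- <-].
    exists bs1, b, bs2, cs1, c, cs2; split=> //; right; exists 0, 1, 1.
    by rewrite /= !addn1; split=> //; exact: walk_at0.
  have /andP[o0 ob] := walk_at_in W; have /andP[o0' ob'] := walk_at_in W'.
  rewrite {1}E {1}E' !rd_block // => E1 E2.
  have W1 := walk_at_step W E1; have W2 := walk_at_step W' E2.
  exists bs1, b, bs2, cs1, c, cs2; split=> //; right; exists t.+1, (mv ma o), (mv mb o').
  by rewrite !mv_add.
- case=> bs1 [b [bs2 [cs1 [cs2 [E ok E' okb [cl [o ob Ex]]]]]]].
  have [o0|o0] := posnP o.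
    rewrite Ex o0 addn0 {1}E rd_base /= orbF => /eqP -> /=.
    by exists bs1, b, bs2, cs1, cs2; split.
  rewrite Ex {1}E rd_block //; have [|s1 s2] := @enc_inner b o; first by rewrite o0.
  have Eo : base bs1 + o.-1 = size (log_word bs1) + o by rewrite /base; lia.
  move=> H; have : c' = (V5, da, db, base bs1 + o.-1, y).
    by rewrite Eo; move: H; case: (nth _ _ _) s1 => //= _; rewrite orbF => /eqP.
  move=> -> /=; exists bs1, b, bs2, cs1, cs2; split=> //; split=> //.
  by exists o.-1 => //; lia.
- case=> bs1 [b [bs2 [E ok okb ->]]]; rewrite {1}E rd_base /= orbF => /eqP -> /=.
  exists (rcons bs1 b), bs2; split; [by rewrite cat_rcons | exact: all_meet_rcons |].
  by rewrite -addn1; apply: (clear_block E); rewrite size_enc.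
Qed.

Definition conn (c c' : vstate * nat * nat) :=
  exists2 p, path (vrel u) c p & last c p = c'.

Lemma conn_refl c : conn c c.
Proof. by exists [::]. Qed.

Lemma conn_trans c1 c2 c3 : conn c1 c2 -> conn c2 c3 -> conn c1 c3.
Proof.
case=> p pp <- [q pq <-]; exists (p ++ q); first by rewrite cat_path pp.
by rewrite last_cat.
Qed.

Lemma conn1 st st' ma mb x y x' y' : (st', ma, mb) \in vopt st (rd u x) (rd u y) ->
  mv ma x = x' -> mv mb y = y' -> conn (st, x, y) (st', x', y').
Proof.
move=> H <- <-; exists [:: (st', mv ma x, mv mb y)] => //=; rewrite andbT /vrel /=.
by apply/hasP; exists (st', ma, mb).
Qed.

Lemma conn_V1 da db x y : conn (V1, da, db, x, y) (V2, da, db, 1, y).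
Proof.
elim: x => [|x IH]; first by apply: (@conn1 _ _ MRight MStay); rewrite ?inE.
apply: conn_trans IH; apply: (@conn1 _ _ MLeft MStay) => //.
by case E: (rd u x.+1) (rd_none u x.+1) => [s|] //=; rewrite inE.
Qed.

Lemma conn_V3 da db x y : conn (V3, da, db, x, y) (V4, da, db, x, 1).
Proof.
elim: y => [|y IH]; first by apply: (@conn1 _ _ MStay MRight); rewrite ?inE.
apply: conn_trans IH; apply: (@conn1 _ _ MStay MLeft) => //.
by case E: (rd u y.+1) (rd_none u y.+1) => [s|] //=; rewrite inE.
Qed.

Lemma clear_ind (P : nat -> Prop) x y : clear x y -> P y ->
    (forall z s, z < y -> rd u z = Some s -> s <> SBegin -> s <> SStop -> P z.+1 -> P z) ->
  P x.
Proof.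
case=> le cl Py H; have key n : n <= y - x -> P (y - n).
  elim: n => [|n IH] nx; first by rewrite subn0.
  have [|s [Es s1 s2]] := cl (y - n.+1); first by lia.
  apply: (H _ s) => //; first by lia.
  by rewrite (_ : (y - n.+1).+1 = y - n); [apply: IH; lia | lia].
by rewrite -(subKn le); apply: key.
Qed.

Lemma conn_V2 da db x y z : clear x z -> conn (V2, da, db, x, y) (V2, da, db, z, y).
Proof.
move=> cl; apply: (@clear_ind (fun t => conn (V2, da, db, t, y) (V2, da, db, z, y)) x z cl).
  exact: conn_refl.
move=> t s _ Es s1 s2 H; apply: conn_trans H; apply: (@conn1 _ _ MRight MStay) => //.
by rewrite Es; case: s s1 s2 {Es} => //= _ _; rewrite inE.
Qed.

Lemma conn_V4 da db x y z : clear y z -> conn (V4, da, db, x, y) (V4, da, db, x, z).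
Proof.
move=> cl; apply: (@clear_ind (fun t => conn (V4, da, db, x, t) (V4, da, db, x, z)) y z cl).
  exact: conn_refl.
move=> t s _ Es s1 s2 H; apply: conn_trans H; apply: (@conn1 _ _ MStay MRight) => //.
by rewrite Es; case: s s1 s2 {Es} => //= _ _; rewrite inE.
Qed.

Lemma conn_V5 bs1 b bs2 da db o y : bs = bs1 ++ b :: bs2 -> o < size (enc b) ->
  conn (V5, da, db, base bs1 + o, y) (V4, da, db, base bs1, y).
Proof.
move=> E; elim: o => [|o IH] ob.
  by rewrite addn0; apply: (@conn1 _ _ MStay MStay) => //; rewrite {1}E rd_base inE.
apply: conn_trans (IH (ltnW ob)); apply: (@conn1 _ _ MLeft MStay) => //; last by rewrite /mv addnS.
rewrite {1}E rd_block //; have [|s1 _] := @enc_inner b o.+1; first by [].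
by case: (nth _ _ _) s1 => //= _; rewrite inE.
Qed.

(** The walk goes on up to a common length, which may be large; only the existence of a path
    matters, and its length is cut down afterwards. *)
Lemma conn_VW bs1 b bs2 cs1 c cs2 : bs = bs1 ++ b :: bs2 -> bs = cs1 ++ c :: cs2 ->
    meets b c ->
  exists da db o o', [/\ o < size (enc b), 0 < o' < size (enc c) &
    conn (VW, true, true, base bs1, base cs1) (V5, da, db, base bs1 + o, base cs1 + o')].
Proof.
move=> E E' [l /andP[lb lc]].
have key t : t <= l -> exists da db o o', [/\ walk_at b t da o, walk_at c t db o' &
    conn (VW, true, true, base bs1, base cs1) (VW, da, db, base bs1 + o, base cs1 + o')].
  elim: t => [|t IH] tl.
    exists true, true, 1, 1; split; [exact: walk_at0 | exact: walk_at0 |].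
    by apply: (@conn1 _ _ MRight MRight); rewrite ?addn1 // {1}E {1}E' !rd_base inE.
  have [da [db [o [o' [W W' H]]]]] := IH (ltnW tl).
  have [da' [ma E1]] := walk_at_moves W tl lb.
  have [db' [mb E2]] := walk_at_moves W' tl lc.
  have /andP[o0 ob] := walk_at_in W; have /andP[o0' ob'] := walk_at_in W'.
  exists da', db', (mv ma o), (mv mb o'); split.
  - exact: walk_at_step W E1.
  - exact: walk_at_step W' E2.
  apply: conn_trans H _; apply: (@conn1 _ _ ma mb); rewrite ?mv_add //.
  by rewrite {1}E {1}E' !rd_block // [vopt _ _ _]/(_ ++ _) E1 E2 mem_cat inE eqxx orbT.
have [da [db [o [o' [W W' H]]]]] := key l (leqnn l).
have /andP[o0 ob] := walk_at_in W; have obc := walk_at_in W'; have /andP[o0' ob'] := obc.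
exists da, db, o, o'; split=> //; apply: conn_trans H _.
apply: (@conn1 _ _ MStay MStay) => //; rewrite {1}E {1}E' !rd_block //.
by rewrite /vopt mem_cat (walk_at_cand W) (walk_at_cand W') lb lc inE eqxx.
Qed.

Hypothesis meet : all_meet bs.

Lemma conn_inner bs1 b bs2 cs1 cs2 da db : bs = bs1 ++ b :: bs2 -> bs = cs1 ++ cs2 ->
  exists da' db' y, conn (V4, da, db, base bs1, base cs1) (V6, da', db', base bs1, y).
Proof.
move=> E; elim: cs2 cs1 da db => [|c cs2 IH] cs1 da db E'.
  exists da, db, (base cs1); apply: (@conn1 _ _ MStay MStay) => //.
  by rewrite {2}E' cats0 rd_end inE.
have mbc : meets b c.
  by apply: meet; [rewrite E | rewrite E']; rewrite mem_cat mem_head orbT.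
have [da1 [db1 [o [o' [ob ob' H]]]]] := conn_VW E E' mbc.
have [|da2 [db2 [y H2]]] := IH (rcons cs1 c) da1 db1; first by rewrite cat_rcons.
exists da2, db2, y.
apply: (@conn_trans _ (VW, true, true, base bs1, base cs1)).
  by apply: (@conn1 _ _ MStay MStay) => //; rewrite {2}E' rd_base inE.
apply: conn_trans H (conn_trans (conn_V5 _ _ _ E ob) (conn_trans _ H2)).
by apply: conn_V4; apply: (clear_block E'); lia.
Qed.

Lemma conn_outer bs1 bs2 da db y : bs = bs1 ++ bs2 ->
  exists da' db' x' y', conn (V2, da, db, base bs1, y) (VD, da', db', x', y').
Proof.
elim: bs2 bs1 da db y => [|b bs2 IH] bs1 da db y E.
  exists da, db, (base bs1), y; apply: (@conn1 _ _ MStay MStay) => //.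
  by rewrite {1}E cats0 rd_end inE.
have [da1 [db1 [y1 H1]]] := @conn_inner bs1 b bs2 [::] bs da db E erefl.
have [|da2 [db2 [x2 [y2 H2]]]] := IH (rcons bs1 b) da1 db1 y1; first by rewrite cat_rcons.
exists da2, db2, x2, y2.
apply: (@conn_trans _ (V3, da, db, base bs1, y)).
  by apply: (@conn1 _ _ MStay MStay) => //; rewrite {1}E rd_base inE.
apply: conn_trans (conn_V3 _ _ _ _) (conn_trans H1 (conn_trans _ H2)).
apply: (@conn_trans _ (V2, da1, db1, (base bs1).+1, y1)).
  by apply: (@conn1 _ _ MRight MStay) => //; rewrite {1}E rd_base inE.
by apply: conn_V2; rewrite -addn1; apply: (clear_block E); rewrite size_enc.
Qed.

Definition in_range (c : vstate * nat * nat) :=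
  (c.1.2 <= (size u).+1) && (c.2 <= (size u).+1).

Lemma vrel_in_range c c' : vrel u c c' -> in_range c -> in_range c'.
Proof.
case: c => [[st x] y] /hasP[o Ho /eqP ->] /andP[/= xu yu].
have /andP[] := vopt_can_move Ho; rewrite /in_range /=.
by case: o.1.2 => /=; case: o.2 => /=; lia.
Qed.

(* A shortest accepting walk visits no configuration twice. *)
Lemma verify_complete da db x y : x <= (size u).+1 -> y <= (size u).+1 ->
  exists p, [/\ path (vrel u) (V1, da, db, x, y) p,
    (last (V1, da, db, x, y) p).1.1.1.1 = VD & size p <= 32 * (size u).+2 ^ 2].
Proof.
move=> xu yu; set c0 := (V1, da, db, x, y).
have [da' [db' [x' [y' H]]]] := @conn_outer [::] bs da db y erefl.
have [p pp lp] := conn_trans (conn_V1 da db x y) H.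
case/shortenP: pp lp => q pq uq _ lq; exists q; rewrite lq; split=> //.
pose pt (c : vstate * 'I_(size u).+2 * 'I_(size u).+2) := (c.1.1, val c.1.2, val c.2).
have sub c1 : in_range c1 -> path (vrel u) c1 q -> {subset q <= codom pt}.
  elim: (q) c1 => //= c s IH c1 rng /andP[st ps] d; rewrite inE.
  have rc := vrel_in_range st rng.
  case/orP => [/eqP ->|ds]; last exact: IH rc ps _ ds.
  case: c rc {st ps} => [[st x1] y1] /andP[/= x1u y1u].
  by apply/codomP; exists (st, Ordinal (x1u : x1 < (size u).+2), Ordinal (y1u : y1 < (size u).+2)).
have rng : in_range c0 by rewrite /in_range /= xu yu.
have uq' : uniq q by case/andP: uq.
have := uniq_leq_size uq' (sub _ rng pq); rewrite size_codom !card_prod !card_ord card_bool.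
(* 8 phases and two direction bits give the factor 32; the two head positions give the square. *)
have : #|{: vphase}| <= 8 by rewrite -[8]card_ord; apply: leq_card (can_inj vphase_codeK).
move: #|_| => k k8 /leq_trans; apply; rewrite -mulnn -!mulnA !mulnA.
by rewrite !leq_mul2r -!mulnA (leq_mul k8 (leqnn (2 * 2))) !orbT.
Qed.

End Verify.

Import Order.TTheory GRing.Theory Num.Theory.

(** * The guessing machine *)

(** A [Fresh] phase stands on a cell just entered whose content is undecided, a [Zero] phase on one
    treated as zero; the suffix [C] means inside a guessed cycle. The delay allows the same cell to
    be declared the mark instead. *)
Inductive sphase := PStart | PEnter | PFresh | PZero | PFreshC | PZeroC | PMark | PDone.

Definition sphase_code (v : sphase) : nat :=
  match v with PStart => 0 | PEnter => 1 | PFresh => 2 | PZero => 3 | PFreshC => 4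
  | PZeroC => 5 | PMark => 6 | PDone => 7 end.

Lemma sphase_codeK : cancel (fun s => inord (sphase_code s) : 'I_8)
  (fun i => nth PDone [:: PStart; PEnter; PFresh; PZero; PFreshC; PZeroC; PMark; PDone] i).
Proof. by case; rewrite /= inordK. Qed.

Module SphaseFinite.
HB.instance Definition _ := Equality.copy sphase (can_type sphase_codeK).
HB.instance Definition _ := Choice.copy sphase (can_type sphase_codeK).
HB.instance Definition _ := Countable.copy sphase (can_type sphase_codeK).
HB.instance Definition _ := Finite.copy sphase (can_type sphase_codeK).
End SphaseFinite.
Export SphaseFinite.

Section Guess.
Variables (Sigma : finType) (h : nat) (A : automaton Sigma h) (k : nat).
Local Notation Q := (aut_state A).
Local Notation Delta := (aut_mem A).
Local Notation gap := 'I_k.+1.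

Definition sstate := (sphase * gap * Q * Q * {ffun gap -> Delta})%type.
Definition xstate := (sstate + gap * vstate)%type.
(** Each gap has two tapes with the same log, one for each head of the comparison. The tapes of the
    input heads carry a flag bit in each cell, which remembers the head positions at the start of a
    cycle. *)
Definition gtape := ('I_h + gap * bool)%type.
Definition gsym := option (option (option Sigma) * bool + lsym).

Definition sym_code (s : insym Sigma) : option (option Sigma) :=
  match s with LEnd => None | REnd => Some None | Letter a => Some (Some a) end.
Definition sym_decode (c : option (option Sigma)) : insym Sigma :=
  match c with None => LEnd | Some None => REnd | Some (Some a) => Letter a end.

Lemma sym_codeK : cancel sym_code sym_decode.
Proof. by case. Qed.

Definition gsym_in (s : insym Sigma) : gsym := Some (inl (sym_code s, false)).

Lemma gsym_in_inj : injective gsym_in.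
Proof. by move=> s s' [/(can_inj sym_codeK)]. Qed.

Lemma gsym_in_blank s : gsym_in s != None.
Proof. by []. Qed.

Definition view_sym (s : gsym) : insym Sigma := if s is Some (inl (c, _)) then sym_decode c else REnd.
Definition view_flag (s : gsym) : bool := if s is Some (inl (_, f)) then f else false.
Definition view_log (s : gsym) : option lsym := if s is Some (inr a) then Some a else None.

Inductive hact := HNone | HMove of {ffun 'I_h -> move} | HFlag | HUnflag.
Definition lact := option (gap * lsym).

Definition auto_step (q : Q) (s : {ffun 'I_h -> insym Sigma}) (a : Delta)
    (f : Q -> {ffun 'I_h -> move} -> memop -> seq (sstate * hact * lact)) :=
  let: (q', d, op) := aut_trans q s a in f q' d op.

(** The mark symbols [g] are guessed once, because a mark may be read again after a minus move;
    every crossing appends one block to the log of its gap. Gap [k] has no mark behind it, so only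
    rays are logged there. A cycle may close when the state [q0] and all flagged positions recur. *)
Definition sopt (st : sstate) (s : {ffun 'I_h -> insym Sigma}) (flagged : bool) :
    seq (sstate * hact * lact) :=
  let: (ph, i, q, q0, g) := st in
  match ph with
  | PStart => [seq (PEnter, ord0, aut_init A, q0, g', HNone, None) | g' <- enum {: {ffun gap -> Delta}}]
  | PEnter => [:: (PFresh, i, q, q0, g, HNone, Some (i, SBegin))]
  | PFresh => (PZero, i, q, q0, g, HNone, Some (i, SZero)) ::
      (if i < k then [:: (PMark, i, q, q0, g, HNone, Some (i, SExact));
                         (PZeroC, i, q, q, g, HFlag, Some (i, SLeft))] else [::])
  | PZero => (if q \in aut_acc A then [:: (PDone, i, q, q0, g, HNone, Some (i, SGe))] else [::]) ++
      auto_step q s (aut_zero A) (fun q' d op =>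
        match op with
        | MemStay => [:: (PZero, i, q', q0, g, HMove d, None)]
        | MemPlus => [:: (PFresh, i, q', q0, g, HMove d, None)]
        | MemMinus => [:: (PEnter, ord0, q', q0, g, HMove d, Some (i, SGe))]
        end)
  | PZeroC => auto_step q s (aut_zero A) (fun q' d op =>
        match op with
        | MemStay => [:: (PZeroC, i, q', q0, g, HMove d, None)]
        | MemPlus => [:: (PFreshC, i, q', q0, g, HMove d, None)]
        | MemMinus => [::]
        end)
  | PFreshC => (PZeroC, i, q, q0, g, HNone, Some (i, SZero)) ::
      (if flagged && (q == q0) then [:: (PMark, i, q, q0, g, HUnflag, Some (i, SRight))] else [::])
  | PMark => (if q \in aut_acc A then [:: (PDone, i, q, q0, g, HNone, None)] else [::]) ++
      auto_step q s (g i) (fun q' d op =>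
        match op with
        | MemStay => [:: (PMark, i, q', q0, g, HMove d, None)]
        | MemPlus => [:: (PEnter, inord i.+1, q', q0, g, HMove d, None)]
        | MemMinus => [:: (PEnter, ord0, q', q0, g, HMove d, None)]
        end)
  | PDone => [::]
  end.

Definition clip (s : insym Sigma) (d : move) : move :=
  match d, s with MLeft, LEnd => MStay | MRight, REnd => MStay | _, _ => d end.

Definition put_flag (f : bool) (s : gsym) : gsym :=
  if s is Some (inl (c, _)) then Some (inl (c, f)) else s.

Definition act_write (ha : hact) (la : lact) (j : gtape) (s : gsym) : gsym :=
  match j with
  | inl _ => match ha with HFlag => put_flag true s | HUnflag => put_flag false s | _ => s end
  | inr (i, _) => if la is Some (i', a) then if i == i' then Some (inr a) else s else s
  end.

Definition act_move (ha : hact) (la : lact) (j : gtape) (s : gsym) : move :=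
  match j with
  | inl r => if ha is HMove d then clip (view_sym s) (d r) else MStay
  | inr (i, _) => if la is Some (i', _) then if i == i' then MRight else MStay else MStay
  end.

Definition ver_move (i : gap) (ma mb : move) (j : gtape) : move :=
  if j is inr (i', b) then if i' == i then if b then mb else ma else MStay else MStay.

Definition verify_start : xstate := inr (ord0, (V1, true, true)).

Definition gtrans (st : xstate) (s : {ffun gtape -> gsym}) (st' : xstate)
    (s' : {ffun gtape -> gsym}) (d : {ffun gtape -> move}) : bool :=
  match st with
  | inl ss =>
      if ss.1.1.1.1 == PDone then
        [&& st' == verify_start,
            s' == [ffun j => if j is inr _ then Some (inr SStop) else s j]
          & d == [ffun => MStay]]
      else has (fun o => [&& st' == inl o.1.1,
                   s' == [ffun j => act_write o.1.2 o.2 j (s j)]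
                 & d == [ffun j => act_move o.1.2 o.2 j (s j)]])
             (sopt ss [ffun r => view_sym (s (inl r))] [forall r, view_flag (s (inl r))])
  | inr (i, vs) =>
      (s' == s) &&
      if vs.1.1 == VD then
        [&& i < k, st' == inr (inord i.+1, (V1, true, true)) & d == [ffun => MStay]]
      else has (fun o => (st' == inr (i, o.1.1)) && (d == [ffun j => ver_move i o.1.2 o.2 j]))
             (vopt vs (view_log (s (inr (i, false)))) (view_log (s (inr (i, true)))))
  end.

Variables (q_any : Q).

Definition guesser : tape_machine Sigma :=
  @TapeMachine Sigma gtape xstate gsym None gsym_in gsym_in_inj gsym_in_blank gtrans
    (inl (PStart, ord0, q_any, q_any, [ffun => aut_zero A]))
    (fun st => if st is inr (i, vs) then (i == ord_max) && (vs.1.1 == VD) else false).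

Variable w : seq Sigma.
Local Notation n := (size w).
Local Notation heads := {ffun 'I_h -> 'I_n.+2}.

Record sconf := SConf {
  sc_st : sstate;
  sc_hd : heads;
  sc_fl : option heads;
  sc_lg : gap -> seq lsym
}.

Definition sc_flag (a : sconf) (r : 'I_h) (p : nat) :=
  if sc_fl a is Some f then f r == p :> nat else false.

Definition hd_syms (hd : heads) : {ffun 'I_h -> insym Sigma} := [ffun r => insym_at w (hd r)].

Definition hd_move (hd : heads) (d : {ffun 'I_h -> move}) : heads :=
  [ffun r => inord (head_move n (d r) (hd r))].

Definition sc_opts (a : sconf) :=
  sopt (sc_st a) (hd_syms (sc_hd a)) [forall r, sc_flag a r (sc_hd a r)].

Definition sc_apply (a : sconf) (o : sstate * hact * lact) : sconf :=
  SConf o.1.1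
    (if o.1.2 is HMove d then hd_move (sc_hd a) d else sc_hd a)
    (match o.1.2 with HFlag => Some (sc_hd a) | HUnflag => None | _ => sc_fl a end)
    (fun i => if o.2 is Some (i', s) then if i == i' then rcons (sc_lg a i) s else sc_lg a i
              else sc_lg a i).

Definition sopt0 : sstate * hact * lact :=
  (PDone, ord0, q_any, q_any, [ffun => aut_zero A], HNone, None).

Definition sstep (a a' : sconf) : Prop :=
  exists2 j, j < size (sc_opts a) & a' = sc_apply a (nth sopt0 (sc_opts a) j).

Definition log_rep (c : xconfig guesser) (lg : gap -> seq lsym) :=
  forall i b, view_log (xc_tape c (inr (i, b)) (-1)%R) = None /\
    forall j, j < size (lg i) -> xc_tape c (inr (i, b)) (Posz j) = Some (inr (nth SStop (lg i) j)).

Definition rep_sim (c : xconfig guesser) (a : sconf) :=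
  [/\ xc_state c = inl (sc_st a),
      forall r, xc_head c (inl r) = ((sc_hd a r)%:Z - 1)%R,
      forall r (p : nat), p <= n.+1 -> xc_tape c (inl r) (p%:Z - 1)%R =
         Some (inl (sym_code (insym_at w p), sc_flag a r p)),
      log_rep c (sc_lg a)
    & forall i b, xc_head c (inr (i, b)) = (Posz (size (sc_lg a i)))].

Lemma hd_moveE (hd : heads) d r : hd_move hd d r = head_move n (d r) (hd r) :> nat.
Proof.
by rewrite ffunE inordK //; have := ltn_ord (hd r); case: (d r) => /=; lia.
Qed.

Lemma rep_views c a : rep_sim c a ->
  let s := [ffun j => xc_tape c j (xc_head c j)] : {ffun gtape -> gsym} in
  [ffun r => view_sym (s (inl r))] = hd_syms (sc_hd a) /\
  [forall r, view_flag (s (inl r))] = [forall r, sc_flag a r (sc_hd a r)].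
Proof.
case=> _ Eh Et _ _ s; have Es r : s (inl r) =
    Some (inl (sym_code (insym_at w (sc_hd a r)), sc_flag a r (sc_hd a r))).
  by rewrite ffunE Eh Et // -ltnS.
split; first by apply/ffunP => r; rewrite [LHS]ffunE Es [RHS]ffunE /= sym_codeK.
by apply: eq_forallb => r; rewrite Es.
Qed.

Lemma clip_move (p : nat) d : p <= n.+1 ->
  move_int (clip (insym_at w p) d) (p%:Z - 1)%R = ((head_move n d p)%:Z - 1)%R.
Proof.
move=> pn; have := insym_at_left w p; have := insym_at_right pn.
by case: d; case: (insym_at w p) => [||a] /=; lia.
Qed.

Lemma rep_apply c a (c' : xconfig guesser) (o : sstate * hact * lact) : rep_sim c a -> xc_state c' = inl o.1.1 ->
    (forall j, xc_head c' j = move_int (act_move o.1.2 o.2 j (xc_tape c j (xc_head c j))) (xc_head c j)) ->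
    (forall j z, xc_tape c' j z = if z == xc_head c j
       then act_write o.1.2 o.2 j (xc_tape c j (xc_head c j)) else xc_tape c j z) ->
    (o.1.2 = HUnflag -> [forall r, sc_flag a r (sc_hd a r)]) ->
    (o.1.2 = HFlag -> sc_fl a = None) ->
  rep_sim c' (sc_apply a o).
Proof.
have hle r : sc_hd a r <= n.+1 by rewrite -ltnS.
case=> Es Eh Et El Ep Es' Eh' Et' Hu Hf; split=> //.
- move=> r; rewrite Eh' /= Eh Et //; case: o.1.2 => // d /=.
  by rewrite sym_codeK clip_move // hd_moveE.
- move=> r p pn; rewrite Et' Eh.
  have -> : (p%:Z - 1 == (sc_hd a r)%:Z - 1)%R = (sc_hd a r == p :> nat).
    by apply/eqP/eqP; lia.
  rewrite Et // Et // /act_write /sc_flag /=.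
  case Eo: o.1.2 Hu Hf => [|d||] Hu Hf; rewrite /= ?(Hf erefl).
  + by case: eqP => // <-.
  + by case: eqP => // <-.
  + by case: eqP => // <-.
  move/forallP/(_ r): (Hu erefl); rewrite /sc_flag; case: (sc_fl a) => // f /eqP ->.
  by case: eqP => // <-.
- move=> i b; have [E1 E2] := El i b; rewrite !Et' Ep; split.
    by case: eqP => // ?; lia.
  move=> j; rewrite /= Et' Ep; case: o.2 => [[i' s]|]; last first.
    by move=> js; case: eqP => [?|_]; [lia | rewrite E2].
  case: (i =P i') => [->|_]; last by move=> js; case: eqP => [?|_]; [lia | rewrite E2].
  rewrite size_rcons ltnS nth_rcons => js.
  case: (ltngtP j (size (sc_lg a i'))) js => // lt _.
    by case: eqP => [?|_]; [lia | have [_ ->] := El i' b].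
  by rewrite lt /= !eqxx.
- move=> i b; rewrite Eh' Ep /=; case: o.2 => [[i' s]|] //.
  by case: eqP => [->|//]; rewrite size_rcons /=; lia.
Qed.

Lemma has_nth T (a : pred T) x0 s : has a s <-> exists2 j, j < size s & a (nth x0 s j).
Proof. by split=> [/(has_nthP x0)|] // H; apply/(has_nthP x0). Qed.

(** The machine writes only under its heads, so new flags presuppose that no stale ones exist.
    Removal is complete because it happens when all heads stand on their flags. *)
Definition flags_ok (a : sconf) :=
  match (sc_st a).1.1.1.1 with
  | PFreshC | PZeroC => true
  | _ => sc_fl a == None
  end.

Lemma sopt_flags st s f j : j < size (sopt st s f) ->
  let o := nth sopt0 (sopt st s f) j in
  [/\ o.1.2 = HUnflag -> f, o.1.2 = HFlag -> st.1.1.1.1 = PFresh &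
      match o.1.1.1.1.1.1 with
      | PFreshC | PZeroC => o.1.2 = HFlag \/ (st.1.1.1.1 = PFreshC \/ st.1.1.1.1 = PZeroC)
      | _ => o.1.2 = HUnflag \/ ((st.1.1.1.1 <> PFreshC /\ st.1.1.1.1 <> PZeroC) /\ o.1.2 <> HFlag)
      end].
Proof.
case: st => [[[[ph i] q] q0] g]; case: ph; rewrite /= /auto_step.
- rewrite size_map => js; rewrite (nth_map [ffun => aut_zero A]) //=; split=> //.
  by right.
- by case: j => //= _; split=> //; right.
- case: ifP => _; case: j => [|[|[|j]]] //= _; split=> //; try (by right); by left.
- by case: (q \in _); case: aut_trans => [[q' d] []]; case: j => [|[|j]] //= _; split=> //; right.
- by case: ifP => [/andP[-> _]|_]; case: j => [|[|j]] //= _; split=> //; auto.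
- by case: aut_trans => [[q' d] []]; case: j => [|j] //= _; split=> //; auto.
- by case: (q \in _); case: aut_trans => [[q' d] []]; case: j => [|[|j]] //= _; split=> //; right.
- by [].
Qed.

Lemma flags_ok_step a a' : flags_ok a -> sstep a a' -> flags_ok a'.
Proof.
move=> ok [j js ->]; have [H1 H2 H3] := sopt_flags js; move: H3.
rewrite /flags_ok /sc_apply /=; set o := nth _ _ _.
case: o.1.1.1.1.1.1 => //; case: o.1.2 => //= [|d|]; move=> [//|[[n1 n2]]]; try (by case);
  move=> _; move: ok; rewrite /flags_ok; by case: (sc_st a).1.1.1.1 n1 n2.
Qed.

Lemma sim_forward c a a' : rep_sim c a -> flags_ok a -> sstep a a' ->
  exists2 c', xm_step c c' & rep_sim c' a'.
Proof.
move=> R ok [j js ->]; have [V1' V2'] := rep_views R; set o := nth _ _ _.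
have [H1 H2 _] := sopt_flags js.
pose s := [ffun j => xc_tape c j (xc_head c j)] : {ffun gtape -> gsym}.
pose c' := @XConfig _ guesser (inl o.1.1 : xstate)
  (fun j => move_int (act_move o.1.2 o.2 j (s j)) (xc_head c j))
  (fun j z => if z == xc_head c j then act_write o.1.2 o.2 j (s j) else xc_tape c j z).
have R' : rep_sim c' (sc_apply a o).
  apply: (@rep_apply c a c' o R erefl).
  - by move=> i; rewrite /= ffunE.
  - by move=> i z; rewrite /= ffunE.
  - exact: H1.
  - by move=> /H2 E; move: ok; rewrite /flags_ok E => /eqP.
exists c' => //.
exists (inl o.1.1 : xstate), [ffun j => act_write o.1.2 o.2 j (s j)],
  [ffun j => act_move o.1.2 o.2 j (s j)].
split; [| by [] | by move=> i; rewrite [in RHS]ffunE | by move=> i z; rewrite [in RHS]ffunE].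
case: R => -> _ _ _ _ /=; rewrite ifN; last first.
  by move: js; rewrite /sc_opts; case: (sc_st a) => [[[[ph i] q] q0] g]; apply: contraTneq => /= ->.
rewrite V1' V2'; apply/(has_nth _ sopt0); exists j => //.
by rewrite -/o !eqxx.
Qed.

Lemma sim_backward c a c' : rep_sim c a -> flags_ok a -> (sc_st a).1.1.1.1 <> PDone ->
  xm_step c c' -> exists2 a', sstep a a' & rep_sim c' a'.
Proof.
move=> R ok nd [st' [s' [d [Ht Es Eh Et]]]]; have [V1' V2'] := rep_views R.
move: Ht; case: (R) => -> _ _ _ _ /=; rewrite ifN; last exact/eqP.
rewrite V1' V2' => /(has_nth _ sopt0)[j js /and3P[/eqP E1 /eqP E2 /eqP E3]].
have [H1 H2 _] := sopt_flags js.
exists (sc_apply a (nth sopt0 (sc_opts a) j)); first by exists j.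
apply: (@rep_apply c a c' _ R).
- by rewrite Es E1.
- by move=> i; rewrite Eh E3 !ffunE.
- by move=> i z; rewrite Et E2 !ffunE.
- exact: H1.
- by move=> /H2 E; move: ok; rewrite /flags_ok E => /eqP.
Qed.

Definition rep_ver (c : xconfig guesser) (lg : gap -> seq lsym) (i : gap)
    (v : vstate * nat * nat) :=
  [/\ xc_state c = inr (i, v.1.1), log_rep c lg,
      forall i b, xc_tape c (inr (i, b)) (Posz (size (lg i))) = Some (inr SStop),
      [/\ v.1.2 <= (size (lg i)).+1, v.2 <= (size (lg i)).+1,
        xc_head c (inr (i, false)) = (v.1.2%:Z - 1)%R & xc_head c (inr (i, true)) = (v.2%:Z - 1)%R]
    & forall (i' : gap) b, i < i' -> xc_head c (inr (i', b)) = (Posz (size (lg i')))].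

Lemma rep_rd c lg i v (b : bool) x : rep_ver c lg i v -> x <= (size (lg i)).+1 ->
  view_log (xc_tape c (inr (i, b)) (x%:Z - 1)%R) = rd (lg i) x.
Proof.
case=> _ El Ee _ _ xs; have [E1 E2] := El i b; case: x xs => [|x] xs; first by rewrite sub0r E1.
have -> : (x.+1%:Z - 1 = x%:Z)%R by lia.
move: xs; rewrite ltnS leq_eqVlt => /orP[/eqP ->|xs]; first by rewrite Ee rd_stop.
by rewrite E2 // /rd /= (nth_map SStop).
Qed.

Lemma done_step c a c' : rep_sim c a -> (sc_st a).1.1.1.1 = PDone -> xm_step c c' ->
  rep_ver c' (sc_lg a) ord0 (V1, true, true, (size (sc_lg a ord0)).+1, (size (sc_lg a ord0)).+1).
Proof.
case=> Es Eh Et El Ep Ed [st' [s' [d [+ Es' Eh' Et']]]]; rewrite Es /= Ed eqxx.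
case/and3P=> /eqP E1 /eqP E2 /eqP E3.
have Hh i b : xc_head c' (inr (i, b)) = (Posz (size (sc_lg a i))) by rewrite Eh' E3 ffunE Ep.
split=> //=.
- by rewrite Es' E1.
- move=> i b; have [F1 F2] := El i b; rewrite !Et' Ep; split; first by case: eqP => // ?; lia.
  by move=> j js; rewrite Et' Ep; case: eqP => [?|_]; [lia | exact: F2].
- by move=> i b; rewrite Et' Ep eqxx E2 ffunE.
by split=> //; rewrite Hh; lia.
Qed.

Lemma done_forward c a : rep_sim c a -> (sc_st a).1.1.1.1 = PDone -> exists c', xm_step c c'.
Proof.
move=> R Ed; pose s := [ffun j => xc_tape c j (xc_head c j)] : {ffun gtape -> gsym}.
pose s' : {ffun gtape -> gsym} := [ffun j => if j is inr _ then Some (inr SStop) else s j].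
exists (@XConfig _ guesser verify_start (xc_head c)
  (fun j z => if z == xc_head c j then s' j else xc_tape c j z)).
exists verify_start, s', [ffun => MStay]; split=> // [|j]; last by rewrite ffunE.
by case: R => -> _ _ _ _ /=; rewrite Ed !eqxx.
Qed.

Lemma ver_step c lg i v c' : rep_ver c lg i v -> v.1.1.1.1 <> VD -> xm_step c c' ->
  exists2 v', vrel (lg i) v v' & rep_ver c' lg i v'.
Proof.
move=> R nd [st' [s' [d [+ Es' Eh' Et']]]]; case: (R) => Es El Ee [x1 x2 Ea Eb] Eh.
rewrite Es /= (negbTE (introN eqP nd)) !ffunE Ea Eb !(rep_rd _ R) //.
case/andP=> /eqP E2 /hasP[o Ho /andP[/eqP E1 /eqP E3]].
have /andP[m1 m2] := vopt_can_move Ho.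
exists (o.1.1, mv o.1.2 v.1.2, mv o.2 v.2).
  by apply/hasP; exists o.
have Tt j z : xc_tape c' j z = xc_tape c j z.
  by rewrite Et' E2 ffunE; case: eqP => // ->.
split=> /=.
- by rewrite Es' E1.
- by move=> i' b; have [F1 F2] := El i' b; rewrite Tt; split=> // j js; rewrite Tt F2.
- by move=> i' b; rewrite Tt.
- rewrite !Eh' E3 !ffunE /= !eqxx Ea Eb; move: m1 m2.
  by case: o.1.2 => /=; case: o.2 => /=; split; lia.
move=> i' b ii'; rewrite Eh' E3 ffunE /= ifN ?Eh //.
by apply: contraTneq ii' => ->; rewrite ltnn.
Qed.

Lemma ver_forward c lg i v v' : rep_ver c lg i v -> vrel (lg i) v v' ->
  exists2 c', xm_step c c' & rep_ver c' lg i v'.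
Proof.
move=> R /hasP[o Ho /eqP Ev']; have /andP[m1 m2] := vopt_can_move Ho.
case: (R) => Es El Ee [x1 x2 Ea Eb] Eh.
have nd : v.1.1.1.1 <> VD by move: Ho; case: (v.1.1) => [[ph da] db] /=; case: ph.
pose d : {ffun gtape -> move} := [ffun j => ver_move i o.1.2 o.2 j].
pose s := [ffun j => xc_tape c j (xc_head c j)] : {ffun gtape -> gsym}.
exists (@XConfig _ guesser (inr (i, o.1.1) : xstate) (fun j => move_int (d j) (xc_head c j)) (xc_tape c)).
  exists (inr (i, o.1.1) : xstate), s, d; split=> // [|j z]; last by rewrite /= ffunE; case: eqP => // ->.
  rewrite Es /= (negbTE (introN eqP nd)) !ffunE Ea Eb !(rep_rd _ R) // eqxx.
  by apply/hasP; exists o; rewrite ?eqxx.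
rewrite Ev'; split=> //=.
- rewrite !ffunE /= !eqxx Ea Eb; move: m1 m2.
  by case: o.1.2 => /=; case: o.2 => /=; split; lia.
move=> i' b ii'; rewrite ffunE /= ifN ?Eh //.
by apply: contraTneq ii' => ->; rewrite ltnn.
Qed.

Definition next_gap (lg : gap -> seq lsym) (i : gap) : gap * (vstate * nat * nat) :=
  let i' := inord i.+1 in (i', (V1, true, true, (size (lg i')).+1, (size (lg i')).+1)).

Lemma ver_next c lg i v c' : rep_ver c lg i v -> v.1.1.1.1 = VD -> xm_step c c' ->
  i < k /\ rep_ver c' lg (next_gap lg i).1 (next_gap lg i).2.
Proof.
move=> R Ed [st' [s' [d [+ Es' Eh' Et']]]]; case: (R) => Es El Ee _ Eh.
rewrite Es /= Ed eqxx => /and4P[/eqP E2 ik /eqP E1 /eqP E3]; split=> //.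
have Tt j z : xc_tape c' j z = xc_tape c j z.
  by rewrite Et' E2 ffunE; case: eqP => // ->.
have Ei : (inord i.+1 : gap) = i.+1 :> nat by rewrite inordK.
have Hh (i' : gap) b : i < i' -> xc_head c' (inr (i', b)) = (Posz (size (lg i'))).
  by move=> ii'; rewrite Eh' E3 ffunE /= Eh.
split=> /=.
- by rewrite Es' E1.
- by move=> i' b; have [F1 F2] := El i' b; rewrite Tt; split=> // j js; rewrite Tt F2.
- by move=> i' b; rewrite Tt.
- by rewrite !Hh ?Ei //; split; lia.
by move=> i' b; rewrite Ei => ii'; rewrite Hh //; lia.
Qed.

Lemma ver_next_forward c lg i v : rep_ver c lg i v -> v.1.1.1.1 = VD -> i < k ->
  exists c', xm_step c c'.
Proof.
move=> R Ed ik; case: R => Es _ _ _ _.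
pose s := [ffun j => xc_tape c j (xc_head c j)] : {ffun gtape -> gsym}.
exists (@XConfig _ guesser (inr (inord i.+1, (V1, true, true)) : xstate) (xc_head c) (xc_tape c)).
exists (inr (inord i.+1, (V1, true, true)) : xstate), s, [ffun => MStay].
split=> // [|j|j z]; rewrite ?ffunE //=; last by case: eqP => // ->.
by rewrite Es /= Ed !eqxx ik.
Qed.

Definition sc_start : sconf :=
  SConf (PStart, ord0, q_any, q_any, [ffun => aut_zero A]) [ffun => inord 1] None (fun=> [::]).

Lemma rep_start : rep_sim (xm_start guesser w) sc_start.
Proof.
have E p : p <= n.+1 -> xinput guesser w (p%:Z - 1)%R = gsym_in (insym_at w p) := @xinput_pos _ guesser w p.
split.
- by [].
- by move=> r; rewrite /= ffunE inordK.
- by move=> r p pn; exact: E.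
- by move=> i b; split=> //; have := E 0 isT; rewrite sub0r => /= ->.
- by [].
Qed.

End Guess.

(** * Runs of the automaton on a sparse memory *)

Section Semantics.
Variables (Sigma : finType) (h : nat) (A : automaton Sigma h) (k : nat) (w : seq Sigma).
Local Notation Q := (aut_state A).
Local Notation Delta := (aut_mem A).
Local Notation gap := 'I_k.+1.
Local Notation n := (size w).
Local Notation heads := {ffun 'I_h -> 'I_n.+2}.
Local Notation conf := (Q * heads)%type.

Definition mem_step (a : Delta) (c : conf) : conf * memop :=
  let: (q, d, op) := aut_trans c.1 (hd_syms c.2) a in ((q, hd_move c.2 d), op).

Definition cell_step (mu : nat -> Delta) (y : conf * nat) : conf * nat :=
  let: (c, op) := mem_step (mu y.2) y.1 in (c, w15_move op y.2).

Definition conf0 : conf := (aut_init A, [ffun => inord 1]).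

Lemma cell_step_sim mu t :
  let c := iter t (@aut_step _ _ A w mu) (aut_start A) in
  let y := iter t (cell_step mu) (conf0, 0) in
  [/\ ac_state c = y.1.1, forall i, ac_head c i = y.1.2 i & ac_cell c = y.2].
Proof.
elim: t => [|t [Es Eh Ec]] /=; first by split=> // i; rewrite ffunE inordK.
rewrite /aut_step /cell_step /mem_step Es Ec.
have -> : [ffun i => insym_at w (ac_head (iter t (aut_step w mu) (aut_start A)) i)] =
    hd_syms (iter t (cell_step mu) (conf0, 0)).1.2.
  by apply/ffunP => i; rewrite !ffunE Eh.
case: (aut_trans _ _ _) => [[q d] op] /=; split=> // i.
by rewrite hd_moveE Eh.
Qed.

Lemma aut_acceptsE mu : aut_accepts w mu <->
  exists t, (iter t (cell_step mu) (conf0, 0)).1.1 \in aut_acc A.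
Proof.
by split=> -[t Ht]; exists t; have [E _ _] := cell_step_sim mu t; rewrite ?E // -?E.
Qed.

Definition goes mu (y y' : conf * nat) := exists t, iter t (cell_step mu) y = y'.

Lemma goes_refl mu y : goes mu y y. Proof. by exists 0. Qed.

Lemma goes_trans mu y1 y2 y3 : goes mu y1 y2 -> goes mu y2 y3 -> goes mu y1 y3.
Proof. by case=> t <- [t' <-]; exists (t' + t); rewrite iterD. Qed.

Lemma goes_step mu c x c' op : mem_step (mu x) c = (c', op) ->
  goes mu (c, x) (c', w15_move op x).
Proof. by move=> E; exists 1; rewrite /= /cell_step /= E. Qed.

Fixpoint gap_base (L : nat -> nat) (i : nat) : nat :=
  if i is j.+1 then (gap_base L j + L j).+1 else 0.

Definition mem_of (L : nat -> nat) (g : {ffun gap -> Delta}) (x : nat) : Delta :=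
  if [pick i : gap | (i < k) && (x == gap_base L i + L i)] is Some i then g i
  else aut_zero A.

Lemma gap_base_lt (L : nat -> nat) i j : i < j -> gap_base L i + L i < gap_base L j.
Proof.
elim: j => // j IH; rewrite ltnS leq_eqVlt => /orP[/eqP ->|/IH] /=; lia.
Qed.

Lemma mem_of_zero (L : nat -> nat) g (i : gap) o : (i < k -> o < L i) ->
  mem_of L g (gap_base L i + o) = aut_zero A.
Proof.
move=> H; rewrite /mem_of; case: pickP => // j /andP[jk /eqP E].
have [ji|ij|ji] := ltngtP j i.
- by have := gap_base_lt L ji; lia.
- have := gap_base_lt L ij; have := H (ltn_trans ij jk); lia.
by have := H; rewrite -ji => /(_ jk); move: E; rewrite ji; lia.
Qed.

Lemma mem_of_mark (L : nat -> nat) g (i : gap) : i < k -> mem_of L g (gap_base L i + L i) = g i.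
Proof.
move=> ik; rewrite /mem_of; case: pickP => [j /andP[jk /eqP E]|/(_ i)]; last by rewrite ik eqxx.
have [ji|ij|ji] := ltngtP j i; last by congr (g _); apply/val_inj.
- by have := gap_base_lt L ji; lia.
- by have := gap_base_lt L ij; lia.
Qed.

Lemma mem_of_sparse (L : nat -> nat) g : sparse k (aut_zero A) (mem_of L g).
Proof.
exists [seq gap_base L i + L i | i <- iota 0 k]; split; first by rewrite size_map size_iota.
move=> x; rewrite /mem_of; case: pickP => [i /andP[ik /eqP ->] _|]; last by rewrite eqxx.
by apply/mapP; exists (val i) => //; rewrite mem_iota.
Qed.

Definition fits (L : nat -> nat) (B : gap -> seq block) :=
  forall i : gap, i < k -> all (in_block (L i)) (B i).

Definition cur_log (ph : sphase) (o m : nat) : seq lsym :=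
  match ph with
  | PFresh => SBegin :: nseq o SZero
  | PZero => SBegin :: nseq o.+1 SZero
  | PFreshC | PZeroC => (SBegin :: nseq o SZero) ++ SLeft :: nseq m SZero
  | _ => [::]
  end.

(** Quantified over memory and starting cell, since a cycle observed once is to be repeated at other
    places of the gap. *)
Definition loops (c c' : conf) (m m' : nat) :=
  forall mu x, (forall y, y <= m -> mu (x + y) = aut_zero A) -> goes mu (c, x) (c', x + m').

Definition static_ok (st : sstate A k) (hd : heads) (fl : option heads) (m : nat) : Prop :=
  let: (ph, i, q, q0, g) := st in
  match ph with
  | PStart => hd = [ffun => inord 1]
  | PZeroC => i < k /\ exists2 f, fl = Some f & loops (q0, f) (q, hd) m m
  | PFreshC => i < k /\ exists2 f, fl = Some f & loops (q0, f) (q, hd) m m.+1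
  | PMark => i < k
  | PDone => q \in aut_acc A
  | _ => True
  end.

(** In the cyclic phases the claim concerns the configuration at the start of the cycle: the gap may
    end at offset [o] already, before the cycle is run even once. *)
Definition run_ok (st : sstate A k) (hd : heads) (fl : option heads) (L : nat -> nat)
    (o : nat) : Prop :=
  let: (ph, i, q, q0, g) := st in
  let run c x := goes (mem_of L g) (conf0, 0) (c, x) in
  match ph with
  | PStart => True
  | PEnter => run (q, hd) (gap_base L i)
  | PFresh => (i < k -> o <= L i) -> run (q, hd) (gap_base L i + o)
  | PZero => (i < k -> o < L i) -> run (q, hd) (gap_base L i + o)
  | PZeroC | PFreshC => o <= L i -> forall f, fl = Some f -> run (q0, f) (gap_base L i + o)
  | PMark => run (q, hd) (gap_base L i + L i)
  | PDone => exists x, run (q, hd) x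
  end.

(* Whatever gap lengths satisfy the constraints logged so far, the automaton
   reaches the simulated configuration on the corresponding memory. *)
Definition log_inv (a : sconf A k w) :=
  exists (B : gap -> seq block) (o m : nat),
    [/\ forall j, sc_lg a j = log_word (B j) ++
          (if j == (sc_st a).1.1.1.2 then cur_log (sc_st a).1.1.1.1 o m else [::]),
        static_ok (sc_st a) (sc_hd a) (sc_fl a) m
      & forall L, fits L B -> run_ok (sc_st a) (sc_hd a) (sc_fl a) L o].

Lemma log_word_rcons B b : log_word (rcons B b) = log_word B ++ enc b.
Proof. by rewrite -cats1 log_word_cat /log_word /= cats0. Qed.

Definition upd (B : gap -> seq block) i b := fun j => if j == i then rcons (B j) b else B j.

Lemma fits_upd L B i b : fits L (upd B i b) -> fits L B /\ (i < k -> in_block (L i) b).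
Proof.
move=> F; split=> [j jk|ik].
  by have := F j jk; rewrite /upd; case: ifP => // _; rewrite all_rcons => /andP[].
by have := F i ik; rewrite /upd eqxx all_rcons => /andP[].
Qed.

Section LogUpdates.
Variables (lg : gap -> seq lsym) (B : gap -> seq block) (i : gap) (s : seq lsym).
Hypothesis El : forall j, lg j = log_word (B j) ++ (if j == i then s else [::]).

Lemma log_write s0 s' : rcons s s0 = s' -> forall j,
  (if j == i then rcons (lg j) s0 else lg j) =
  log_word (B j) ++ (if j == i then s' else [::]).
Proof. by move=> <- j; rewrite El; case: (j == i) => //; rewrite rcons_cat. Qed.

Lemma log_close s0 b i2 : rcons s s0 = enc b -> forall j,
  (if j == i then rcons (lg j) s0 else lg j) =
  log_word (upd B i b j) ++ (if j == i2 then [::] else [::]).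
Proof.
move=> E j; rewrite El /upd if_same cats0; case: (j == i); last by rewrite cats0.
by rewrite rcons_cat E log_word_rcons.
Qed.

Lemma log_keep i2 : s = [::] -> forall j,
  lg j = log_word (B j) ++ (if j == i2 then [::] else [::]).
Proof. by move=> E j; rewrite El E !if_same. Qed.
End LogUpdates.

Lemma rcons_nseq T (x : T) o : rcons (nseq o x) x = nseq o.+1 x.
Proof. by elim: o => //= o ->. Qed.

Lemma enc_exact o m : rcons (cur_log PFresh o m) SExact = enc (BExact o).
Proof. by rewrite /enc /block_tail cats1. Qed.

Lemma enc_ge o m : rcons (cur_log PZero o m) SGe = enc (BGe o.+1).
Proof. by rewrite /enc /block_tail cats1. Qed.

Lemma enc_cyc o m : rcons (cur_log PFreshC o m) SRight = enc (BCyc o m).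
Proof. by rewrite /cur_log rcons_cat. Qed.

Lemma goes_loop mu c x m j :
  (forall i, i < j -> goes mu (c, x + i * m) (c, x + i.+1 * m)) ->
  goes mu (c, x) (c, x + j * m).
Proof.
elim: j => [|j IH] H; first by rewrite mul0n addn0; exact: goes_refl.
by apply: goes_trans (IH (fun i ij => H i (ltnW ij))) (H j (ltnSn j)).
Qed.

Lemma log_inv_step q_any (a a' : sconf A k w) : flags_ok a -> log_inv a ->
  sstep q_any a a' -> log_inv a'.
Proof.
case: a => [[[[[ph i] q] q0] g] hd fl lg] ok [B [o [m [El Hs Hr]]]] [j].
move: El Hs Hr; cbn [sc_st sc_hd sc_fl sc_lg fst snd] => El Hs Hr.
have stepE a0 q' d op : aut_trans q (hd_syms hd) a0 = (q', d, op) ->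
    mem_step a0 (q, hd) = ((q', hd_move hd d), op) by rewrite /mem_step /= => ->.
rewrite /sc_opts; cbn [sc_st sc_hd sc_fl sc_lg].
case: ph ok El Hs Hr => ok El Hs Hr; rewrite /sopt /auto_step; cbn iota beta.
- rewrite size_map => js ->; rewrite (nth_map [ffun => aut_zero A]) //.
  exists B, 0, 0; split=> //; first exact: log_keep El _ erefl.
  by move=> L _; rewrite /= Hs; exact: goes_refl.
- case: j => // _ ->; exists B, 0, 0; split=> //; first exact: log_write El _ _ erefl.
  by move=> L /Hr /= H _; rewrite addn0.
- case: j => [_ ->|j].
    exists B, o, 0; split=> //; first by apply: log_write El _ _ _; rewrite rcons_cons rcons_nseq.
    by move=> L /Hr /= H oL; apply: H => ik; apply/ltnW/oL.
  case: ifP => // ik; case: j => [_ ->|[_ ->|//]].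
    exists (upd B i (BExact o)), 0, 0; split=> //.
      exact: (log_close El i (enc_exact o m)).
    move=> L /fits_upd[/Hr /= H /(_ ik)/eqP E]; rewrite E; apply: H.
    by rewrite E.
  exists B, o, 0; split=> //; first by apply: log_write El _ _ _; rewrite -cats1.
    split=> //; exists hd => // mu x _; rewrite addn0; exact: goes_refl.
  by move=> L /Hr /= H oL f [<-]; apply: H.
(* The ray starts at [o.+1] because cell [o] itself has been treated as a zero. *)
- have accE L : fits L (upd B i (BGe o.+1)) ->
      goes (mem_of L g) (conf0, 0) ((q, hd), gap_base L i + o) /\ (i < k -> o < L i).
    by move=> /fits_upd[/Hr /= H1 H2]; split=> //; apply: H1.
  have closeE i2 : forall j, (if j == i then rcons (lg j) SGe else lg j) =
      log_word (upd B i (BGe o.+1) j) ++ (if j == i2 then [::] else [::]).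
    exact: (log_close El i2 (enc_ge o m)).
  have main : forall j0, j0 < size (let: (q', d, op) := aut_trans q (hd_syms hd) (aut_zero A) in
       match op with
        | MemStay => [:: (PZero, i, q', q0, g, HMove d, None)]
        | MemPlus => [:: (PFresh, i, q', q0, g, HMove d, None)]
        | MemMinus => [:: (PEnter, ord0, q', q0, g, HMove d, Some (i, SGe))]
        end) -> log_inv (sc_apply (SConf (PZero, i, q, q0, g) hd fl lg) (nth (@sopt0 _ _ A k q_any) 
        (let: (q', d, op) := aut_trans q (hd_syms hd) (aut_zero A) in
       match op with
        | MemStay => [:: (PZero, i, q', q0, g, HMove d, None)]
        | MemPlus => [:: (PFresh, i, q', q0, g, HMove d, None)]
        | MemMinus => [:: (PEnter, ord0, q', q0, g, HMove d, Some (i, SGe))]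
        end) j0)).
    move=> j0; case Et: (aut_trans _ _ _) => [[q' d] op]; have St := stepE _ _ _ _ Et.
    have go (L : nat -> nat) : (i < k -> o < L i) -> goes (mem_of L g) ((q, hd), gap_base L i + o)
        ((q', hd_move hd d), w15_move op (gap_base L i + o)).
      by move=> oL; apply: goes_step; rewrite mem_of_zero.
    case: op Et St go => Et St go; case: j0 => // _.
    + exists B, o.+1, 0; split=> // L /Hr /= H oL; rewrite addnS.
      by apply: goes_trans (go L oL); apply: H.
    + exists (upd B i (BGe o.+1)), 0, 0; split=> //; first exact: (closeE ord0).
      by move=> L /accE[H oL]; apply: goes_trans H (go L oL).
    + exists B, o, 0; split=> // L /Hr /= H oL.
      by apply: goes_trans (go L oL); apply: H.
  case: ifP => qacc; last by move=> js ->; apply: main.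
  case: j => [_ ->|j js ->]; last exact: (main j).
  exists (upd B i (BGe o.+1)), 0, 0; split=> //; first exact: (closeE i).
  by move=> L /accE[H _]; exists (gap_base L i + o).
- case: Hs => ik [f Ef Hl]; case: j => [_ ->|j].
    exists B, o, m.+1; split=> //.
      by apply: log_write El _ _ _; rewrite /cur_log rcons_cat rcons_cons rcons_nseq.
    split=> //; exists f => // mu x Hz; apply: Hl => y ym; apply: Hz; exact: leqW.
  case: ifP => // /andP[/forallP Hf /eqP Eq]; case: j => // _ ->.
  have Ehd : hd = f.
    by apply/ffunP => r; apply/val_inj; have := Hf r; rewrite /sc_flag /= Ef => /eqP.
  exists (upd B i (BCyc o m)), 0, 0; split=> //.
    exact: (log_close El i (enc_cyc o m)).
  (* [j] is the number of turns of the cycle, possibly zero; every turn reads only cells before the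
     mark. *)
  move=> L /fits_upd[/Hr /= H /(_ ik) /andP[oL /dvdnP[j Ej]]].
  rewrite Eq Ehd; apply: goes_trans (H oL _ Ef) _.
  have -> : gap_base L i + L i = gap_base L i + o + j * m.+1 by lia.
  apply: goes_loop => j' lt; rewrite mulSn [m.+1 + _]addnC addnA.
  have := Hl (mem_of L g) (gap_base L i + o + j' * m.+1); rewrite Eq Ehd; apply=> y ym.
  rewrite -2!addnA mem_of_zero // => _.
  have : j' * m.+1 + m.+1 <= j * m.+1 by rewrite -mulSnr leq_mul2r lt orbT.
  by lia.
- case: Hs => ik [f Ef Hl]; case Et: (aut_trans _ _ _) => [[q' d] op].
  have St := stepE _ _ _ _ Et.
  have go mu x : mu x = aut_zero A -> goes mu ((q, hd), x) ((q', hd_move hd d), w15_move op x).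
    by move=> E; apply: goes_step; rewrite E.
  case: op Et St go => Et St go; case: j => // _ ->.
  + exists B, o, m; split=> //; split=> //; exists f => // mu x Hz.
    apply: goes_trans (Hl mu x Hz) _; rewrite addnS.
    by apply: go; apply: Hz.
  + exists B, o, m; split=> //; split=> //; exists f => // mu x Hz.
    apply: goes_trans (Hl mu x Hz) _.
    by apply: go; apply: Hz.
- have main : forall j0, j0 < size (let: (q', d, op) := aut_trans q (hd_syms hd) (g i) in
       match op with
        | MemStay => [:: (PMark, i, q', q0, g, HMove d, (None : lact k))]
        | MemPlus => [:: (PEnter, inord i.+1, q', q0, g, HMove d, (None : lact k))]
        | MemMinus => [:: (PEnter, ord0, q', q0, g, HMove d, (None : lact k))]
        end) -> log_inv (sc_apply (SConf (PMark, i, q, q0, g) hd fl lg) (nth (@sopt0 _ _ A k q_any) 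
        (let: (q', d, op) := aut_trans q (hd_syms hd) (g i) in
       match op with
        | MemStay => [:: (PMark, i, q', q0, g, HMove d, (None : lact k))]
        | MemPlus => [:: (PEnter, inord i.+1, q', q0, g, HMove d, (None : lact k))]
        | MemMinus => [:: (PEnter, ord0, q', q0, g, HMove d, (None : lact k))]
        end) j0)).
    move=> j0; case Et: (aut_trans _ _ _) => [[q' d] op]; have St := stepE _ _ _ _ Et.
    have go (L : nat -> nat) : goes (mem_of L g) ((q, hd), gap_base L i + L i)
        ((q', hd_move hd d), w15_move op (gap_base L i + L i)).
      by apply: goes_step; rewrite mem_of_mark.
    case: op Et St go => Et St go; case: j0 => // _; exists B, 0, 0; split=> //.
    + exact: log_keep El _ erefl.
    + move=> L /Hr /= H; rewrite inordK ?ltnS //=; exact: goes_trans H (go L).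
    + exact: log_keep El _ erefl.
    + by move=> L /Hr /= H; exact: goes_trans H (go L).
    + by move=> L /Hr /= H; exact: goes_trans H (go L).
  case: ifP => qacc; last by move=> js ->; apply: main.
  case: j => [_ ->|j js ->]; last exact: (main j).
  exists B, 0, 0; split=> // L /Hr /= H; by exists (gap_base L i + L i).
- by [].
Qed.

Lemma log_inv_start q_any : log_inv (@sc_start _ _ A k q_any w).
Proof. by exists (fun=> [::]), 0, 0; split=> // j; rewrite if_same. Qed.

Lemma log_inv_done (a : sconf A k w) : log_inv a -> (sc_st a).1.1.1.1 = PDone ->
  exists B, (forall j, sc_lg a j = log_word (B j)) /\
    ((forall j, all_meet (B j) (B j)) ->
     exists mu, sparse k (aut_zero A) mu /\ aut_accepts w mu).
Proof.
case: a => [[[[[ph i] q] q0] g] hd fl lg] [B [o [m [El Hs Hr]]]] /= Ep.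
rewrite {}Ep /= in El Hs Hr; exists B; split=> [j|Hm]; first by rewrite El if_same cats0.
have ch (j : gap) : exists l, all (in_block l) (B j) := blocks_meet (Hm j).
have [L HL] : exists L : gap -> nat, forall j, all (in_block (L j)) (B j).
  (* Membership in blocks is boolean, so [xchoose] selects the lengths without a choice axiom. *)
  by exists (fun j => xchoose (ch j)) => j; exact: (xchooseP (ch j)).
pose L' x := L (inord x).
have F : fits L' B by move=> j _; rewrite /L' inord_val.
have [x [t Ht]] := Hr L' F; exists (mem_of L' g); split; first exact: mem_of_sparse.
by apply/aut_acceptsE; exists t; rewrite Ht.
Qed.

End Semantics.

(** * Short runs of the guessing machine *)

(** Pigeonhole: up to the least time at which the point is reached the orbit repeats nothing, since
    a repetition could be cut out. *)
Lemma short_orbit (T : finType) (f : T -> T) x s :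
  exists2 s', s' < #|T| & s' <= s /\ iter s' f x = iter s f x.
Proof.
have [s' Es mins] := ex_minnP (ex_intro (fun s' => iter s' f x == iter s f x) s (eqxx _)).
exists s'; last by rewrite (eqP Es) mins.
have inj : injective (fun i : 'I_s'.+1 => iter i f x).
  suff H (i j : 'I_s'.+1) : i < j -> iter i f x <> iter j f x.
    move=> i j E; apply/val_inj; case: (ltngtP i j) => // lt; first by case: (H _ _ lt).
    by case: (H _ _ lt).
  move=> ij E; have js := ltn_ord j.
  have := mins (s' - j + i); rewrite iterD E -iterD subnK; last by lia.
  by rewrite Es => /(_ isT); lia.
by have := leq_card _ inj; rewrite card_ord.
Qed.

Section Complete.
Variables (Sigma : finType) (h : nat) (A : automaton Sigma h) (k : nat) (w : seq Sigma).
Local Notation Q := (aut_state A).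
Local Notation Delta := (aut_mem A).
Local Notation gap := 'I_k.+1.
Local Notation n := (size w).
Local Notation heads := {ffun 'I_h -> 'I_n.+2}.
Local Notation conf := (Q * heads)%type.
Variable (q_any : Q).
Local Notation zero := (aut_zero A).
Local Notation mstep := (@mem_step Sigma h A w).

(** The motion on zeros does not depend on the cell, so it is a map on a finite set. The bit records
    that the last move entered a new cell and separates the [Fresh] from the [Zero] phases. *)
Definition zf (z : conf * bool) : conf * bool :=
  ((mstep zero z.1).1, if (mstep zero z.1).2 is MemPlus then true else false).

Definition minus_at (c : conf) := if (mstep zero c).2 is MemMinus then true else false.

Fixpoint zcount (z : conf * bool) (s : nat) : nat :=
  if s is s'.+1 then z.2 + zcount (zf z) s' else 0.

Fixpoint zoff (z : conf * bool) (s : nat) : nat :=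
  if s is s'.+1 then (zf z).2 + zoff (zf z) s' else 0.

(** [zcount] counts logged zeros and [zoff] plus moves. A zero is logged only when its fresh phase
    is left, and the two bits account for this delay. *)
Lemma zcount_off z s : zcount z s + (iter s zf z).2 = z.2 + zoff z s.
Proof.
elim: s z => [|s IH] z; first by rewrite /= addn0.
rewrite iterSr -[zcount z s.+1]/(z.2 + zcount (zf z) s).
by rewrite -[zoff z s.+1]/((zf z).2 + zoff (zf z) s) -addnA IH.
Qed.

Lemma zoff_add z s t : zoff z (s + t) = zoff z s + zoff (iter s zf z) t.
Proof.
elim: s z => // s IH z; rewrite addSn iterSr.
by rewrite -[zoff z (s + t).+1]/((zf z).2 + zoff (zf z) (s + t)) IH addnA.
Qed.

Definition at_s (a : sconf A k w) (st : sstate A k) (hd : heads) (fl : option heads)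
    (l : gap -> seq lsym) :=
  [/\ sc_st a = st, sc_hd a = hd, sc_fl a = fl & forall j, sc_lg a j = l j].

Inductive sreach (a : sconf A k w) : nat -> sconf A k w -> Prop :=
| sreach0 : sreach a 0 a
| sreachS t b c : sreach a t b -> sstep q_any b c -> sreach a t.+1 c.

Lemma sreach_trans a b c t t' : sreach a t b -> sreach b t' c -> sreach a (t + t') c.
Proof.
move=> H; elim=> [|{}t' b1 c1 _ IH st]; first by rewrite addn0.
by rewrite addnS; apply: sreachS IH st.
Qed.

Definition within (a : sconf A k w) (K : nat) (P : sconf A k w -> Prop) :=
  exists t b, [/\ t <= K, sreach a t b & P b].

Lemma within_trans a K1 K2 (P P' : sconf A k w -> Prop) :
  within a K1 P -> (forall b, P b -> within b K2 P') -> within a (K1 + K2) P'.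
Proof.
case=> t [b [tK rb Pb]] H; have [t' [c [tK' rc Pc]]] := H b Pb.
by exists (t + t'), c; split=> //; [rewrite leq_add | apply: sreach_trans rb rc].
Qed.

Lemma within_refl a K (P : sconf A k w -> Prop) : P a -> within a K P.
Proof. by exists 0, a; split=> //; exact: sreach0. Qed.

Lemma within_le a K K' (P P' : sconf A k w -> Prop) :
  within a K P -> K <= K' -> (forall b, P b -> P' b) -> within a K' P'.
Proof.
by case=> t [b [tK rb Pb]] KK H; exists t, b; split; [exact: leq_trans tK KK | | exact: H].
Qed.

Definition wr (l : gap -> seq lsym) (i : gap) (s : seq lsym) (j : gap) : seq lsym :=
  if j == i then l j ++ s else l j.

Definition flagged (fl : option heads) (hd : heads) : bool :=
  [forall r, if fl is Some f then f r == hd r :> nat else false].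

Lemma step_s a st hd fl l o j : at_s a st hd fl l ->
    j < size (sopt st (hd_syms hd) (flagged fl hd)) ->
    nth (@sopt0 _ _ A k q_any) (sopt st (hd_syms hd) (flagged fl hd)) j = o ->
  within a 1 (fun b => at_s b o.1.1
    (if o.1.2 is HMove d then hd_move hd d else hd)
    (match o.1.2 with HFlag => Some hd | HUnflag => None | _ => fl end)
    (if o.2 is Some (i, s) then wr l i [:: s] else l)).
Proof.
case: a => st' hd' fl' lg' [/= -> -> -> El] js <-; set o' := nth _ _ _.
exists 1, (sc_apply (SConf st hd fl lg') o'); split=> //.
  by apply: (sreachS (sreach0 _)); exists j.
split=> //= i; case: o'.2 => [[i' s]|] //; rewrite /wr El.
by case: (i == i'); rewrite ?cats1.
Qed.

Definition zphase (C : bool) (b : bool) : sphase :=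
  if b then (if C then PFreshC else PFresh) else (if C then PZeroC else PZero).

Lemma at_s_ext a st hd fl l l' : (forall j, l j = l' j) -> at_s a st hd fl l -> at_s a st hd fl l'.
Proof. by move=> E [? ? ? El]; split=> // j; rewrite El E. Qed.

Lemma wr_wr l i s1 s2 j : wr (wr l i s1) i s2 j = wr l i (s1 ++ s2) j.
Proof. by rewrite /wr; case: (j == i); rewrite ?catA. Qed.

Lemma wr_nil l i j : wr l i [::] j = l j.
Proof. by rewrite /wr cats0 if_same. Qed.

Lemma commit_s C a (i : gap) c q0 g fl l :
    at_s a (zphase C true, i, c.1, q0, g) c.2 fl l ->
  within a 1 (fun b => at_s b (zphase C false, i, c.1, q0, g) c.2 fl (wr l i [:: SZero])).
Proof. by case: C => H; exact: (@step_s _ _ _ _ _ _ 0 H isT erefl). Qed.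

Lemma zero_s C a (i : gap) c q0 g fl l :
    at_s a (zphase C false, i, c.1, q0, g) c.2 fl l -> ~~ minus_at c ->
  within a 1 (fun b => at_s b (zphase C (zf (c, true)).2, i, (zf (c, true)).1.1, q0, g)
    (zf (c, true)).1.2 fl l).
Proof.
case: c => q hd /= H; rewrite /minus_at /zf /mem_step /=.
case: C H => H; rewrite /zphase in H.
- have := step_s H; rewrite /sopt /auto_step /=; case: aut_trans => [[q' d] op] St /=.
  by case: op St => // St _; exact: (St _ 0 isT erefl).
- have := step_s H; rewrite /sopt /auto_step /=; case: aut_trans => [[q' d] op] St /=.
  case: op St => // St _; case: ifP St => _ St;
    by first [exact: (St _ 1 isT erefl) | exact: (St _ 0 isT erefl)].
Qed.

(** One automaton step costs at most two: declaring the cell zero, then moving. *)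
Lemma zrun_s C (z : conf * bool) s a (i : gap) q0 g fl l :
    at_s a (zphase C z.2, i, z.1.1, q0, g) z.1.2 fl l ->
    (forall j, j < s -> ~~ minus_at (iter j zf z).1) ->
  within a (2 * s) (fun b => at_s b (zphase C (iter s zf z).2, i, (iter s zf z).1.1, q0, g)
    (iter s zf z).1.2 fl (wr l i (nseq (zcount z s) SZero))).
Proof.
elim: s z a l => [|s IH] z a l H nm.
  by apply: within_refl; apply: at_s_ext H => j; rewrite wr_nil.
have st1 : within a 2 (fun b => at_s b (zphase C (zf z).2, i, (zf z).1.1, q0, g)
    (zf z).1.2 fl (wr l i (nseq z.2 SZero))).
  case: z H nm => c [] /= H nm.
    by apply: within_trans (commit_s H) _ => b Hb; apply: (zero_s Hb); apply: (nm 0).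
  apply: within_le (zero_s H (nm 0 isT)) _ _ => // b Hb.
  by apply: at_s_ext Hb => j; rewrite wr_nil.
rewrite mulnS; apply: within_trans st1 _ => b Hb.
have nm' j : j < s -> ~~ minus_at (iter j zf (zf z)).1 by move=> js; rewrite -iterSr; apply: nm.
have := IH _ _ _ Hb nm'; rewrite -!iterSr => W.
apply: within_le W (leqnn _) _ => b' Hb'; apply: at_s_ext Hb' => j.
by rewrite wr_wr -nseqD.
Qed.

Section Memory.
Variables (mu : nat -> Delta) (L : nat -> nat) (g : {ffun gap -> Delta}).
Hypothesis mu_zero : forall (i : gap) o, (i < k -> o < L i) -> mu (gap_base L i + o) = zero.
Hypothesis mu_mark : forall i : gap, i < k -> mu (gap_base L i + L i) = g i.
Local Notation gb := (gap_base L).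
Local Notation N2 := #|{: conf * bool}|.

Lemma real_zrun (i : gap) (z : conf * bool) s :
    (forall j, j < s -> ~~ minus_at (iter j zf z).1 /\ (i < k -> zoff z j < L i)) ->
  iter s (cell_step mu) (z.1, gb i) = ((iter s zf z).1, gb i + zoff z s).
Proof.
elim: s => [|s IH] H; first by rewrite addn0.
rewrite iterS IH => [|j js]; last by apply: H; apply: ltnW.
have [nm lt] := H s (ltnSn s).
have -> : zoff z s.+1 = zoff z s + zoff (iter s zf z) 1 by rewrite -zoff_add addn1.
rewrite iterS; move: (iter s zf z) nm => zs; rewrite /cell_step /= mu_zero // /minus_at /zf addn0.
by case: (mem_step _ _) => [c' []] //= _; rewrite ?addn0 ?addn1 ?addnS.
Qed.

(** Blocks of a gap before the last contain its true length, and those of the last gap are rays;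
    either way they meet pairwise. *)
Definition block_ok (j : gap) (b : block) :=
  if j < k then in_block (L j) b else if b is BGe _ then true else false.

Definition good (l : gap -> seq lsym) := exists B : gap -> seq block,
  (forall j, l j = log_word (B j)) /\ forall j, all (block_ok j) (B j).

Lemma good_wr l i b s : good l -> block_ok i b -> s = enc b -> good (wr l i s).
Proof.
case=> B [El HB] ok ->; exists (fun j => if j == i then rcons (B j) b else B j).
split=> j; rewrite ?/wr ?El; case: eqP => [E|_] //; first by rewrite log_word_rcons.
by rewrite all_rcons HB E ok.
Qed.

Lemma good_ext l l' : (forall j, l j = l' j) -> good l -> good l'.
Proof. by move=> E [B [El HB]]; exists B; split=> // j; rewrite -E. Qed.

Definition mark_at b (i : gap) (c : conf) :=
  exists q0 l, at_s b (PMark, i, c.1, q0, g) c.2 None l /\ good l.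

Lemma zoff_iter z p j : iter p zf z = z -> zoff z (j * p) = j * zoff z p.
Proof.
move=> E; elim: j => // j IH; rewrite mulSn zoff_add E IH mulSn; lia.
Qed.

Lemma iter_mul_fix T (f : T -> T) x p j : iter p f x = x -> iter (j * p) f x = x.
Proof. by move=> E; elim: j => // j IH; rewrite mulSn iterD IH. Qed.

(** Let [s1] be an early time with the same configuration as the arrival at the mark. If it is the
    arrival, the crossing is short and logged as a point. Otherwise the configuration recurs with a
    least period [p], at most [N2], that divides the remaining time; [s1] steps and one period then
    describe the whole crossing. *)
Lemma reach_mark a (i : gap) c q0 l e : good l -> i < k ->
    at_s a (PFresh, i, c.1, q0, g) c.2 None (wr l i [:: SBegin]) ->
    (forall j, j < e -> ~~ minus_at (iter j zf (c, true)).1 /\ zoff (c, true) j < L i) ->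
    (iter e zf (c, true)).2 -> zoff (c, true) e = L i ->
  within a (4 * N2 + 3) (fun b => mark_at b i (iter e zf (c, true)).1).
Proof.
move=> gl ik Ha He fe Eo; set z0 := (c, true) in He fe Eo *.
have [s1 s1N' [s1e Es1]] := short_orbit zf z0 e; have s1N : s1 < N2 by exact: s1N'.
have nm j : j < s1 -> ~~ minus_at (iter j zf z0).1.
  by move=> js; have [] := He j (leq_trans js s1e).
have R1 := @zrun_s false z0 s1 a i q0 g None _ Ha nm.
have C1 : zcount z0 s1 = zoff z0 s1.
  by have := zcount_off z0 s1; rewrite Es1 fe /=; lia.
rewrite Es1 fe C1 /zphase in R1.
case Ed: (iter e zf z0) fe R1 Es1 => [d fd] /= Efd R1 Es1; rewrite Efd in Ed Es1.
have [E|ne] := eqVneq s1 e.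
  apply: (within_le (K := 2 * s1 + 1) (P := fun b => mark_at b i d)) => //; last by lia.
  apply: within_trans R1 _ => b Hb.
  have := @step_s _ _ _ _ _ _ 1 Hb; rewrite /sopt ik => /(_ _ isT erefl) W.
  apply: within_le W (leqnn _) _ => b' Hb'; exists q0; eexists; split; first exact: Hb'.
  apply: (good_ext (l := wr l i (enc (BExact (L i))))).
    by move=> j; rewrite !wr_wr E Eo.
  by apply: good_wr gl _ erefl; rewrite /block_ok ik /= eqxx.
have lt : s1 < e by lia.
set zd := (d, true) in Ed Es1.
have Efix : iter (e - s1) zf zd = zd.
  by rewrite -{1}Es1 -iterD subnK; [exact: Ed | exact: ltnW].
have exp : exists p, (0 < p) && (iter p zf zd == zd).
  by exists (e - s1); rewrite subn_gt0 lt Efix eqxx.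
have [p /andP[p0 /eqP Ep] minp] := ex_minnP exp.
have pe : p <= e - s1 by apply: minp; rewrite subn_gt0 lt Efix eqxx.
have pN : p <= N2.
  have [s' s'N [s'p Es']] := short_orbit zf (zf zd) p.-1.
  apply: leq_trans s'N; apply: minp => /=.
  by rewrite -iterS iterSr Es' -iterSr prednK // Ep eqxx.
have dvp : p %| e - s1.
  rewrite /dvdn; apply/negPn/negP => r0; have := ltn_pmod (e - s1) p0.
  rewrite ltnNge => /negP[]; apply: minp; rewrite lt0n r0 /=; apply/eqP.
  have := Efix; rewrite {1}(divn_eq (e - s1) p) addnC iterD.
  by rewrite (iter_mul_fix _ Ep).
have [jj Ejj] := dvdnP dvp.
have Em : L i = zoff z0 s1 + jj * zoff zd p.
  by rewrite -Eo -(subnKC (ltnW lt)) zoff_add Es1 Ejj zoff_iter.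
(* A period without progress would never bring the walk to the mark. *)
have m0 : 0 < zoff zd p by have [_] := He s1 lt; case: (zoff zd p) Em => [|m] //; lia.
have nmc j : j < p -> ~~ minus_at (iter j zf zd).1.
  by move=> jp; have [] := He (j + s1) _; [lia | rewrite iterD Es1].
(* The guessed cycle begins in [PZeroC], with fresh bit [false] where the orbit has [true]. The
   difference vanishes after one step and saves one logged zero, hence the predecessor in [BCyc]. *)
have itE j : 0 < j -> iter j zf (d, false) = iter j zf zd by case: j => // j _; rewrite !iterSr.
have offE : zoff (d, false) p = zoff zd p by case: (p) p0.
have C2 : zcount (d, false) p = (zoff zd p).-1.
  by have := zcount_off (d, false) p; rewrite itE // Ep offE /=; lia.
apply: (within_le (K := 2 * s1 + (1 + (2 * p + 1))) (P := fun b => mark_at b i d)) => //; last by lia.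
apply: within_trans R1 _ => b Hb.
have := @step_s _ _ _ _ _ _ 2 Hb; rewrite /sopt ik => /(_ _ isT erefl) W.
apply: within_trans W _ => b' Hb'.
have nm2 j : j < p -> ~~ minus_at (iter j zf (d, false)).1.
  by case: j => [|j] jp; [apply: (nmc 0) | rewrite itE //; apply: nmc].
have R2 := @zrun_s true (d, false) p b' i d.1 g (Some d.2) _ Hb' nm2.
rewrite itE // Ep C2 in R2; apply: within_trans R2 _ => b2 Hb2.
have fl : flagged (Some d.2) d.2 by apply/forallP => r.
have := @step_s _ _ _ _ _ _ 1 Hb2; rewrite /sopt /= fl eqxx => /(_ _ isT erefl) W2.
apply: within_le W2 (leqnn _) _ => b3 Hb3; exists d.1; eexists; split; first exact: Hb3.
apply: (good_ext (l := wr l i (enc (BCyc (zoff z0 s1) (zoff zd p).-1)))).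
  by move=> j; rewrite !wr_wr; congr (wr l i _ j); rewrite /enc /block_tail -?cats1 -?catA /= -?catA.
apply: good_wr gl _ erefl; rewrite /block_ok ik /= prednK // Em leq_addr addKn.
exact: dvdn_mull.
Qed.

Definition entry_at b (i : gap) (c : conf) :=
  exists q0 l, at_s b (PEnter, i, c.1, q0, g) c.2 None l /\ good l.

Definition done_at b :=
  exists (i : gap) (c : conf) q0 l, at_s b (PDone, i, c.1, q0, g) c.2 None l /\ good l.

Definition acc_in t (c : conf) x := (iter t (cell_step mu) (c, x)).1.1 \in aut_acc A.

Definition progress t b := done_at b \/
  exists (i : gap) (c : conf) t', [/\ t' < t, entry_at b i c & acc_in t' c (gb i)].

Definition stays (a : Delta) (c : conf) := if (mstep a c).2 is MemStay then true else false.

Lemma mark_run (i : gap) c l q0 s a : at_s a (PMark, i, c.1, q0, g) c.2 None l ->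
    (forall j, j < s -> stays (g i) (iter j (fun c => (mstep (g i) c).1) c)) ->
  within a s (fun b => at_s b (PMark, i, (iter s (fun c => (mstep (g i) c).1) c).1, q0, g)
     (iter s (fun c => (mstep (g i) c).1) c).2 None l).
Proof.
elim: s c a => [|s IH] c a H st; first exact: within_refl.
have W : within a 1 (fun b => at_s b (PMark, i, (mstep (g i) c).1.1, q0, g)
    (mstep (g i) c).1.2 None l).
  have := st 0 isT; have := step_s H; rewrite /stays /sopt /auto_step /= /mem_step.
  case: c {H st} => q hd /=; case: aut_trans => [[q' d] op] St /=.
  case: op St => // St _; case: ifP St => _ St;
    by first [exact: (St _ 1 isT erefl) | exact: (St _ 0 isT erefl)].
rewrite -add1n; apply: within_trans W _ => b Hb; rewrite add1n iterSr.
by apply: IH Hb _ => j js; rewrite -iterSr; apply: st.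
Qed.

Lemma visit_mark b (i : gap) c t : i < k -> mark_at b i c -> acc_in t c (gb i + L i) ->
  within b (N2 + 1) (progress t).
Proof.
move=> ik [q0 [l [Hb gl]]] Ht; pose mf c := (mstep (g i) c).1.
pose ev s := ((iter s mf c).1 \in aut_acc A) || ~~ stays (g i) (iter s mf c).
have real s : (forall j, j < s -> ~~ ev j) ->
    iter s (cell_step mu) (c, gb i + L i) = (iter s mf c, gb i + L i).
  elim: s => // s IH H; rewrite iterS IH => [|j js]; last by apply: H; apply: ltnW.
  have := H s (ltnSn s); rewrite /ev negb_or negbK => /andP[_]; rewrite iterS.
  move: (iter s mf c) => c1; rewrite /stays /cell_step /= mu_mark // /mf.
  by case: (mem_step _ _) => [c2 []].
have exev : exists s, ev s && (s <= t).
  case: (boolP [exists s : 'I_t.+1, ev s]) => [/existsP[s es]|/existsPn no].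
    by exists s; rewrite es -ltnS /=.
  have nev j : j < t.+1 -> ~~ ev j by move=> jt; apply: (no (Ordinal jt)).
  exists t; rewrite leqnn andbT /ev; move: Ht; rewrite /acc_in real => [->//|j jt].
  by apply: nev; apply: ltnW.
have [e /andP[ee et] mine] := ex_minnP exev.
have nev j : j < e -> ~~ ev j.
  by move=> je; apply/negP => ej; have := mine j; rewrite ej => /(_ _)/wrap[]; lia.
have eN : e < N2.
  have [s' s'N [s'e Es']] := short_orbit mf c e.
  have : e <= s' by apply: mine; rewrite /ev Es' -/(ev e) ee; lia.
  by move: s'N; rewrite !card_prod card_bool; lia.
have Er := real e nev.
have nst j : j < e -> stays (g i) (iter j mf c).
  by move=> je; have := nev j je; rewrite /ev negb_or negbK => /andP[].
apply: (within_le (K := e + 1) (P := progress t)) => //; last by lia.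
apply: within_trans (mark_run Hb nst) _ => b1; rewrite -/mf.
have Ht2 : acc_in (t - e) (iter e mf c) (gb i + L i).
  by move: Ht; rewrite /acc_in -{1}(subnK et) iterD Er.
rewrite /ev in ee; move: (iter e mf c) ee Ht2 {Er nev nst} => [q hd] ee Ht2 Hb1.
have := step_s Hb1; rewrite /sopt /auto_step /=.
case: (boolP (q \in aut_acc A)) => [qa|qn] St.
  apply: within_le (St _ 0 isT erefl) (leqnn _) _ => b2 Hb2; left.
  by exists i, (q, hd), q0, l.
move: ee; rewrite /= (negbTE qn) /= /stays /mem_step /=.
have [d Ed] : exists d, t - e = d.+1.
  by case E: (t - e) Ht2 => [|d]; [rewrite /acc_in /= (negbTE qn) | exists d].
move: Ht2; rewrite Ed /acc_in iterSr /cell_step /= mu_mark // /mem_step /=.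
case: aut_trans St => [[q' d'] op] /= St; case: op St => // St Ha _.
- apply: within_le (St _ 0 isT erefl) (leqnn _) _ => b2 Hb2; right.
  exists (inord i.+1), (q', hd_move hd d'), d; split; [by lia | by exists q0, l |].
  by rewrite /acc_in inordK.
- apply: within_le (St _ 0 isT erefl) (leqnn _) _ => b2 Hb2; right.
  by exists ord0, (q', hd_move hd d'), d; split; [by lia | by exists q0, l |].
Qed.

(** The first event decides the block: arrival at the mark gives a point or a cycle, acceptance or a
    minus move before it gives a ray. In the latter case the event comes within [N2] steps, since an
    earlier visit of the same configuration would show it already. *)
Lemma visit a (i : gap) c t : entry_at a i c -> acc_in t c (gb i) ->
  within a (7 * N2 + 8) (progress t).
Proof.
case=> q0 [l [Ha gl]] Ht; pose z0 := (c, true).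
pose mark s := (i < k) && (L i <= zoff z0 s).
pose ev s := [|| (iter s zf z0).1.1 \in aut_acc A, minus_at (iter s zf z0).1 | mark s].
have nevE s : ~~ ev s -> [/\ (iter s zf z0).1.1 \notin aut_acc A,
    ~~ minus_at (iter s zf z0).1 & i < k -> zoff z0 s < L i].
  rewrite /ev !negb_or => /and3P[h1 h2 h3]; split=> // ik; move: h3.
  by rewrite /mark ik /= -ltnNge.
have real s : (forall j, j < s -> ~~ ev j) ->
    iter s (cell_step mu) (c, gb i) = ((iter s zf z0).1, gb i + zoff z0 s).
  by move=> H; apply: (@real_zrun i z0) => j js; have [] := nevE j (H j js).
have exev : exists s, ev s && (s <= t).
  case: (boolP [exists s : 'I_t.+1, ev s]) => [/existsP[s es]|/existsPn no].
    by exists s; rewrite es -ltnS /=.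
  have nev j : j < t.+1 -> ~~ ev j by move=> jt; apply: (no (Ordinal jt)).
  exists t; rewrite leqnn andbT /ev; move: Ht; rewrite /acc_in real => [->//|j jt].
  by apply: nev; apply: ltnW.
have [e /andP[ee et] mine] := ex_minnP exev.
have nev j : j < e -> ~~ ev j.
  by move=> je; apply/negP => ej; have := mine j; rewrite ej (ltnW (leq_trans je et)) => /(_ isT); lia.
have Er := real e nev.
have Ht2 : acc_in (t - e) (iter e zf z0).1 (gb i + zoff z0 e).
  by move: Ht; rewrite /acc_in -{1}(subnK et) iterD Er.
have W1 : within a 1 (fun b => at_s b (PFresh, i, c.1, q0, g) c.2 None (wr l i [:: SBegin])).
  exact: (@step_s _ _ _ _ _ _ 0 Ha isT erefl).
case: (boolP (mark e)) => [/andP[ik me]|nm].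
  have [fe Eo] : (iter e zf z0).2 /\ zoff z0 e = L i.
    case: (e) nev me => [|e'] nev me; first by move: me; rewrite /= leqn0 => /eqP ->.
    have [_ _ /(_ ik) lt] := nevE e' (nev e' (ltnSn e')).
    have : zoff z0 e'.+1 = zoff z0 e' + (zf (iter e' zf z0)).2.
      by rewrite -addn1 zoff_add /= addn0.
    by rewrite iterS; case: (zf _).2; move: me => /=; lia.
  have He j : j < e -> ~~ minus_at (iter j zf z0).1 /\ zoff z0 j < L i.
    by move=> je; have [_ ? /(_ ik)] := nevE j (nev j je).
  apply: (within_le (K := 1 + ((4 * N2 + 3) + (N2 + 1))) (P := progress t)) => //; last by lia.
  apply: within_trans W1 _ => b Hb.
  apply: within_trans (reach_mark gl ik Hb He fe Eo) _ => b1 Hb1.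
  rewrite Eo in Ht2; apply: within_le (visit_mark ik Hb1 Ht2) (leqnn _) _ => b2 [|[i' [c' [t' [? ? ?]]]]].
    by left.
  by right; exists i', c', t'; split=> //; lia.
have oL : i < k -> zoff z0 e < L i.
  by move=> ik; move: nm; rewrite /mark ik /= -ltnNge.
have eN : e < N2.
  have [s' s'N [s'e Es']] := short_orbit zf z0 e.
  have : e <= s'; last by move=> le; exact: leq_ltn_trans le s'N.
  apply: mine; rewrite (leq_trans s'e et) andbT /ev Es'; move: ee; rewrite /ev (negbTE nm) orbF.
  by case/orP => ->; rewrite ?orbT.
have nmj j : j < e -> ~~ minus_at (iter j zf z0).1 by move=> /nev/nevE[].
apply: (within_le (K := 1 + (2 * e + (1 + 1))) (P := progress t)) => //; last by lia.
apply: within_trans W1 _ => b Hb.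
apply: within_trans (@zrun_s false z0 e b i q0 g None _ Hb nmj) _ => b1 Hb1.
have Cz := zcount_off z0 e; have E1 : zcount z0 e + (iter e zf z0).2 = (zoff z0 e).+1 by rewrite Cz.
have W2 : within b1 1 (fun b => at_s b (PZero, i, (iter e zf z0).1.1, q0, g) (iter e zf z0).1.2 None
    (wr l i (SBegin :: nseq (zoff z0 e).+1 SZero))).
  case: (iter e zf z0) E1 Hb1 => d [] /= E1 Hb1.
    apply: within_le (commit_s (C := false) Hb1) (leqnn _) _ => b' Hb'; apply: at_s_ext Hb' => j.
    rewrite !wr_wr; congr (wr l i _ j); move: E1; rewrite addn1 => -[->].
    by rewrite -[SZero :: nseq _ _]/(nseq (zoff z0 e).+1 SZero) -addn1 nseqD.
  apply: within_refl; apply: at_s_ext Hb1 => j; rewrite !wr_wr; congr (wr l i _ j).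
  by move: E1; rewrite addn0 => ->.
apply: within_trans W2 _ => b2 Hb2.
have gd : good (wr l i (rcons (SBegin :: nseq (zoff z0 e).+1 SZero) SGe)).
  apply: good_wr gl _ (enc_ge (zoff z0 e) 0); rewrite /block_ok; case: ifP => // /oL.
have gd' : good (wr (wr l i (SBegin :: nseq (zoff z0 e).+1 SZero)) i [:: SGe]).
  by apply: good_ext gd => j; rewrite wr_wr cats1.
have ee2 : ((iter e zf z0).1.1 \in aut_acc A) || minus_at (iter e zf z0).1.
  by move: ee; rewrite /ev (negbTE nm) orbF.
case Ez: (iter e zf z0) ee2 Ht2 Hb2 => [[q hd] fb] /= ee2 Ht2 Hb2.
have := step_s Hb2; rewrite /sopt /auto_step /=.
case: (boolP (q \in aut_acc A)) => [qa|qn] St.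
  apply: within_le (St _ 0 isT erefl) (leqnn _) _ => b3 Hb3; left.
  by exists i, (q, hd), q0; eexists; split; first exact: Hb3.
move: ee2; rewrite (negbTE qn) /= /minus_at /mem_step /=.
have [d Ed] : exists d, t - e = d.+1.
  by case E: (t - e) Ht2 => [|d]; [rewrite /acc_in /= (negbTE qn) | exists d].
move: Ht2; rewrite Ed /acc_in iterSr /cell_step /= mu_zero // /mem_step /=.
case: aut_trans St => [[q' d'] op] /= St; case: op St => // St Hacc _.
apply: within_le (St _ 0 isT erefl) (leqnn _) _ => b3 Hb3; right.
exists ord0, (q', hd_move hd d'), d; split; [by lia | | exact: Hacc].
by exists q0; eexists; split; first exact: Hb3.
Qed.

Definition accepting_entries t : {set gap * conf} :=
  [set x : gap * conf | [exists s : 'I_t.+1, acc_in s x.2 (gb x.1)]].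

(** With the least accepting time [t0] of the current entry, the next entry accepts in less than
    [t0] steps, so the current pair of gap and configuration leaves the set for good. Hence there
    are at most as many crossings as such pairs, however long the run. *)
Lemma all_visits t a (i : gap) c : entry_at a i c -> acc_in t c (gb i) ->
  within a (#|accepting_entries t| * (7 * N2 + 8)) done_at.
Proof.
set K := 7 * N2 + 8.
elim/ltn_ind: t a i c => t IH a i c Ha Ht.
have [t0 at0 min0] := ex_minnP (ex_intro (fun s => acc_in s c (gb i)) t Ht).
have t0t : t0 <= t by apply: min0.
have sub s s' : s <= s' -> accepting_entries s \subset accepting_entries s'.
  move=> ss'; apply/subsetP => x; rewrite !inE => /existsP[j Hj].
  have js : j < s'.+1 by have := ltn_ord j; lia.
  by apply/existsP; exists (Ordinal js).
have inW : (i, c) \in accepting_entries t0 by rewrite inE; apply/existsP; exists ord_max.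
have le := subset_leq_card (sub _ _ t0t).
have pos : 0 < #|accepting_entries t0| by apply/card_gt0P; exists (i, c).
have [s [b [sK rb [Db|[i' [c' [t' [t'0 Eb At']]]]]]]] := visit Ha at0.
  by exists s, b; split=> //; apply: leq_trans sK _; rewrite -/K; nia.
have [s' [b' [s'K rb' Db']]] := IH t' (leq_trans t'0 t0t) b i' c' Eb At'.
have lt : #|accepting_entries t'| < #|accepting_entries t0|.
  apply: proper_card; rewrite properE (sub _ _ (ltnW t'0)) /=.
  apply/subsetPn; exists (i, c) => //; rewrite inE; apply/existsPn => j.
  by apply/negP => /min0; have := ltn_ord j; lia.
exists (s + s'), b'; split=> //; last exact: sreach_trans rb rb'.
by rewrite -/K in sK; apply: leq_trans (leq_add sK s'K) _; nia.
Qed.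

End Memory.
End Complete.

(** * Simulation in nondeterministic polynomial time *)

Lemma gap_base_shift L p j :
  gap_base (fun i => if i is j'.+1 then L j' else p) j.+1 = p.+1 + gap_base L j.
Proof.
elim: j => [|j IH]; first by rewrite addn0.
by rewrite -[LHS]/((gap_base _ j.+1 + L j).+1) IH /=; lia.
Qed.

(** Peel off the least marked cell: it ends the first gap, and the memory behind it has one mark
    fewer. When the marks run out, the remaining gaps may have length 0. *)
Lemma sparse_layout (D : eqType) (z : D) k (mu : nat -> D) :
    (exists s : seq nat, size s <= k /\ forall x, mu x != z -> x \in s) ->
  exists L, forall i o, i <= k -> (i < k -> o < L i) -> mu (gap_base L i + o) = z.
Proof.
elim: k mu => [|k IH] mu [s [ss Hs]].
  exists (fun=> 0) => i o _ _; apply/eqP; apply/negPn/negP => /Hs.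
  by case: s ss {Hs}.
have [H0|H0] := Classical_Prop.classic (exists x, mu x != z); last first.
  by exists (fun=> 0) => i o _ _; apply/eqP; apply/negPn/negP => H; apply: H0; eexists; exact: H.
have [p np minp] := ex_minnP H0.
have [|L HL] := IH (fun x => mu (p.+1 + x)).
  exists [seq y - p.+1 | y <- s & y != p]; split.
    rewrite size_map size_filter; have := count_predC (pred1 p) s.
    have : 0 < count (pred1 p) s by rewrite -has_count has_pred1 Hs.
    by move=> c0 cs; rewrite -ltnS (leq_trans _ ss) // -cs -add1n leq_add2r.
  move=> x /Hs sx; apply/mapP; exists (p.+1 + x); last by rewrite addKn.
  by rewrite mem_filter sx andbT; apply/eqP; lia.
exists (fun i => if i is j.+1 then L j else p) => -[|i] o ik io.
  apply/eqP; apply/negPn/negP => H; have := minp _ H; have := io isT.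
  by rewrite /= add0n => ? ?; lia.
by rewrite gap_base_shift -addnA; apply: HL.
Qed.

Section Final.
Variables (Sigma : finType) (h : nat) (A : automaton Sigma h) (k : nat) (w : seq Sigma).
Local Notation gap := 'I_k.+1.
Local Notation q_any := (aut_init A).
Local Notation X := (guesser k q_any).

Lemma xm_reach_trans (c c1 c2 : xconfig X) t t' :
  xm_reach c t c1 -> xm_reach c1 t' c2 -> xm_reach c (t + t') c2.
Proof.
move=> H; elim=> [|{}t' c3 c4 _ IH st]; first by rewrite addn0.
by rewrite addnS; apply: xm_reachS IH st.
Qed.

Lemma sreach_size (a b : sconf A k w) t j : sreach q_any a t b ->
  size (sc_lg b j) <= size (sc_lg a j) + t.
Proof.
elim=> [|{}t b1 b2 _ IH [i _ ->]]; first by rewrite addn0.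
rewrite addnS; apply: leq_trans (_ : (size (sc_lg b1 j)).+1 <= _); last by rewrite ltnS.
rewrite /sc_apply /=; case: (nth _ _ _).2 => [[i' s]|] //.
by case: ifP; rewrite ?size_rcons.
Qed.

Lemma sreach_rep (c : xconfig X) (a b : sconf A k w) t : rep_sim c a -> flags_ok a ->
  sreach q_any a t b -> exists c', [/\ xm_reach c t c', rep_sim c' b & flags_ok b].
Proof.
move=> R ok; elim=> [|{}t b1 b2 _ [c1 [r1 R1 ok1]] st].
  by exists c; split=> //; exact: xm_reach0.
have [c2 st2 R2] := sim_forward R1 ok1 st.
exists c2; split=> //; [exact: xm_reachS r1 st2 | exact: flags_ok_step ok1 st].
Qed.

Lemma ver_path (c : xconfig X) lg i v p : rep_ver c lg i v -> path (vrel (lg i)) v p ->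
  exists2 c', xm_reach c (size p) c' & rep_ver c' lg i (last v p).
Proof.
elim: p c v => [|v' p IH] c v R /=; first by exists c => //; exact: xm_reach0.
case/andP=> st pp; have [c1 s1 R1] := ver_forward R st.
have [c2 r2 R2] := IH _ _ R1 pp; exists c2 => //.
by rewrite -add1n; apply: xm_reach_trans r2; apply: xm_reachS (xm_reach0 _) s1.
Qed.

Lemma ver_all (lg : gap -> seq lsym) (B : gap -> seq block) U (c : xconfig X) (i : gap) :
    (forall j, lg j = log_word (B j)) -> (forall j, all_meet (B j) (B j)) ->
    (forall j, size (lg j) <= U) ->
    rep_ver c lg i (V1, true, true, (size (lg i)).+1, (size (lg i)).+1) ->
  exists t c', [/\ t <= (k.+1 - i) * (32 * U.+2 ^ 2 + 1), xm_reach c t c' & xm_acc (xc_state c')].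
Proof.
move=> El Hm HU; move: {2}(k - i) (leqnn (k - i)) => d.
elim: d c i => [|d IH] c i di R.
all: have [p [pp lp sp]] := @verify_complete (B i) (Hm i) true true (size (lg i)).+1 (size (lg i)).+1 ltac:(by rewrite El) ltac:(by rewrite El).
all: rewrite -El in pp sp; have [c1 r1 R1] := ver_path R pp.
all: have b1 : size p <= 32 * U.+2 ^ 2 by apply: leq_trans sp _; rewrite leq_mul2l leq_exp2r // !ltnS HU orbT.
  exists (size p), c1; split=> //; first by have := ltn_ord i; nia.
  case: R1 => -> _ _ _ _ /=; rewrite lp eqxx andbT; apply/eqP/val_inj => /=.
  by have := ltn_ord i; lia.
have [ik|ki] := ltnP i k; last first.
  exists (size p), c1; split=> //; first by have := ltn_ord i; nia.
  case: R1 => -> _ _ _ _ /=; rewrite lp eqxx andbT; apply/eqP/val_inj => /=.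
  by have := ltn_ord i; lia.
have [c2 s2] := ver_next_forward R1 lp ik; have [_ R2] := ver_next R1 lp s2.
have Ei : (inord i.+1 : gap) = i.+1 :> nat by rewrite inordK.
have [|t [c3 [tb r3 acc]]] := IH c2 (inord i.+1) _ R2; first by rewrite Ei; lia.
exists (size p + 1 + t), c3; split=> //.
  rewrite Ei in tb; have -> : k.+1 - i = (k.+1 - i.+1).+1 by lia.
  by rewrite mulSn leq_add // leq_add.
by apply: xm_reach_trans r3; rewrite addn1; apply: xm_reachS r1 s2.
Qed.

Definition accepted_sparse := exists mu : nat -> aut_mem A,
  sparse k (aut_zero A) mu /\ aut_accepts w mu.

(** Once the log is complete, acceptance is conditional on all gaps passing the comparison; the gaps
    before [i] have passed. *)
Definition xinv (c : xconfig X) : Prop :=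
  (exists a : sconf A k w, [/\ rep_sim c a, flags_ok a & log_inv a]) \/
  exists (B : gap -> seq block) lg i v,
    [/\ forall j, lg j = log_word (B j), rep_ver c lg i v, vinv (B i) v,
        forall j : gap, j < i -> all_meet (B j) (B j)
      & (forall j, all_meet (B j) (B j)) -> accepted_sparse].

Lemma xinv_reach t c : xm_reach (xm_start X w) t c -> xinv c.
Proof.
elim=> [|{}t c1 c2 _ IH st].
  left; exists (@sc_start _ _ A k q_any w); split; [exact: rep_start | by [] | exact: log_inv_start].
case: IH => [[a [R ok inv]]|[B [lg [i [v [El R vi Hlt Hacc]]]]]].
  have [Ed|nd] := eqVneq (sc_st a).1.1.1.1 PDone.
    right; have [B [El Hacc]] := log_inv_done inv Ed.
    by exists B, (sc_lg a), ord0, (V1, true, true, (size (sc_lg a ord0)).+1, (size (sc_lg a ord0)).+1);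
      split=> //; apply: done_step R Ed st.
  have [a' sa R'] := sim_backward R ok (elimN eqP nd) st.
  left; exists a'; split=> //; [exact: flags_ok_step ok sa | exact: log_inv_step ok inv sa].
right; have [Ed|nd] := eqVneq v.1.1.1.1 VD.
  have [ik R'] := ver_next R Ed st.
  have Ei : (inord i.+1 : gap) = i.+1 :> nat by rewrite inordK.
  exists B, lg, (inord i.+1), (next_gap lg i).2; split=> // j; rewrite Ei ltnS leq_eqVlt.
  case/orP => [/eqP Ej|]; last exact: Hlt.
  have -> : j = i by apply/val_inj.
  by move: vi; case: v Ed {R st R'} => [[[[ph da] db] x] y] /= ->.
have [v' sv R'] := ver_step R (elimN eqP nd) st.
by exists B, lg, i, v'; split=> //; apply: vinv_step vi _; rewrite -El.
Qed.

Lemma guesser_sound t : xm_accepts_within X w t -> accepted_sparse.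
Proof.
case=> s [c [_ /xinv_reach inv acc]]; case: inv => [[a [[Es _ _ _ _] _ _]]|].
  by move: acc; rewrite Es.
case=> B [lg [i [v [El [Es _ _ _ _] vi Hlt Hacc]]]]; apply: Hacc => j.
move: acc; rewrite Es /= => /andP[/eqP Ei /eqP Ev].
have [ji|] := ltnP j i; first exact: Hlt.
rewrite Ei /= => kj; have -> : j = i by apply/val_inj; rewrite Ei /=; have := ltn_ord j; lia.
by move: vi; case: v Ev {Es} => [[[[ph da] db] x] y] /= ->.
Qed.

Local Notation conf := (aut_state A * {ffun 'I_h -> 'I_(size w).+2})%type.

(** One step guesses the mark symbols, then each pair of gap and configuration pays for at most one
    crossing. A step appends at most one symbol to a log, so this also bounds the logs compared in
    [total_time]. *)
Definition sim_time := 1 + k.+1 * #|{: conf}| * (7 * #|{: conf * bool}| + 8).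
Definition total_time := sim_time + 1 + k.+1 * (32 * sim_time.+2 ^ 2 + 1).

Lemma guesser_complete : accepted_sparse -> xm_accepts_within X w total_time.
Proof.
case=> mu [sp /aut_acceptsE[t Ht]].
have [L HL] := sparse_layout sp.
pose g : {ffun gap -> aut_mem A} := [ffun i : gap => mu (gap_base L i + L i)].
have mz (i : gap) o : (i < k -> o < L i) -> mu (gap_base L i + o) = aut_zero A.
  by apply: HL; rewrite -ltnS.
have mm (i : gap) : i < k -> mu (gap_base L i + L i) = g i by rewrite ffunE.
pose a0 := @sc_start _ _ A k q_any w.
have W0 : within q_any a0 1 (fun b => entry_at L g b ord0 (conf0 A w)).
  exists 1, (sc_apply a0 (PEnter, ord0, aut_init A, q_any, g, HNone h, None)); split=> //.
    apply: (sreachS (sreach0 _ _)); exists (index g (enum {: {ffun gap -> aut_mem A}})).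
      by rewrite /sc_opts /= size_map index_mem mem_enum.
    rewrite /sc_opts /= (nth_map g) ?index_mem ?mem_enum // nth_index ?mem_enum //.
  exists q_any, (fun=> [::]); split=> //.
  by exists (fun=> [::]).
have [s0 [b0 [s01 r0 Eb0]]] := W0.
have [s1 [b1 [s1b r1 [i [c [q0 [l [[Es1 Eh1 Ef1 El1] [B [ElB HB]]]]]]]]]] :=
  all_visits q_any mz mm Eb0 Ht.
have [c1 [x1 R1 ok1]] := sreach_rep (rep_start k q_any w) isT (sreach_trans r0 r1).
have Ed : (sc_st b1).1.1.1.1 = PDone by rewrite Es1.
have [c2 st2] := done_forward R1 Ed; have R2 := done_step R1 Ed st2.
have sb : s0 + s1 <= sim_time.
  rewrite leq_add // (leq_trans s1b) // leq_mul2r; apply/orP; right.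
  by apply: leq_trans (max_card _) _; rewrite card_prod card_ord.
have Hm j : all_meet (B j) (B j).
  move=> b b' bB b'B; have H1 := allP (HB j) _ bB; have H2 := allP (HB j) _ b'B.
  move: H1 H2; rewrite /block_ok; case: ifP => _ H1 H2; first by exists (L j); rewrite H1.
  by case: b b' H1 H2 {bB b'B} => // r [] // r' _ _; exists (maxn r r'); rewrite /= leq_maxl leq_maxr.
have HU j : size (sc_lg b1 j) <= sim_time.
  by apply: leq_trans (sreach_size j (sreach_trans r0 r1)) _; rewrite add0n.
have [|t3 [c3 [t3b r3 acc]]] := ver_all (B := B) _ Hm HU R2; first by move=> j; rewrite El1 ElB.
exists (s0 + s1 + 1 + t3), c3; split=> //; first by rewrite /total_time subn0 in t3b *; lia.
apply: xm_reach_trans r3; rewrite addn1; exact: xm_reachS x1 st2.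
Qed.

End Final.

(** [V] covers the configurations and [K] the gaps, so the simulation takes at most 16 K V^2 steps.
    The comparison squares this for each gap, which gives K^3 V^4; the constants are collected in
    2^20 = 32 * 32^3, and b >= 2 turns it into a power of [b]. *)
Lemma total_time_poly (Sigma : finType) (h : nat) (A : automaton Sigma h) k w :
  total_time A k w <=
    ((size w).+2 ^ (20 + 3 * k.+1 + 4 * (#|aut_state A| + h).+1)).-1.
Proof.
set b := (size w).+2; set q := #|aut_state A|.
have pow2 n : 2 ^ n <= b ^ n by case: n => // n; rewrite leq_exp2r.
have powb n : n < b ^ n by apply: leq_trans (ltn_expl n (isT : 1 < 2)) (pow2 n).
pose V := b ^ (q + h).+1; pose K := b ^ k.+1.
have hV : q * b ^ h * 2 <= V.
  by rewrite /V expnS expnD mulnC leq_mul // leq_mul // ltnW.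
have V1 : 0 < V by rewrite expn_gt0.
have Kk : k.+1 <= K by apply: ltnW; apply: powb.
have Ek : 2 ^ 20 * (K ^ 3 * V ^ 4) <= b ^ (20 + 3 * k.+1 + 4 * (q + h).+1).
  move: (pow2 20); move: {1 3}20 => e pe.
  rewrite !expnD -mulnA; apply: leq_mul => //; rewrite /K /V -!expnM.
  by rewrite [k.+1 * 3]mulnC [_.+1 * 4]mulnC.
have W1 : 0 < K * V ^ 2 by rewrite muln_gt0 !expn_gt0.
have st : sim_time A k w <= 16 * (K * V ^ 2).
  rewrite /sim_time !card_prod card_bool card_ffun !card_ord -/b -/q.
  move: hV Kk V1 W1; move: (q * b ^ h) => n hV Kk V1 W1.
  have B2 : k.+1 * n <= K * V by rewrite leq_mul //; lia.
  have B1 : 7 * (n * 2) + 8 <= 15 * V by lia.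
  apply: leq_trans (leq_add W1 (leq_mul B2 B1)) _.
  by rewrite -[V ^ 2]/(V * V); lia.
have E3 : K ^ 3 * V ^ 4 = K * (K * V ^ 2) ^ 2 by rewrite expnMn -expnM mulnA -expnS.
rewrite -ltnS prednK ?expn_gt0 //; apply: leq_trans Ek; rewrite E3 /total_time.
move: (sim_time A k w) (K * V ^ 2) st W1 => t W st W1.
have -> : 2 ^ 20 = 32 * 32 ^ 3 by rewrite -expnS -[in RHS](expnM 2 5 4).
have sq : t.+2 ^ 2 <= 32 ^ 2 * W ^ 2 by rewrite -expnMn leq_exp2r //; lia.
have B3 : k.+1 * (32 * t.+2 ^ 2 + 1) <= K * (32 ^ 3 * W ^ 2 + 1).
  by rewrite leq_mul // leq_add2r [32 ^ 3]expnS -mulnA leq_mul2l sq.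
have WW : W <= W ^ 2 by rewrite -[W ^ 2]/(W * W) leq_pmulr.
have KW : W ^ 2 <= K * W ^ 2 by rewrite leq_pmull //; lia.
have K1 : K <= K * W ^ 2 by rewrite leq_pmulr // expn_gt0 W1.
have C1 : 0 < 32 ^ 3 by rewrite expn_gt0.
move: B3; move: (32 ^ 3) C1 => C C1.
have -> : K * (C * W ^ 2 + 1) = C * (K * W ^ 2) + K by rewrite mulnDr muln1 mulnCA.
rewrite -mulnA; move: (W ^ 2) WW KW K1 => Y WW; move: (K * Y) => X KW K1.
have CX : X <= C * X by rewrite leq_pmull.
by move: (C * X) (k.+1 * _) CX => Z T CX B3; lia.
Qed.

Lemma R_W15_sub_NP (Sigma : finType) (k : nat) (L : seq Sigma -> Prop) :
  R_W15 (sparse k) L -> NP L.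
Proof.
case=> h [A HA].
apply: (@NP_of_clocked _ (guesser k (aut_init A))
  (19 + 3 * k.+1 + 4 * (#|aut_state A| + h).+1)) => w.
split=> [/HA acc|/guesser_sound acc]; last exact/HA.
have [s [c [sT r ac]]] := guesser_complete acc.
by exists s, c; split=> //; apply: leq_trans sT (total_time_poly _ _ _).
Qed.

Theorem theorem4 (k : nat) (hk : 1 <= k) (Sigma : finType)
    (L : seq Sigma -> Prop) :
  R_W15 (sparse k) L <-> NP L.
Proof.
by split; [exact: R_W15_sub_NP | exact: NP_sub_R_W15].
Qed.
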